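(* Let $m\ge 2$ be an integer and let $X\subset\mathbb{P}(V)$ be an irreducible subvariety. Then $X$ is Legendrian and contained in $Y$ if and only if $X$ is one of the following varieties: 1. $X=\psi_\mu(X_{\mathrm{inv}}(m))$ for some $\mu\in\mathbb{C}^*$, or 2. $X=X_{\mathrm{deg}}(m,k)$ for some $k\in\{0,1,\ldots,m\}$.
   Context: $V$ is the complex vector space of dimension $2m^2$ of pairs $(A,B)$ of complex $m\times m$ matrices; $\mathbb{P}(V)=(V\setminus\{0\})/\mathbb{C}^*$, and $[A,B]$ denotes the class of $(A,B)$. $V$ carries the symplectic form $\omega((A,B),(A',B'))=\operatorname{tr}(A(B')^T-A'B^T)$. A linear subspace $W\subset V$ is Lagrangian if it equals its $\omega$-perpendicular subspace (equivalently $\omega|_W\equiv 0$ and $\dim W=\tfrac12\dim V$). A subvariety $Z\subset V$ is Lagrangian if for every smooth point $z\in Z$ the tangent space $T_zZ\subset V$ is Lagrangian. A subvariety $X\subset\mathbb{P}(V)$ is Legendrian if its affine cone $\hat X\subset V$ is Lagrangian. $Y:=\{[A,B]\in\mathbb{P}(V) : AB^T=B^TA=\lambda^2\mathrm{Id}_m \text{ for some }\lambda\in\mathbb{C}\}$. $X_{\mathrm{inv}}(m):=\overline{\{[g,(g^{-1})^T]\in\mathbb{P}(V) : \det g=1\}}$ (closure in $\mathbb{P}(V)$). For $k\in\{0,1,\ldots,m\}$: $X_{\mathrm{deg}}(m,k):=\{[A,B]\in\mathbb{P}(V) : AB^T=B^TA=0,\ \operatorname{rk}A\le k,\ \operatorname{rk}B\le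 m-k\}$. For $\mu\in\mathbb{C}^*$, $\psi_\mu:\mathbb{P}(V)\to\mathbb{P}(V)$ is the automorphism $\psi_\mu([A,B])=[\mu A,\mu^{-1}B]$. *)

(* Defs.v *)
From HB Require Import structures.
From mathcomp Require Import all_boot all_order all_algebra.
From mathcomp Require Import generic_quotient.
From mathcomp Require Import boolp classical_sets reals.
From mathcomp Require Import complex mpoly.

Set Implicit Arguments.
Unset Strict Implicit.
Unset Printing Implicit Defensive.

Import GRing.Theory.
Local Open Scope ring_scope.
Local Open Scope classical_set_scope.
Local Open Scope quotient_scope.

(* The field of complex numbers is R[i], where R is any model of the reals. *)

Section AmbientSpaces.
Variables (R : realType) (m : nat).

Definition V : vectType R[i] := ('M[R[i]]_m * 'M[R[i]]_m)%type.

Definition omega (u v : V) : R[i] := \tr (u.1 *m v.2^T - v.1 *m u.2^T).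

Definition coord_dim : nat := (m * m + m * m)%N.

Definition coords (v : V) : 'I_coord_dim -> R[i] :=
  row_mx (mxvec v.1) (mxvec v.2) 0.

Definition polyV := {mpoly R[i][coord_dim]}.

Definition punctured := {v : V | v != 0}.

Definition proj_rel (u v : punctured) : bool :=
  `[< exists2 c : R[i], c != 0 & val v = c *: val u >].

Lemma proj_rel_refl : reflexive proj_rel.
Proof. by move=> u; apply/asboolP; exists 1; rewrite ?oner_neq0 ?scale1r. Qed.

Lemma proj_rel_sym : ssrbool.symmetric proj_rel.
Proof.
suff H u v : proj_rel u v -> proj_rel v u by move=> u v; apply/idP/idP; apply: H.
move=> /asboolP[c c0 e]; apply/asboolP; exists c^-1; first by rewrite invr_eq0.
by rewrite e scalerA mulVf // scale1r.
Qed.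

Lemma proj_rel_trans : transitive proj_rel.
Proof.
move=> v u w /asboolP[c c0 e] /asboolP[d d0 e']; apply/asboolP.
by exists (d * c); [rewrite mulf_neq0 | rewrite e' e scalerA].
Qed.

Canonical proj_equiv :=
  EquivRel proj_rel proj_rel_refl proj_rel_sym proj_rel_trans.

Definition PV := {eq_quot proj_equiv}.

Definition cls (v : V) (v0 : v != 0) : PV :=
  \pi_PV (exist (fun v : V => v != 0) v v0).

Lemma clsP (u v : V) (u0 : u != 0) (v0 : v != 0) :
  cls u0 = cls v0 <-> exists2 c : R[i], c != 0 & v = c *: u.
Proof.
split=> [/eqmodP/asboolP//|H].
by apply/eqmodP/asboolP.
Qed.

End AmbientSpaces.

Section AffineGeometry.
Variables (R : realType) (m : nat).
Implicit Types Z W : set (V R m).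

Definition affine_closed Z : Prop :=
  exists S : set (polyV R m),
    Z = [set z | forall p, S p -> p.@[coords z] = 0].

Definition affine_irreducible Z : Prop :=
  [/\ affine_closed Z, Z !=set0 &
      forall F G, affine_closed F -> affine_closed G ->
        Z `<=` F `|` G -> Z `<=` F \/ Z `<=` G].

Definition ideal_of Z : set (polyV R m) :=
  [set p | forall z, Z z -> p.@[coords z] = 0].

Definition tangent_space Z (z : V R m) : set (V R m) :=
  [set v | forall p, ideal_of Z p ->
     \sum_(i < coord_dim m) (p^`M(i)).@[coords z] * coords v i = 0].

Definition alg_independent_on W (d : nat) (f : 'I_d -> polyV R m) : Prop :=
  forall q : {mpoly R[i][d]},
    (forall w, W w -> q.@[fun i => (f i).@[coords w]] = 0) -> q = 0.

(* For W irreducible: the transcendence degree over the complex numbers of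
   the function field of W, i.e. of the fraction field of its coordinate
   ring. *)
Definition has_dim W (d : nat) : Prop :=
  (exists f : 'I_d -> polyV R m, alg_independent_on W f) /\
  (forall e (f : 'I_e -> polyV R m), alg_independent_on W f -> (e <= d)%N).

(* The largest dimension of an irreducible closed subset of Z through z. *)
Definition has_local_dim Z (z : V R m) (d : nat) : Prop :=
  (exists W, [/\ affine_irreducible W, W `<=` Z, W z & has_dim W d]) /\
  (forall W e, affine_irreducible W -> W `<=` Z -> W z -> has_dim W e ->
     (e <= d)%N).

Definition smooth_point Z (z : V R m) : Prop :=
  Z z /\
  exists T : {vspace V R m},
    (forall v, v \in T <-> tangent_space Z z v) /\ has_local_dim Z z (\dim T).

Definition Lagrangian_subspace (T : set (V R m)) : Prop :=
  T = [set u | forall t, T t -> omega u t = 0].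

Definition Lagrangian Z : Prop :=
  forall z, smooth_point Z z -> Lagrangian_subspace (tangent_space Z z).

End AffineGeometry.

Section ProjectiveGeometry.
Variables (R : realType) (m : nat).
Implicit Types X F G : set (PV R m).

Definition proj_closed X : Prop :=
  exists S : set (polyV R m),
    (forall p, S p -> exists d : nat, p \is d.-homog) /\
    (forall (v : V R m) (v0 : v != 0),
       X (cls v0) <-> forall p, S p -> p.@[coords v] = 0).

Definition proj_irreducible X : Prop :=
  [/\ proj_closed X, X !=set0 &
      forall F G, proj_closed F -> proj_closed G ->
        X `<=` F `|` G -> X `<=` F \/ X `<=` G].

Definition proj_closure X : set (PV R m) :=
  [set x | forall F, proj_closed F -> X `<=` F -> F x].

Definition affine_cone X : set (V R m) :=
  [set v | v = 0 \/ exists v0 : v != 0, X (cls v0)].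

Definition Legendrian X : Prop := Lagrangian (affine_cone X).

(* The set of the classes [A, B], for (A, B) a nonzero element of D. *)
Definition classes_of (D : set (V R m)) : set (PV R m) :=
  [set x | exists v (v0 : v != 0), D v /\ x = cls v0].

End ProjectiveGeometry.

Section Varieties.
Variables (R : realType) (m : nat).

Definition Y : set (PV R m) :=
  classes_of [set v : V R m | exists lam : R[i],
    v.1 *m v.2^T = (lam ^+ 2)%:M /\ v.2^T *m v.1 = (lam ^+ 2)%:M].

Definition X_inv : set (PV R m) :=
  proj_closure (classes_of [set v : V R m | exists g : 'M[R[i]]_m,
    \det g = 1 /\ v = (g, (invmx g)^T)]).

Definition X_deg (k : nat) : set (PV R m) :=
  classes_of [set v : V R m |
    [/\ v.1 *m v.2^T = 0, v.2^T *m v.1 = 0,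
        (\rank v.1 <= k)%N & (\rank v.2 <= m - k)%N]].

Definition rescale (mu : R[i]) (v : V R m) : V R m :=
  (mu *: v.1, mu^-1 *: v.2).

Lemma rescale_neq0 (mu : R[i]) (mu0 : mu != 0) (v : V R m) :
  v != 0 -> rescale mu v != 0.
Proof.
apply: contra_neq => -[/eqP + /eqP]; rewrite !scaler_eq0 invr_eq0 (negPf mu0) /=.
by case: v => A B /= /eqP-> /eqP->.
Qed.

Definition psi (mu : R[i]) (mu0 : mu != 0) (x : PV R m) : PV R m :=
  cls (rescale_neq0 mu0 (valP (repr x))).

Lemma psiE (mu : R[i]) (mu0 : mu != 0) (v : V R m) (v0 : v != 0) :
  psi mu0 (cls v0) = cls (rescale_neq0 mu0 v0).
Proof.
rewrite /psi; set u := repr _.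
have /clsP[c c0 e] : cls (valP u) = cls v0.
  by rewrite /cls -[RHS]reprK -/u; congr (\pi_ _ _); apply: val_inj.
apply/clsP; exists c => //.
by rewrite e /rescale; congr pair; rewrite /= !scalerA mulrC.
Qed.

End Varieties.

Arguments Y R m : clear implicits.
Arguments X_inv R m : clear implicits.
Arguments X_deg R m k : clear implicits.

(* Main.v *)
(** The quadrics tr(C A B^T) and tr(C B^T A), tr C = 0, vanish on [Y].  On a
Legendrian [X] in [Y] their Hamiltonian fields (CA, -C^T B) and (AC, -B C^T)
are tangent to the cone of [X] at its smooth points, which are dense, so they
preserve its ideal; integrating the nilpotent ones, the cone is invariant under
(A, B) -> (gAh, g^-T B h^-T) for g, h in SL_m.

If tr(AB^T) does not vanish on [X], a point with AB^T = lambda^2 Id generates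
some psi_mu(X_inv).  Only finitely many such mu occur up to m-th roots of unity,
otherwise [X] would contain the lines (sA, B), whose direction (A, 0) is not
omega-orthogonal to (A, B); irreducibility leaves one mu.

If tr(AB^T) vanishes on [X], it gives the additional Hamiltonian (A, -B), and
the cone is invariant under GL_m x GL_m.  If the generic ranks satisfied
rk A + rk B < m, some (x^T y, 0) with x B = 0 = B y^T would be
omega-orthogonal to the tangent space and yet violate the differentials of the
minors of [A].  Hence rk A = k and rk B = m - k generically, the cone contains
the orbit of all such pairs, and [X] is its closure X_deg(m, k).

Conversely, being Lagrangian at the points of a dense open set suffices, and
there the tangent spaces are computed from the orbits and the equations. *)
Require Import Defs.
From HB Require Import structures.
From mathcomp Require Import all_boot all_order all_algebra.
From mathcomp Require Import generic_quotient.
From mathcomp Require Import boolp classical_sets reals.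
From mathcomp Require Import complex mpoly ring zify.

Set Implicit Arguments.
Unset Strict Implicit.
Unset Printing Implicit Defensive.

Import Order.TTheory GRing.Theory Num.Theory.
Local Open Scope ring_scope.

(** * Extending derivations; the generic dimension of tangent spaces *)

(** [Lagrangian] speaks only of smooth points, and smoothness compares a tangent space with a
    transcendence degree. Hence nothing can start before smooth points are known to be dense. This
    is a Jacobian criterion in characteristic zero: algebraically independent functions admit dual
    vector fields tangent to the variety, obtained by extending derivations. The argument stays in
    polynomial rings modulo a prime ideal, where denominators become multipliers outside the ideal.

    Integrating a field needs no exponential. If a linear field [M] satisfies M^2 = cM, its orbits
    lie on the lines z + t zM, so invariance is a polynomial identity in t. The case c = 0 yields
    transvections, which generate SL_m; c = 1 yields the scaling of A alone.

    The unknown scalar lambda^2 in [Y] is why only traceless matrices give equations. It also leaves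
    [Y] one dimension too large near invertible pairs, and there [X_inv] is singled out by one
    further equation between determinants.

    In the converse direction the irreducibility of the model varieties is inherited from [X]. *)

(** Here [R] is an [A]-module through [ev]; equivalently, [ev] + eps [D] is multiplicative into the
    dual numbers over [R]. *)
Definition derivation_along (A R : comNzRingType) (ev D : A -> R) : Prop :=
  (forall x y, D (x + y) = D x + D y) /\
  (forall x y, D (x * y) = ev x * D y + D x * ev y).

Section DerivationBasics.
Variables (A R : comNzRingType) (ev : {rmorphism A -> R}) (D : A -> R).
Hypothesis derD : derivation_along ev D.

Lemma derivation0 : D 0 = 0.
Proof. by apply: (addrI (D 0)); rewrite -derD.1 !addr0. Qed.

Lemma derivation_sum (J : Type) (r : seq J) (P : pred J) (F : J -> A) :
  D (\sum_(j <- r | P j) F j) = \sum_(j <- r | P j) D (F j).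
Proof. exact: (big_morph D derD.1 derivation0). Qed.

Lemma derivationB x y : D (x - y) = D x - D y.
Proof. by apply/eqP; rewrite -subr_eq opprK -derD.1 subrK. Qed.

Lemma map_derivationD p q :
  map_poly D (p + q) = map_poly D p + map_poly D q.
Proof.
by apply/polyP=> i; rewrite coefD !coef_map_id0 ?derivation0 // coefD derD.1.
Qed.

Lemma map_derivationM p q : map_poly D (p * q) =
  map_poly ev p * map_poly D q + map_poly D p * map_poly ev q.
Proof.
apply/polyP=> i; rewrite coefD !coefM coef_map_id0 ?derivation0 // coefM.
rewrite derivation_sum -big_split; apply: eq_bigr => j _ /=.
by rewrite derD.2 !coef_map !coef_map_id0 ?derivation0.
Qed.

End DerivationBasics.

(** The last clauses say that the quotient is nonzero and torsion-free. Keeping [I] as a predicate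
    avoids forming the residue domain and its fraction field. *)
Definition char0_prime_ideal (R : comNzRingType) (I : R -> Prop) : Prop :=
  [/\ I 0, (forall x y, I x -> I y -> I (x + y)),
      (forall x y, I y -> I (x * y)), (forall x y, I (x * y) -> I x \/ I y) &
      ~ I 1 /\ (forall n x, I (x *+ n.+1) -> I x)].

Section DerivationExtension.
Variables (R : comNzRingType) (I : R -> Prop).
Hypothesis HI : char0_prime_ideal I.

Let I0 : I 0. Proof. by case: HI. Qed.
Let ID x y : I x -> I y -> I (x + y). Proof. by case: HI => _ H _ _ _; exact: H. Qed.
Let IM x y : I y -> I (x * y). Proof. by case: HI => _ _ H _ _; exact: H. Qed.
Let IMr x y : I x -> I (x * y). Proof. by rewrite mulrC; exact: IM. Qed.
Let IN x : I x -> I (- x). Proof. by rewrite -mulN1r; exact: IM. Qed.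
Let IB x y : I x -> I y -> I (x - y). Proof. by move=> ? ?; apply: ID => //; exact: IN. Qed.
Let Ipr x y : I (x * y) -> ~ I x -> I y.
Proof. by case: HI => _ _ _ H _ /H[]. Qed.
Let I1 : ~ I 1. Proof. by case: HI => _ _ _ _ []. Qed.
Let Ichar n x : I (x *+ n.+1) -> I x. Proof. by case: HI => _ _ _ _ [_ H]; exact: H. Qed.
Let Isum (J : Type) (r : seq J) (P : pred J) (F : J -> R) :
  (forall j, P j -> I (F j)) -> I (\sum_(j <- r | P j) F j).
Proof. by move=> H; apply: (big_ind I). Qed.
Let IMn x n : I x -> I (x *+ n). Proof. by rewrite -mulr_natl; exact: IM. Qed.
Let IX x n : ~ I x -> ~ I (x ^+ n).
Proof. by move=> h; elim: n => [|n IH]; rewrite ?expr0 ?exprS // => /Ipr-/(_ h). Qed.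

Lemma prime_ideal_horner (p : {poly R}) (a : R) : (forall i, I p`_i) -> I p.[a].
Proof. by move=> H; rewrite horner_coef; apply: Isum => i _; exact: IMr. Qed.

(* If some polynomial relation for [a] has leading coefficient outside [I],
   then for one of least degree the value s of its derivative at [a] is not
   in [I], and [s D] extends to A[T]; otherwise [T] is transcendental and
   [D] itself extends. *)
Lemma extend_derivation (A : comNzRingType) (ev : {rmorphism A -> R}) (D : A -> R) (a : R) :
  derivation_along ev D -> (forall x, I (ev x) -> I (D x)) ->
  exists (evP : {rmorphism {poly A} -> R}) (DP : {poly A} -> R) (s : R),
    [/\ derivation_along evP DP, (forall p, I (evP p) -> I (DP p)),
        evP 'X = a & ~ I s /\ forall x, evP x%:P = ev x /\ DP x%:P = s * D x].
Proof.
move=> derD kerD.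
have D0 := derivation0 derD.
pose evP : {rmorphism {poly A} -> R} := horner_morph (fun x => mulrC a (ev x)).
have evPE p : evP p = (map_poly ev p).[a] by [].
pose DP s u p := s * (map_poly D p).[a] + (map_poly ev p^`()).[a] * u.
have derDP s u : derivation_along evP (DP s u).
  split=> p q; rewrite /DP.
    rewrite (map_derivationD derD) derivD rmorphD !hornerD mulrDr mulrDl.
    by rewrite addrACA.
  rewrite (map_derivationM derD) derivM rmorphD !rmorphM !hornerD !hornerM !evPE.
  by ring.
have DPC s u x : DP s u x%:P = s * D x.
  rewrite /DP derivC rmorph0 horner0 mul0r addr0; congr (_ * _).
  suff -> : map_poly D x%:P = (D x)%:P by rewrite hornerC.
  by apply/polyP=> i; rewrite coef_map_id0 // !coefC; case: ifP.
have evX : evP 'X = a by rewrite evPE map_polyX hornerX.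
have evC x : evP x%:P = ev x by rewrite evPE map_polyC hornerC.
pose good (p : {poly A}) := I (evP p) /\ ~ I (ev (lead_coef p)).
(* a relation with a coefficient outside the kernel can be truncated *)
have trunc (p : {poly A}) : I (evP p) -> (forall i, I (ev p`_i)) \/
    exists2 q, good q & (size q <= size p)%N.
  have: forall n (q : {poly A}), (size q <= n)%N -> I (evP q) ->
      (forall i, I (ev q`_i)) \/ exists2 q', good q' & (size q' <= size q)%N.
    elim=> [q|n IH q sq Iq].
      by rewrite leqn0 size_poly_eq0 => /eqP-> _; left=> i; rewrite coef0 rmorph0.
    case: (pselect (I (ev q`_n))) => [In|nIn]; last first.
      right; exists q => //; split=> //; suff -> : lead_coef q = q`_n by [].
      rewrite lead_coefE; have /eqP-> : size q == n.+1 => //.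
      rewrite eqn_leq sq ltnNge; apply/negP => /leq_sizeP/(_ n (leqnn _)) e.
      by apply: nIn; rewrite e rmorph0.
    have eq : q = take_poly n q + q`_n *: 'X^n.
      apply/polyP=> i; rewrite coefD coef_take_poly coefZ coefXn.
      case: ltngtP => [||->]; rewrite ?mulr1 ?mulr0 ?addr0 ?add0r //.
      by move=> ni; apply/esym; rewrite nth_default //; exact: leq_trans ni.
    have st : (size (take_poly n q) <= n)%N by exact: size_take_poly.
    have It : I (evP (take_poly n q)).
      have -> : take_poly n q = q - q`_n *: 'X^n by rewrite {2}eq addrK.
      rewrite rmorphB -mul_polyC rmorphM evC; apply: IB => //; exact: IMr.
    case: (IH _ st It) => [H|[q' gq' sq']].
      left=> i; have := H i; rewrite coef_take_poly; case: ltngtP => // [ni _|-> //].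
      by rewrite nth_default ?rmorph0 //; exact: leq_trans ni.
    right; exists q' => //; apply: leq_trans sq' _.
    have [snq|nsq] := leqP (size q) n.
      apply/leq_sizeP => j hj; rewrite coef_take_poly.
      by case: ifP => // _; rewrite nth_default.
    exact: leq_trans st (ltnW nsq).
  by move=> /(_ (size p) p (leqnn _)).
have kerDP0 s u (p : {poly A}) : (forall i, I (ev p`_i)) -> I (DP s u p).
  move=> Hp; apply: ID.
    by apply/IM/prime_ideal_horner => i; rewrite coef_map_id0 //; exact/kerD/Hp.
  apply/IMr/prime_ideal_horner => i.
  by rewrite coef_map coef_deriv raddfMn; apply: (@IMn _ i.+1); exact: Hp.
case: (pselect (exists n, exists2 p, good p & size p = n)) => [ex|nex]; last first.
  exists evP, (DP 1 0), 1; split=> //.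
  move=> p /trunc[|[q gq _]]; first exact: kerDP0.
  by case: nex; exists (size q), q.
have ex' : exists n, `[< exists2 p, good p & size p = n >].
  by case: ex => n H; exists n; apply/asboolP.
case: (ex_minnP ex') => n /asboolP[P [IP lP] sP] minP.
have {}minP q : good q -> (size P <= size q)%N.
  by move=> gq; rewrite sP; apply: minP; apply/asboolP; exists q.
have P0 : P != 0 by apply: contra_notN lP => /eqP->; rewrite lead_coef0 rmorph0.
have ltP (q : {poly A}) : (size q < size P)%N -> I (evP q) -> forall i, I (ev q`_i).
  move=> sq /trunc[//|[q' /minP sq' sqq']].
  by have := leq_ltn_trans (leq_trans sq' sqq') sq; rewrite ltnn.
(* With these values [DP s u] kills the minimal relation [P] exactly, without dividing by the
   derivative of [P] at [a]. *)
pose s := evP P^`(); pose u := - (map_poly D P).[a].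
(* Otherwise minimality of [P] puts all coefficients of its derivative in [I]; the top one is a
   positive multiple of the leading coefficient of [P], which characteristic zero would then put in
   [I]. *)
have nIs : ~ I s.
  move=> Is; have sP' := lt_size_deriv P0.
  have := ltP _ sP' Is (size P).-2.
  rewrite coef_deriv raddfMn.
  case e : (size P) => [|[|k]] /=.
  - by move/eqP: e; rewrite size_poly_eq0 (negPf P0).
  - have [c ec] : exists c, P = c%:P by exists P`_0; apply: size1_polyC; rewrite e.
    by move: lP IP; rewrite ec lead_coefC evC.
  - by move=> /Ichar; apply: contra_not lP; rewrite lead_coefE e.
exists evP, (DP s u), s; split=> // g Ig.
(* Pseudo-division by [P]: the multiplier [c] lies outside [I], the quotient term dies with [P], and
   the remainder is too short to be a nontrivial relation. *)
pose c := lead_coef P ^+ Pdiv.Ring.rscalp g P.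
pose q := Pdiv.Ring.rdivp g P; pose r := Pdiv.Ring.rmodp g P.
have eg : c%:P * g = q * P + r by rewrite mul_polyC; exact: Pdiv.ComRing.rdivp_eq.
have nIc : ~ I (ev c) by rewrite rmorphXn; exact: IX.
have Ir : I (evP r).
  have -> : r = c%:P * g - q * P by rewrite eg addrC addKr.
  by rewrite rmorphB !rmorphM; apply: IB; exact: IM.
have sr : (size r < size P)%N by rewrite Pdiv.Ring.ltn_rmodp.
have Dr : I (DP s u r) by apply: kerDP0; exact: ltP.
have DP0 : DP s u P = 0 by rewrite /DP /u -evPE -/s mulrN subrr.
have : I (DP s u (c%:P * g)).
  rewrite eg (derDP s u).1 (derDP s u).2 DP0 mulr0 add0r.
  by apply: ID => //; exact: IM.
rewrite (derDP s u).2 evC => H.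
suff /Ipr : I (ev c * DP s u g) by apply.
have -> : ev c * DP s u g = ev c * DP s u g + DP s u c%:P * evP g - DP s u c%:P * evP g by rewrite addrK.
by apply: IB => //; exact: IM.
Qed.
End DerivationExtension.

Lemma mpoly_ring_ind (K : comNzRingType) n (P : {mpoly K[n]} -> Prop) :
  (forall c, P c%:MP) -> (forall i, P 'X_i) ->
  (forall p q, P p -> P q -> P (p + q)) -> (forall p q, P p -> P q -> P (p * q)) ->
  forall p, P p.
Proof.
move=> PC PX PD PM; elim/mpolyind => [|c m p _ _ Pp]; first by rewrite -mpolyC0.
apply: (PD) => //; rewrite -mul_mpolyC; apply: (PM) => //.
rewrite mpolyXE_id; apply: (big_ind P) => [|x y|i _]; [by rewrite -mpolyC1|exact: PM|].
elim: (m i) => [|k IH]; first by rewrite expr0 -mpolyC1.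
by rewrite exprS; exact: PM.
Qed.

Lemma mderivU (K : comNzRingType) n (i j : 'I_n) :
  ('X_j : {mpoly K[n]})^`M(i) = (j == i)%:R.
Proof.
rewrite mderivX mnm1E; case: eqP => [->|_]; last by rewrite scale0r.
rewrite scale1r; have -> : (U_(i) - U_(i) = 0)%MM by apply/mnmP=> l; rewrite !mnmE subnn.
by rewrite mpolyX0.
Qed.

Lemma derivation_mpoly (K S : comNzRingType) n (phi : {rmorphism {mpoly K[n]} -> S})
    (d : {mpoly K[n]} -> S) :
  derivation_along phi d -> (forall c, d c%:MP = 0) ->
  forall p, d p = \sum_(i < n) phi (p^`M(i)) * d 'X_i.
Proof.
move=> der dC; elim/mpoly_ring_ind => [c|i|p q IHp IHq|p q IHp IHq].
- by rewrite dC big1 // => i _; rewrite mderivC rmorph0 mul0r.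
- rewrite (bigD1 i) //= big1 ?addr0 => [|j ji].
    by rewrite mderivU eqxx rmorph1 mul1r.
  by rewrite mderivU eq_sym (negPf ji) rmorph0 mul0r.
- rewrite der.1 IHp IHq -big_split; apply: eq_bigr => i _ /=.
  by rewrite mderivD rmorphD mulrDl.
- rewrite der.2 IHp IHq mulr_sumr mulr_suml -big_split; apply: eq_bigr => i _ /=.
  by rewrite mderivM rmorphD !rmorphM; ring.
Qed.

Section DualFields.
Variables (R : comNzRingType) (I : R -> Prop).
Hypothesis HI : char0_prime_ideal I.

(** Generators are adjoined one at a time; the multipliers accumulate into [t], which stays outside
    [I] by primality. *)
Lemma extend_derivation_seq (s : seq R) (A : comNzRingType) (ev : {rmorphism A -> R})
    (D : A -> R) :
  derivation_along ev D -> (forall x, I (ev x) -> I (D x)) ->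
  exists (B : comNzRingType) (evB : {rmorphism B -> R}) (DB : B -> R)
         (iota : {rmorphism A -> B}) (t : R),
    [/\ derivation_along evB DB, (forall x, I (evB x) -> I (DB x)),
        {in s, forall a, exists b, evB b = a} &
        ~ I t /\ forall x, evB (iota x) = ev x /\ DB (iota x) = t * D x].
Proof.
elim: s A ev D => [|a s IH] A ev D derD kerD.
  exists A, ev, D, idfun, 1; split=> //; split; first by case: HI => _ _ _ _ [].
  by move=> x; rewrite mul1r.
have [evP [DP [u [derP kerP evX [Iu HC]]]]] := extend_derivation HI a derD kerD.
have [B [evB [DB [iota [t [derB kerB Hs [It Hi]]]]]]] := IH _ _ _ derP kerP.
exists B, evB, DB, (iota \o polyC), (t * u); split=> //.
  move=> x; rewrite inE => /predU1P[->|/Hs //].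
  by exists (iota 'X); rewrite (Hi _).1.
split=> [|x /=]; first by case: HI => _ _ _ pr _ /pr[].
by rewrite (Hi _).1 (Hi _).2 (HC _).1 (HC _).2 mulrA.
Qed.

End DualFields.

Section DualFieldsMpoly.
Variables (K : comNzRingType) (n : nat) (I : {mpoly K[n]} -> Prop).
Hypothesis HI : char0_prime_ideal I.

(* The vector field [w] is tangent to the zero locus of [I], and it extends
   the derivation [s d/d(f k)] of K[f]. *)
Lemma dual_vector_field e (f : 'I_e -> {mpoly K[n]}) (k : 'I_e) :
  (forall q : {mpoly K[e]}, I (mmap (@mpolyC n K) f q) -> q = 0) ->
  exists (w : 'I_n -> {mpoly K[n]}) (s : {mpoly K[n]}),
    [/\ ~ I s, forall p, I p -> I (\sum_j p^`M(j) * w j) &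
        forall l, I (\sum_j (f l)^`M(j) * w j - s *+ (l == k))].
Proof.
move=> indf; pose ev : {rmorphism _ -> _} := mmap (@mpolyC n K) f.
pose D q := ev q^`M(k).
have derD : derivation_along ev D.
  split=> p q; first by rewrite /D mderivD rmorphD.
  by rewrite /D mderivM rmorphD !rmorphM addrC.
(* Independence of [f] modulo [I] means that only 0 is sent into [I]. *)
have kerD x : I (ev x) -> I (D x).
  by move=> /indf ->; rewrite /D mderiv0 rmorph0; case: HI.
pose X : seq {mpoly K[n]} := [seq 'X_j | j <- enum 'I_n].
have [B [evB [DB [iota [t [derB kerB Hs [It Hi]]]]]]] :=
  extend_derivation_seq HI X derD kerD.
have /choice[b evb] : forall j, exists b, evB b = 'X_j.
  by move=> j; apply: Hs; apply: map_f; rewrite mem_enum.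
(* All coordinates having been adjoined, [phi] is a section of [evB]; composing [DB] with it gives a
   derivation of the polynomial ring, that is, a vector field. *)
pose phi : {rmorphism _ -> _} := mmap (iota \o @mpolyC e K) b.
have evphi p : evB (phi p) = p.
  elim/mpoly_ring_ind: p => [c|i|p q IHp IHq|p q IHp IHq].
  - by rewrite /phi /= mmapC /= (Hi _).1 /ev /= mmapC.
  - by rewrite /phi /= mmapX mmap1U.
  - by rewrite !rmorphD IHp IHq.
  - by rewrite !rmorphM IHp IHq.
have DBphi p : DB (phi p) = \sum_j p^`M(j) * DB (b j).
  have der : derivation_along idfun (DB \o phi).
    split=> x y /=; first by rewrite rmorphD derB.1.
    by rewrite rmorphM derB.2 !evphi.
  rewrite -[LHS]/((DB \o phi) p) (derivation_mpoly (phi := idfun) der) => [|c].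
    by apply: eq_bigr => j _ /=; rewrite /phi /= mmapX mmap1U.
  by rewrite /= /phi /= mmapC /= (Hi _).2 /D mderivC rmorph0 mulr0.
exists (fun j => DB (b j)), t; split=> // [p Ip|l].
  by rewrite -DBphi; apply: kerB; rewrite evphi.
rewrite -DBphi -[t *+ _]mulr_natr.
(* [phi (f l)] and [iota 'X_l] both lie over [f l], so [DB] agrees on them modulo [I]. *)
have -> : t * (l == k)%:R = DB (iota 'X_l).
  by rewrite (Hi _).2 /D mderivU rmorph_nat.
rewrite -(derivationB derB); apply: kerB.
rewrite rmorphB evphi (Hi _).1 /ev /= mmapX mmap1U subrr.
by case: HI.
Qed.

End DualFieldsMpoly.

(** Choose [E] of maximal rank with all rows in [P]; adjoining a further vector of [P] cannot raise
    the rank. *)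
Lemma subspace_mx (K : fieldType) n (P : 'rV[K]_n -> Prop) :
  P 0 -> (forall a u v, P u -> P v -> P (a *: u + v)) ->
  exists E : 'M[K]_n, forall v, P v <-> (v <= E)%MS.
Proof.
move=> P0 PZD.
have PD u v : P u -> P v -> P (u + v) by move=> Pu Pv; rewrite -[u]scale1r; exact: PZD.
have PM m (u : 'rV_m) (E : 'M_(m, n)) : (forall i, P (row i E)) -> P (u *m E).
  move=> PE; rewrite mulmx_sum_row; apply: (big_ind P) => // i _.
  by rewrite -[_ *: _]addr0; exact: PZD.
pose Q r := `[< exists E : 'M[K]_n, (forall i, P (row i E)) /\ \rank E = r >].
have Q0 : exists r, Q r.
  by exists 0%N; apply/asboolP; exists 0; split=> [i|]; rewrite ?row0 ?mxrank0.
have Qn r : Q r -> (r <= n)%N by move=> /asboolP[E [_ <-]]; exact: rank_leq_row.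
case: (ex_maxnP Q0 Qn) => r /asboolP[E [PE rE]] maxr.
exists E => v; split=> [Pv|/submxP[u ->]]; last exact: PM.
have rEv : (\rank (E + v)%MS <= \rank E)%N.
  rewrite rE; apply: maxr; apply/asboolP; exists (E + v)%MS; split=> // i.
  have /sub_addsmxP[[u1 u2] /= ->] := row_sub i (E + v)%MS.
  apply: PD; [exact: PM|apply: PM => j].
  by rewrite (_ : row j v = v) //; apply/rowP=> k; rewrite mxE ord1.
have sE : (E <= E + v)%MS by exact: addsmxSl.
have : (E + v <= E)%MS.
  by rewrite -(mxrank_leqif_sup sE) eqn_leq mxrankS.
by apply: submx_trans; exact: addsmxSr.
Qed.

Lemma mevalP_mmap (K : comNzRingType) n e (f : 'I_e -> {mpoly K[n]}) q x :
  (mmap (@mpolyC n K) f q).@[x] = q.@[fun i => (f i).@[x]].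
Proof.
elim/mpoly_ring_ind: q => [c|i|p q IHp IHq|p q IHp IHq].
- by rewrite mmapC !mevalC.
- by rewrite mmapX mmap1U mevalXU.
- by rewrite !rmorphD /= IHp IHq.
- by rewrite !rmorphM /= IHp IHq.
Qed.

Lemma mderiv_eq0 (K : numFieldType) n (q : {mpoly K[n]}) :
  (forall i, q^`M(i) = 0) -> exists c, q = c%:MP.
Proof.
move=> dq; exists q@_0; apply/mpolyP => m; rewrite mcoeffC.
case: eqVneq => [<-|m0]; first by rewrite mulr1.
rewrite mulr0; have [i mi] : exists i, m i != 0%N.
  apply/existsP; rewrite -negb_forall; apply: contra m0 => /forallP m0.
  by apply/eqP/mnmP=> i; rewrite mnmE (eqP (m0 i)).
have := congr1 (mcoeff (m - U_(i))%MM) (dq i).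
rewrite mcoeff_mderiv mcoeff0 submK; last first.
  by apply/mnm_lepP => j; rewrite mnm1E; case: eqP => // <-; rewrite lt0n.
by move/eqP; rewrite mulrn_eq0 /= => /eqP.
Qed.

(** * Zariski tangent spaces and their generic dimension *)

Section GenericSmoothness.
Variables (K : numFieldType) (n : nat) (Z : 'rV[K]_n -> Prop).
Notation poly := {mpoly K[n]}.

Definition vanishes_on (p : poly) := forall z, Z z -> p.@[z 0] = 0.

Definition tangent_at (z v : 'rV[K]_n) :=
  forall p, vanishes_on p -> \sum_j (p^`M(j)).@[z 0] * v 0 j = 0.

Definition independent_on e (f : 'I_e -> poly) :=
  forall q : {mpoly K[e]}, vanishes_on (mmap (@mpolyC n K) f q) -> q = 0.

Definition grad (p : poly) (z : 'rV[K]_n) : 'rV[K]_n := \row_j (p^`M(j)).@[z 0].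

Lemma vanishes_onPn p : ~ vanishes_on p -> exists2 z, Z z & p.@[z 0] != 0.
Proof.
move=> /existsNP[z /not_implyP[Zz /eqP pz]]; by exists z.
Qed.

Lemma tangent_mx z : exists E : 'M[K]_n, forall v, tangent_at z v <-> (v <= E)%MS.
Proof.
apply: subspace_mx => [p _|a u v tu tv p Ip].
  by rewrite big1 // => j _; rewrite mxE mulr0.
transitivity (a * (\sum_j (p^`M(j)).@[z 0] * u 0 j) + \sum_j (p^`M(j)).@[z 0] * v 0 j).
  rewrite mulr_sumr -big_split; apply: eq_bigr => j _ /=; rewrite !mxE; ring.
by rewrite tu // tv // mulr0 addr0.
Qed.

Lemma tangent_gradE (z v : 'rV[K]_n) (p : poly) :
  \sum_j (p^`M(j)).@[z 0] * v 0 j = (grad p z *m v^T) 0 0.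
Proof. by rewrite mxE; apply: eq_bigr => j _; rewrite !mxE. Qed.

Lemma grad_mx z : exists S : 'M[K]_n, forall v,
  (exists2 p, vanishes_on p & v = grad p z) <-> (v <= S)%MS.
Proof.
apply: subspace_mx => [|a u v [p Ip ->] [q Iq ->]].
  exists 0; first by move=> x _; rewrite meval0.
  by apply/rowP=> j; rewrite !mxE mderiv0 meval0.
exists (a *: p + q).
  by move=> x Zx; rewrite mevalD mevalZ Ip // Iq // mulr0 addr0.
by apply/rowP=> j; rewrite !mxE mderivD mderivZ mevalD mevalZ.
Qed.

(** The tangent space is the annihilator of the space of gradients of equations. *)
Lemma rank_tangent z (T S : 'M[K]_n) :
  (forall v, tangent_at z v <-> (v <= T)%MS) ->
  (forall v, (exists2 p, vanishes_on p & v = grad p z) <-> (v <= S)%MS) ->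
  \rank S = (n - \rank T)%N.
Proof.
move=> TE SE.
have -> : \rank T = \rank (kermx S^T).
  apply/eqP; rewrite eqn_leq; apply/andP; split; apply: mxrankS.
    apply/rV_subP => v /TE tv; apply/sub_kermxP.
    apply: trmx_inj; rewrite trmx_mul trmxK trmx0.
    apply/row_matrixP => i; rewrite row_mul row0; apply/rowP=> k.
    have [p Ip ->] := (SE (row i S)).2 (row_sub i S).
    by rewrite ord1 -tangent_gradE tv // mxE.
  apply/rV_subP => v /sub_kermxP vS; apply/TE => p Ip; rewrite tangent_gradE.
  have /submxP[u ->] := (SE (grad p z)).1 (ex_intro2 _ _ p Ip erefl).
  by rewrite -mulmxA -[S]trmxK -trmx_mul vS trmx0 mulmx0 mxE.
by rewrite mxrank_ker mxrank_tr subKn // rank_leq_row.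
Qed.

Hypotheses (HI : char0_prime_ideal vanishes_on).

(* At a point [z0] where the tangent space has the least dimension [t], the
   rows of [U] are gradients of equations of [Z] followed by [t] linear forms;
   where [det] does not vanish these forms are coordinates on tangent spaces. *)
Theorem generic_smoothness : (exists z, Z z) ->
  exists (t : nat) (g : poly), [/\ ~ vanishes_on g,
    exists f : 'I_t -> poly, independent_on f,
    forall e (f : 'I_e -> poly), independent_on f -> (e <= t)%N &
    forall z, Z z -> g.@[z 0] != 0 -> forall E : 'M[K]_n,
      (forall v, tangent_at z v <-> (v <= E)%MS) -> \rank E = t].
Proof.
move=> [z1 Zz1]; have /choice[T TE] := tangent_mx.
have exT : exists t, `[< exists2 z, Z z & \rank (T z) = t >].
  by exists (\rank (T z1)); apply/asboolP; exists z1.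
case: (ex_minnP exT) => t /asboolP[z0 Zz0 tE] mint.
have {exT}mint z : Z z -> (t <= \rank (T z))%N.
  by move=> Zz; apply: mint; apply/asboolP; exists z.
have [S SE] := grad_mx z0.
have rS : \rank S = (n - t)%N by rewrite (rank_tangent (TE z0) SE) tE.
have tn : (t <= n)%N by rewrite -tE rank_leq_row.
(* The first n - t rows of [U] span the gradients at [z0]; [C] keeps only the last [t] rows, which
   complete them to a basis. *)
pose U := row_ebase S; pose C : 'M[K]_n := copid_mx (n - t) *m U.
have rC : \rank C = t.
  by rewrite mxrankMfree ?rank_copid_mx ?leq_subr ?subKn // row_free_unit row_ebase_unit.
have /choice[p pE] : forall i : 'I_n, exists q : poly, vanishes_on q /\
    row i (pid_mx (n - t) *m U) = grad q z0.
  move=> i; suff /SE[q] : (row i (pid_mx (n - t) *m U) <= S)%MS by exists q.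
  apply: submx_trans (row_sub _ _) _.
  rewrite -[X in (_ <= X)%MS]mulmx_ebase rS -/U.
  rewrite -[X in (X <= _)%MS]mul1mx -(mulVmx (col_ebase_unit S)) -!mulmxA.
  exact: submxMl.
pose G : 'M[poly]_n := \matrix_(i, j) ((p i)^`M(j) + (C i j)%:MP).
pose J (z : 'rV[K]_n) : 'M[K]_n := \matrix_i grad (p i) z.
have GE (z : 'rV[K]_n) : map_mx (meval (z 0)) G = J z + C.
  by apply/matrixP=> i j; rewrite !mxE mevalD mevalC.
have gE (z : 'rV[K]_n) : (\det G).@[z 0] = \det (J z + C) by rewrite -GE det_map_mx.
have nIg : ~ vanishes_on (\det G).
  move=> /(_ z0 Zz0); rewrite gE.
  have -> : J z0 + C = U.
    have -> : J z0 = pid_mx (n - t) *m U.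
      by apply/row_matrixP=> i; rewrite (pE i).2 rowK.
    by rewrite /C -mulmxDl addrC subrK mul1mx.
  by apply/eqP; rewrite -unitfE -unitmxE row_ebase_unit.
(* Gradients of equations annihilate tangent vectors, so only the [t] forms in [C] act. Where the
   determinant is nonzero they act injectively, which bounds the tangent dimension by [t]. *)
have JT z : Z z -> T z *m (J z + C)^T = T z *m C^T.
  move=> Zz; rewrite linearD mulmxDr [X in X + _](_ : _ = 0) ?add0r //.
  apply/row_matrixP=> k; rewrite row_mul row0; apply/rowP=> i.
  have /TE/(_ _ (pE i).1) := row_sub k (T z).
  by rewrite !mxE => {2}<-; apply: eq_bigr => j _; rewrite !mxE mulrC.
have rT z : Z z -> (\det G).@[z 0] != 0 -> \rank (T z) = t /\ \rank (T z *m C^T) = t.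
  rewrite gE -unitfE -unitmxE => Zz u.
  have e : \rank (T z *m C^T) = \rank (T z).
    by rewrite -JT // mxrankMfree // row_free_unit unitmx_tr.
  split=> //; last rewrite e; apply/eqP; rewrite eqn_leq mint // andbT -e.
    by rewrite -rC -[\rank C]mxrank_tr mxrankM_maxr.
  by rewrite -rC -[\rank C]mxrank_tr mxrankM_maxr.
exists t, (\det G); split=> //.
- rewrite -rC; pose B := row_base C.
  have full z : Z z -> (\det G).@[z 0] != 0 -> row_full (T z *m B^T).
    move=> Zz gz; have [_ r2] := rT z Zz gz.
    rewrite -col_leq_rank {1}rC -[X in (X <= _)%N]r2 -[C in C^T]mulmx_base trmx_mul mulmxA.
    exact: mxrankM_maxl.
  pose f i : poly := \sum_j B i j *: 'X_j.
  have df i j : (f i)^`M(j) = (B i j)%:MP.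
    rewrite /f raddf_sum (bigD1 j) //= big1 ?addr0 => [|k kj].
      by rewrite mderivZ mderivU eqxx alg_mpolyC.
    by rewrite mderivZ mderivU (negPf kj) scaler0.
  exists f => q.
  (* Induction on a degree bound: differentiating a relation among the forms along tangent vectors
     dual to them turns each partial derivative of [q] into a relation of lower degree, hence into
     0. Then [q] is constant. *)
  have [d] : exists d, forall m, (d <= mdeg m)%N -> q@_m = 0.
    by exists (msize q) => m /msize_mdeg_ge/memN_msupp_eq0.
  elim: d q => [q qd _|d IH q qd Iq].
    by apply/mpolyP=> m; rewrite qd // mcoeff0.
  pose phi : {rmorphism _ -> _} := mmap (@mpolyC n K) f.
  have dphi j : (phi q)^`M(j) = \sum_i phi q^`M(i) * (B i j)%:MP.
    have der : derivation_along phi (mderiv j \o phi).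
      by split=> x y /=; rewrite ?rmorphD ?mderivD // rmorphM mderivM addrC.
    rewrite -[LHS]/((mderiv j \o phi) q) (derivation_mpoly der) => [|c].
      by apply: eq_bigr => i _ /=; rewrite /phi /= mmapX mmap1U df.
    by rewrite /= /phi /= mmapC mderivC.
  have dq0 i : q^`M(i) = 0.
    apply: IH => [m md|].
      by rewrite mcoeff_mderiv qd ?mul0rn // mdegD mdeg1 addn1.
    case: HI => _ _ _ pr _.
    suff /pr[/nIg//|//] : vanishes_on (\det G * phi q^`M(i)).
    move=> z Zz; rewrite mevalM.
    have [->|gz] := eqVneq (\det G).@[z 0] 0; first by rewrite mul0r.
    have /row_fullP[W WE] := full z Zz gz.
    (* A tangent vector on which the [i]-th form is 1 and the others are 0. *)
    pose v := row i W *m T z.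
    have /TE/(_ _ Iq) : (v <= T z)%MS by exact: submxMl.
    suff -> : \sum_j ((phi q)^`M(j)).@[z 0] * v 0 j = (phi q^`M(i)).@[z 0] by move=> ->; rewrite mulr0.
    pose y := \row_k (phi q^`M(k)).@[z 0].
    have vB : v *m B^T = row i 1%:M by rewrite /v -mulmxA -row_mul WE.
    transitivity ((v *m B^T *m y^T) 0 0).
      rewrite -mulmxA -trmx_mul mxE; apply: eq_bigr => j _; rewrite mulrC; congr (_ * _).
      rewrite dphi !mxE raddf_sum; apply: eq_bigr => k _.
      by rewrite [y _ _]mxE /= mevalM mevalC.
    by rewrite vB -row_mul mul1mx !mxE.
  have [c qc] := mderiv_eq0 dq0.
  have := Iq z0 Zz0; rewrite qc mmapC mevalC => ->; by rewrite mpolyC0.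
- move=> e f indf.
  (* At a point avoiding all exceptional loci the [e] dual fields are tangent vectors whose pairing
     with the gradients of the [f k] is diagonal and invertible, so they are independent in a space
     of dimension [t]. *)
  have /choice[ws wsE] : forall k, exists ws : ('I_n -> poly) * poly,
      [/\ ~ vanishes_on ws.2, forall p, vanishes_on p -> vanishes_on (\sum_j p^`M(j) * ws.1 j) &
      forall l, vanishes_on (\sum_j (f l)^`M(j) * ws.1 j - ws.2 *+ (l == k))].
    by move=> k; have [w [s H]] := dual_vector_field HI k indf; exists (w, s).
  have nI : ~ vanishes_on (\det G * \prod_k (ws k).2).
    case: HI => _ _ _ pr [I1 _]; move/pr => [/nIg//|].
    elim: (index_enum _) => [|k s IH]; first by rewrite big_nil.
    by rewrite big_cons => /pr[|//]; case: (wsE k).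
  have [z Zz] := vanishes_onPn nI.
  rewrite mevalM rmorph_prod mulf_eq0 negb_or => /andP[gz sz].
  have [rTz _] := rT z Zz gz; rewrite -rTz.
  pose W : 'M[K]_(e, n) := \matrix_(k, j) ((ws k).1 j).@[z 0].
  have WT : (W <= T z)%MS.
    apply/row_subP => k; apply/TE => q Iq; case: (wsE k) => _ /(_ _ Iq) /(_ z Zz) + _.
    rewrite raddf_sum => e1; rewrite -[RHS]e1.
    by apply: eq_bigr => j _; rewrite !mxE /= mevalM.
  suff : row_free W by move=> /eqP <-; exact: mxrankS.
  pose F : 'M[K]_(e, n) := \matrix_k grad (f k) z.
  have WF : W *m F^T = diag_mx (\row_k (ws k).2.@[z 0]).
    apply/matrixP=> k l; case: (wsE k) => _ _ /(_ l z Zz).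
    rewrite mevalB raddf_sum => /eqP; rewrite subr_eq0 => /eqP e1.
    rewrite !mxE; transitivity ((ws k).2 *+ (l == k)).@[z 0].
      by rewrite -e1; apply: eq_bigr => j _; rewrite !mxE /= mevalM mulrC.
    by rewrite mevalMn eq_sym.
  have : W *m F^T \in unitmx.
    rewrite WF unitmxE det_diag unitfE; apply: contraNneq sz => <-.
    by apply/eqP; apply: eq_bigr => k _; rewrite mxE.
  rewrite -row_free_unit -!row_leq_rank => /leq_trans; apply.
  exact: mxrankM_maxl.
- move=> z Zz gz E EE; have [<- _] := rT z Zz gz.
  by apply/eqP; rewrite eqn_leq; apply/andP; split; apply: mxrankS; apply/rV_subP=> v;
    rewrite -EE TE.
Qed.

End GenericSmoothness.

Lemma horner_ext (K : numDomainType) (p q : {poly K}) : 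
  (forall x, p.[x] = q.[x]) -> p = q.
Proof.
move=> pq; apply/eqP; rewrite -subr_eq0; apply: contraT => d0.
pose s : seq K := [seq i%:R | i <- iota 0 (size (p - q))].
have us : uniq s.
  by rewrite map_inj_uniq ?iota_uniq // => i j /eqP; rewrite eqr_nat => /eqP.
have /(max_poly_roots d0)/(_ us) : all (root (p - q)) s.
  by apply/allP => x _; rewrite rootE hornerD hornerN pq subrr.
by rewrite size_map size_iota ltnn.
Qed.

(** * Lines in coordinate space and linear vector fields *)

Section Curves.
Variables (K : numFieldType) (n : nat).
Notation poly := {mpoly K[n]}.
Implicit Types (p : poly) (z v : 'rV[K]_n).

Definition line z v : poly -> {poly K} :=
  mmap (@polyC K) (fun i => (z 0 i)%:P + v 0 i *: 'X).

HB.instance Definition _ z v := GRing.RMorphism.copy (line z v) (line z v).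

Lemma horner_line z v p t : (line z v p).[t] = p.@[(z + t *: v) 0].
Proof.
elim/mpoly_ring_ind: p => [c|i|p q IHp IHq|p q IHp IHq].
- by rewrite /line mmapC hornerC mevalC.
- by rewrite /line mmapX mmap1U mevalXU !hornerE !mxE mulrC.
- by rewrite rmorphD mevalD hornerD IHp IHq.
- by rewrite rmorphM mevalM hornerM IHp IHq.
Qed.

Lemma deriv_line z v p :
  (line z v p)^`() = \sum_j line z v p^`M(j) * (v 0 j)%:P.
Proof.
have der : derivation_along (line z v) (deriv \o line z v).
  by split=> x y /=; rewrite ?rmorphD ?derivD // rmorphM derivM addrC.
rewrite -[LHS]/((deriv \o line z v) p) (derivation_mpoly der) => [|c].
  apply: eq_bigr => j _ /=; congr (_ * _).
  by rewrite /line mmapX mmap1U derivD derivC derivZ derivX add0r alg_polyC.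
by rewrite /= /line mmapC derivC.
Qed.

Lemma differential_line z v p :
  \sum_j (p^`M(j)).@[z 0] * v 0 j = (line z v p)^`().[0].
Proof.
rewrite deriv_line horner_sum; apply: eq_bigr => j _.
by rewrite hornerM hornerC horner_line scale0r addr0.
Qed.

Lemma differential_unique z v p (h : {poly K}) :
  (forall t, h.[t] = p.@[(z + t *: v) 0]) ->
  \sum_j (p^`M(j)).@[z 0] * v 0 j = h^`().[0].
Proof.
move=> hE; rewrite differential_line; congr (_^`().[0]).
by apply: horner_ext => t; rewrite hE horner_line.
Qed.

Lemma tangent_of_line (Z : 'rV[K]_n -> Prop) z v :
  (forall t, Z (z + t *: v)) -> tangent_at Z z v.
Proof.
move=> Zt p Ip; rewrite (@differential_unique _ _ _ 0) ?deriv0 ?horner0 // => t.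
by rewrite horner0 Ip.
Qed.

Definition lin_field (M : 'M[K]_n) (p : poly) : poly :=
  \sum_j p^`M(j) * \sum_k M k j *: 'X_k.

Lemma lin_fieldE M p z :
  (lin_field M p).@[z 0] = \sum_j (p^`M(j)).@[z 0] * (z *m M) 0 j.
Proof.
rewrite /lin_field raddf_sum; apply: eq_bigr => j _ /=.
rewrite mevalM !mxE; congr (_ * _).
rewrite raddf_sum; apply: eq_bigr => k _ /=.
by rewrite mevalZ mevalXU mulrC.
Qed.

(** Let h(q) be the restriction of q to the line z + t zM. Since M^2 = cM, (1 + ct) h(q)' =
    h([lin_field M q]). Tangency keeps [lin_field M q] in the ideal, so the coefficients of h(q)
    vanish one after the other, simultaneously for all q in the ideal; characteristic zero allows
    division by the degree. *)
Lemma lin_field_invariant (Z : 'rV[K]_n -> Prop) (M : 'M[K]_n) (c : K) :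
  M *m M = c *: M -> (forall z, Z z -> tangent_at Z z (z *m M)) ->
  forall p, vanishes_on Z p -> forall z, Z z -> forall t, p.@[(z + t *: (z *m M)) 0] = 0.
Proof.
move=> MM tM p Ip z Zz t; rewrite -horner_line.
pose h q := line z (z *m M) q.
have hD q : (1 + c *: 'X) * (h q)^`() = h (lin_field M q).
  apply: horner_ext => x; rewrite hornerM !hornerE horner_line lin_fieldE.
  rewrite /h deriv_line horner_sum mulr_sumr. apply: eq_bigr => j _.
  rewrite hornerM hornerC horner_line mulrCA; congr (_ * _).
  rewrite mulmxDl -scalemxAl -mulmxA MM -scalemxAr !mxE; ring.
suff H k : forall q, vanishes_on Z q -> (h q)`_k = 0.
  by have -> : line z (z *m M) p = 0 by [apply/polyP => k; rewrite coef0 H|]; rewrite horner0.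
elim/ltn_ind: k => -[|k] IH q Iq.
  by rewrite -horner_coef0 horner_line scale0r addr0 Iq.
have ID : vanishes_on Z (lin_field M q).
  by move=> y Zy; rewrite lin_fieldE tM.
have := IH k (ltnSn k) _ ID.
rewrite -hD mulrDl mul1r -scalerAl coefD coefZ coefXM !coef_deriv.
case: k IH => [|k] IH /=; first by rewrite mulr0 addr0 mulr1n.
rewrite (IH k.+1) // mul0rn mulr0 addr0 => /eqP; rewrite mulrn_eq0 /= => /eqP //.
Qed.

End Curves.

(** * Matrix lemmas *)

Section Transvections.
Variable (K : fieldType).

Definition transvection_closed m (H : 'M[K]_m -> Prop) :=
  forall n g, n *m n = 0 -> \tr n = 0 -> H g -> H ((1%:M + n) *m g).

(** An impredicative form of lying in one orbit under left multiplication by products of such 1 + n: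
    no list of factors has to be carried along. *)
Definition transvection_equiv m (g g' : 'M[K]_m) :=
  forall H, transvection_closed H -> H g <-> H g'.

Lemma transvection_equiv_trans m (g2 g1 g3 : 'M[K]_m) :
  transvection_equiv g1 g2 -> transvection_equiv g2 g3 -> transvection_equiv g1 g3.
Proof. by move=> H12 H23 H cH; apply: iff_trans (H12 H cH) (H23 H cH). Qed.

Lemma transvection_equiv_mul m (n g : 'M[K]_m) : n *m n = 0 -> \tr n = 0 ->
  transvection_equiv g ((1%:M + n) *m g).
Proof.
move=> nn tn H cH; split=> [|Hg]; first exact: cH.
have -> : g = (1%:M + - n) *m ((1%:M + n) *m g).
  rewrite mulmxA mulmxDl mul1mx mulNmx mulmxDr mulmx1 nn addr0.
  by rewrite [1%:M + n]addrC addrAC subrr add0r mul1mx.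
by apply: cH Hg; rewrite ?mulNmx ?mulmxN ?nn ?oppr0 // raddfN /= tn oppr0.
Qed.

Lemma transvection_equiv_up m (a : 'M[K]_1) b c (d : 'M_m) (y : 'rV_m) :
  transvection_equiv (block_mx a b c d) (block_mx (a + y *m c) (b + y *m d) c d).
Proof.
have -> : block_mx (a + y *m c) (b + y *m d) c d =
    (1%:M + block_mx 0 y 0 0) *m block_mx a b c d.
  by rewrite mulmxDl mul1mx mulmx_block !mul0mx ?add0r ?addr0 add_block_mx ?addr0.
apply: transvection_equiv_mul; last by rewrite mxtrace_block !mxtrace0 addr0.
by rewrite mulmx_block !mul0mx !mulmx0 !addr0 block_mx0.
Qed.

Lemma transvection_equiv_down m (a : 'M[K]_1) b c (d : 'M_m) (x : 'cV_m) :
  transvection_equiv (block_mx a b c d) (block_mx a b (c + x *m a) (d + x *m b)).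
Proof.
have -> : block_mx a b (c + x *m a) (d + x *m b) =
    (1%:M + block_mx 0 0 x 0) *m block_mx a b c d.
  by rewrite mulmxDl mul1mx mulmx_block !mul0mx ?addr0 add_block_mx ?addr0.
apply: transvection_equiv_mul; last by rewrite mxtrace_block !mxtrace0 addr0.
by rewrite mulmx_block !mul0mx !mulmx0 !addr0 block_mx0.
Qed.

(** Gaussian elimination by determinant-one row operations. A nonzero entry of the first column
    below the corner serves to make the corner 1; then the column is cleared, and finally the first
    row by means of the now invertible lower block. *)
Lemma transvection_equiv_reduce m (g : 'M[K]_(1 + m.+1)) : \det g != 0 ->
  exists2 d, \det d = \det g & transvection_equiv g (block_mx 1%:M 0 0 d).
Proof.
have red1 (b : 'rV[K]_m.+1) c (d : 'M[K]_m.+1) : \det (block_mx 1%:M b c d) != 0 ->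
    exists2 d', \det d' = \det (block_mx 1%:M b c d) &
      transvection_equiv (block_mx 1%:M b c d) (block_mx 1%:M 0 0 d').
  move=> det0; have H1 := @transvection_equiv_down _ 1%:M b c d (- c).
  rewrite mulmx1 subrr in H1; set d' := d + _ in H1.
  have detE : \det d' = \det (block_mx 1%:M b c d).
    have <- : block_mx 1%:M 0 c 1%:M *m block_mx 1%:M b 0 d' = block_mx 1%:M b c d.
      rewrite mulmx_block ?mul1mx ?mul0mx ?mulmx1 ?mulmx0 ?addr0.
      by rewrite /d' mulNmx addrCA subrr addr0.
    by rewrite det_mulmx det_ublock det_lblock !det1 !mul1r.
  exists d' => //; have ud : d' \in unitmx by rewrite unitmxE unitfE detE.
  apply: transvection_equiv_trans H1 _.
  have := @transvection_equiv_up _ 1%:M b 0 d' (- (b *m invmx d')).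
  by rewrite mulmx0 addr0 mulNmx -mulmxA mulVmx // mulmx1 subrr.
have redc (a : 'M[K]_1) b (c : 'cV[K]_m.+1) d : c != 0 -> \det (block_mx a b c d) != 0 ->
    exists2 d', \det d' = \det (block_mx a b c d) &
      transvection_equiv (block_mx a b c d) (block_mx 1%:M 0 0 d').
  move=> c0 det0; have [i ci] : exists i, c i 0 != 0.
    apply/existsP; rewrite -negb_forall; apply: contra c0 => /forallP c0.
    by apply/eqP/colP => i; rewrite mxE (eqP (c0 i)).
  pose y : 'rV[K]_m.+1 := ((1 - a 0 0) / c i 0) *: delta_mx 0 i.
  have yc : a + y *m c = 1%:M.
    rewrite -scalemxAl -rowE; apply/rowP=> j.
    by rewrite !ord1 !mxE divfK // addrC subrK.
  have H1 := @transvection_equiv_up _ a b c d y; rewrite yc in H1.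
  have detE : \det (block_mx 1%:M (b + y *m d) c d) = \det (block_mx a b c d).
    have <- : block_mx 1%:M y 0 1%:M *m block_mx a b c d = block_mx 1%:M (b + y *m d) c d.
      by rewrite mulmx_block ?mul1mx ?mul0mx ?add0r yc.
    by rewrite det_mulmx det_ublock !det1 !mul1r.
  have [|d' e H2] := red1 (b + y *m d) c d; first by rewrite detE.
  by exists d'; [rewrite e|exact: transvection_equiv_trans H2].
rewrite -[g]submxK; move: (ulsubmx g) (ursubmx g) (dlsubmx g) (drsubmx g) => a b c d det0.
have [c0|] := eqVneq c 0; last by move=> c0; exact: redc.
have a0 : a 0 0 != 0.
  apply: contraNneq det0 => e; rewrite c0 det_ublock [a]mx11_scalar e.
  by rewrite det_scalar1 mul0r.
(* If the column below the corner is zero, adding the first row to every other row makes it nonzero.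
   This is where size at least 2 matters. *)
have H1 := @transvection_equiv_down _ a b c d (const_mx 1).
have detE : \det (block_mx a b (c + const_mx 1 *m a) (d + const_mx 1 *m b)) =
    \det (block_mx a b c d).
  have <- : block_mx 1%:M 0 (const_mx 1) 1%:M *m block_mx a b c d =
      block_mx a b (c + const_mx 1 *m a) (d + const_mx 1 *m b).
    by rewrite mulmx_block ?mul1mx ?mul0mx ?addr0 addrC [_ *m b + d]addrC.
  by rewrite det_mulmx det_lblock !det1 !mul1r.
have [||d' e H2] := redc a b (c + const_mx 1 *m a) (d + const_mx 1 *m b).
- apply: contraNneq a0 => /colP/(_ 0); rewrite c0 add0r [a]mx11_scalar.
  by rewrite mul_mx_scalar !mxE mulr1 eqxx mulr1n => ->.
- by rewrite detE.
by exists d'; [rewrite e|exact: transvection_equiv_trans H2].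
Qed.

Lemma transvection_closed_lift m (H : 'M[K]_(1 + m) -> Prop) :
  transvection_closed H -> transvection_closed (fun x => H (block_mx 1%:M 0 0 x)).
Proof.
move=> cH n x nn tn Hx.
have -> : block_mx (1%:M : 'M_1) 0 0 ((1%:M + n) *m x) =
    (1%:M + block_mx 0 0 0 n) *m block_mx 1%:M 0 0 x.
  rewrite !mulmxDl !mul1mx mulmx_block !mul0mx !mulmx0 ?addr0 ?add0r.
  by rewrite add_block_mx ?addr0 ?add0r.
apply: cH Hx; last by rewrite mxtrace_block mxtrace0 add0r.
by rewrite mulmx_block nn !mul0mx !mulmx0 !addr0 block_mx0.
Qed.

(** Reduction leaves a smaller block with the same determinant; in size 1 the determinant is the
    matrix. *)
Lemma transvection_equiv_det m (g g' : 'M[K]_m) :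
  \det g != 0 -> \det g = \det g' -> transvection_equiv g g'.
Proof.
elim: m g g' => [|[|m] IH] g g' det0 e.
- by have -> : g = g' by apply/matrixP => -[].
- have -> : g = g'; last by [].
  by rewrite [g]mx11_scalar [g']mx11_scalar -!det_mx11 e.
have [d de Hd] := transvection_equiv_reduce det0.
have [|d' de' Hd'] := @transvection_equiv_reduce m g'; first by rewrite -e.
move=> H cH; apply: iff_trans (Hd H cH) (iff_trans _ (iff_sym (Hd' H cH))).
have cH' := transvection_closed_lift (cH : transvection_closed (H : 'M_(1 + m.+1) -> Prop)).
by have := IH d d' _ _ _ cH'; rewrite de de'; apply.
Qed.

End Transvections.

(** * Normal forms of pairs with AB^T = B^TA = 0 *)

Section MatrixPairs.
Variable (K : fieldType).

Lemma mxtrace_eq0 m n (M : 'M[K]_(m, n)) : (forall g, \tr (g *m M) = 0) -> M = 0.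
Proof.
move=> H; apply/matrixP=> i j; rewrite mxE -(H (delta_mx j i)).
rewrite /mxtrace (bigD1 j) //= big1 ?addr0 => [|k kj].
  rewrite mxE (bigD1 i) //= big1 ?addr0 => [|l li]; first by rewrite mxE !eqxx mul1r.
  by rewrite mxE (negPf li) andbF mul0r.
by rewrite mxE big1 // => l _; rewrite mxE (negPf kj) mul0r.
Qed.

(** In bases where A is an identity block, the two equations kill the first block row and the first
    block column of B^T. *)
Lemma pair_normal_form a n (A B : 'M[K]_(a + n)) :
  \rank A = a -> A *m B^T = 0 -> B^T *m A = 0 ->
  exists (P P' Q Q' : 'M[K]_(a + n)) (B2 : 'M[K]_n),
    [/\ P' *m P = 1%:M, Q' *m Q = 1%:M, A = P *m block_mx 1%:M 0 0 0 *m Q &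
        B = P'^T *m block_mx 0 0 0 B2 *m Q'^T].
Proof.
move=> rA AB BA; pose P := col_ebase A; pose Q := row_ebase A.
have P'P : invmx P *m P = 1%:M by rewrite mulVmx ?col_ebase_unit.
have Q'Q : invmx Q *m Q = 1%:M by rewrite mulVmx ?row_ebase_unit.
have PP' := mulmx1C P'P; have QQ' := mulmx1C Q'Q.
have AE : A = P *m block_mx 1%:M 0 0 0 *m Q.
  by rewrite -pid_mx_block -[LHS]mulmx_ebase rA.
pose B1 := P^T *m B *m Q^T.
have BE : B = (invmx P)^T *m B1 *m (invmx Q)^T.
  rewrite /B1 !mulmxA -trmx_mul PP' trmx1 mul1mx -mulmxA -trmx_mul Q'Q.
  by rewrite trmx1 mulmx1.
have e1 : (block_mx 1%:M 0 0 0 : 'M_(a + n)) *m B1^T = 0.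
  transitivity (invmx P *m (A *m B^T) *m P); last by rewrite AB mulmx0 mul0mx.
  by rewrite {1}AE /B1 !trmx_mul !trmxK !mulmxA P'P mul1mx.
have e2 : B1^T *m (block_mx 1%:M 0 0 0 : 'M_(a + n)) = 0.
  transitivity (Q *m (B^T *m A) *m invmx Q); last by rewrite BA mulmx0 mul0mx.
  by rewrite {1}AE /B1 !trmx_mul !trmxK -!mulmxA QQ' mulmx1.
exists P, (invmx P), Q, (invmx Q), (drsubmx B1); split=> //.
rewrite {1}BE; congr (_ *m _ *m _); rewrite -[LHS]submxK.
move: e1 e2; rewrite -{1 2}[B1]submxK tr_block_mx !mulmx_block.
have z0 : (0 : 'M[K]_(a + n)) = block_mx 0 0 0 0 by rewrite block_mx0.
rewrite !mul1mx !mul0mx !mulmx1 !mulmx0 !addr0 z0.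
move=> /eq_block_mx[/(canRL (@trmxK _ _ _)) -> /(canRL (@trmxK _ _ _)) -> _ _].
move=> /eq_block_mx[_ _ /(canRL (@trmxK _ _ _)) -> _].
by rewrite !trmx0.
Qed.

Lemma mxrank_conj m (P P' D Q Q' : 'M[K]_m) :
  P' *m P = 1%:M -> Q' *m Q = 1%:M -> \rank (P *m D *m Q) = \rank D.
Proof.
move=> PP QQ; rewrite mxrankMfree; last by apply/row_freeP; exists Q'; exact: mulmx1C.
by rewrite eqmxMfull //; apply/row_fullP; exists P'.
Qed.

(** The pairs of ranks exactly k and m - k are dense: a line through (A, B) has all its other points
    there. In normal form the missing rank is supplied by t times complementary idempotents, added
    to the free block of each matrix. *)
Lemma pair_approx m k (A B : 'M[K]_m) : (k <= m)%N ->
  A *m B^T = 0 -> B^T *m A = 0 -> (\rank A <= k)%N -> (\rank B <= m - k)%N ->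
  exists A1 B1 : 'M[K]_m, forall t : K, t != 0 ->
    [/\ (A + t *: A1) *m (B + t *: B1)^T = 0, (B + t *: B1)^T *m (A + t *: A1) = 0,
        \rank (A + t *: A1)%R = k & \rank (B + t *: B1)%R = (m - k)%N].
Proof.
have [a ra] : exists a, \rank A = a by exists (\rank A).
move=> km AB BA; rewrite ra => ak rB.
have [n em] : exists n, m = (a + n)%N by exists (m - a)%N; rewrite subnKC // -ra rank_leq_row.
subst m; have [P [P' [Q [Q' [B2 [PP QQ AE BE]]]]]] := pair_normal_form ra AB BA.
have PPt : P^T *m P'^T = 1%:M by rewrite -trmx_mul PP trmx1.
have QQt : Q^T *m Q'^T = 1%:M by rewrite -trmx_mul QQ trmx1.
have rB2 : \rank B = \rank B2.
  by rewrite BE (mxrank_conj _ PPt QQt) rank_diag_block_mx mxrank0.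
pose r := (a + n - k)%N; pose b := \rank B2.
have br : (b <= r)%N by rewrite /b -rB2.
have rn : (r <= n)%N by rewrite /r leq_subLR leq_add2r.
have bn := leq_trans br rn.
pose L := col_ebase B2; pose M := row_ebase B2.
have LL : invmx L *m L = 1%:M by rewrite mulVmx ?col_ebase_unit.
have MM : invmx M *m M = 1%:M by rewrite mulVmx ?row_ebase_unit.
have LLt : L^T *m (invmx L)^T = 1%:M by rewrite -trmx_mul LL trmx1.
have MMt : M^T *m (invmx M)^T = 1%:M by rewrite -trmx_mul MM trmx1.
pose E := (invmx L)^T *m copid_mx r *m (invmx M)^T.
(* Diagonal with b ones, then r - b entries t. Its product with [D t^-1] is [pid_mx r], which gives
   the rank for t nonzero. *)
pose D t : 'M[K]_n := pid_mx b + t *: (pid_mx r - pid_mx b).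
have bb : (pid_mx b : 'M[K]_n) *m pid_mx b = pid_mx b :> 'M[K]_n by rewrite pid_mx_id.
have rr : (pid_mx r : 'M[K]_n) *m pid_mx r = pid_mx r :> 'M[K]_n by rewrite pid_mx_id.
have bpr : (pid_mx b : 'M[K]_n) *m pid_mx r = pid_mx b :> 'M[K]_n.
  by rewrite mul_pid_mx (minn_idPl br) (minn_idPr bn).
have rpb : (pid_mx r : 'M[K]_n) *m pid_mx b = pid_mx b :> 'M[K]_n.
  by rewrite mul_pid_mx (minn_idPr br) (minn_idPr bn).
have Dtr t : (D t)^T = D t by rewrite /D linearD linearZ linearB /= !tr_pid_mx.
have cD t : copid_mx r *m D t = 0.
  by rewrite mulmxBl mul1mx /D mulmxDr -scalemxAr mulmxBr rr rpb subrr.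
have Dc t : D t *m copid_mx r = 0.
  by rewrite mulmxBr mulmx1 /D mulmxDl -scalemxAl mulmxBl rr bpr subrr.
exists (P *m block_mx 0 0 0 E *m Q), (P'^T *m block_mx 0 0 0 (L *m (pid_mx r - pid_mx b) *m M) *m Q'^T).
move=> t t0.
have AtE : A + t *: (P *m block_mx 0 0 0 E *m Q) = P *m block_mx 1%:M 0 0 (t *: E) *m Q.
  rewrite {1}AE scalemxAl scalemxAr -mulmxDl -mulmxDr scale_block_mx add_block_mx.
  by rewrite !scaler0 !addr0 add0r.
have BtE : B + t *: (P'^T *m block_mx 0 0 0 (L *m (pid_mx r - pid_mx b) *m M) *m Q'^T) =
    P'^T *m block_mx 0 0 0 (L *m D t *m M) *m Q'^T.
  rewrite {1}BE scalemxAl scalemxAr -mulmxDl -mulmxDr scale_block_mx add_block_mx.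
  rewrite !scaler0 !addr0 -{1}[B2]mulmx_ebase scalemxAl scalemxAr.
  by rewrite -mulmxDl -mulmxDr.
have EF : (t *: E) *m (L *m D t *m M)^T = 0.
  rewrite !trmx_mul -scalemxAl /E -!mulmxA [(invmx M)^T *m _]mulmxA (mulmx1C MMt) mul1mx.
  by rewrite [copid_mx r *m _]mulmxA Dtr cD mul0mx mulmx0 scaler0.
have FE : (L *m D t *m M)^T *m (t *: E) = 0.
  rewrite !trmx_mul -scalemxAr /E !mulmxA -[_ *m L^T *m _]mulmxA LLt mulmx1.
  by rewrite Dtr -[M^T *m _ *m _]mulmxA Dc mulmx0 mul0mx scaler0.
rewrite AtE BtE; split.
- rewrite !trmx_mul !trmxK tr_block_mx !trmx0 !mulmxA -[_ *m Q *m Q']mulmxA (mulmx1C QQ).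
  rewrite mulmx1 -[P *m _ *m _]mulmxA mulmx_block !mul0mx !mulmx0 !addr0 add0r.
  by rewrite EF block_mx0 mulmx0 mul0mx.
- move: FE; move: (L *m D t *m M) => F FE.
  rewrite !trmx_mul !trmxK tr_block_mx !trmx0 -!mulmxA [P' *m _]mulmxA PP.
  rewrite mul1mx [X in Q' *m X]mulmxA mulmx_block !mul0mx !mulmx0 !addr0 add0r.
  by rewrite FE block_mx0 mul0mx mulmx0.
- rewrite (mxrank_conj _ PP QQ) rank_diag_block_mx mxrank1 mxrank_scale_nz //.
  rewrite /E (mxrank_conj _ LLt MMt) rank_copid_mx //.
  by rewrite addnBA // subKn.
- rewrite (mxrank_conj _ PPt QQt) rank_diag_block_mx mxrank0 add0n.
  rewrite (mxrank_conj _ LL MM); apply/eqP; rewrite eqn_leq; apply/andP; split.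
    have := mulmx0_rank_max (Dc t); rewrite rank_copid_mx // => H.
    by rewrite -(leq_add2r (n - r)) subnKC.
  have DD : D t *m D t^-1 = pid_mx r.
    rewrite /D mulmxDl !mulmxDr -!scalemxAr -!scalemxAl scalerA mulVf // scale1r.
    rewrite !mulmxBr !mulmxBl bb rr bpr rpb !subrr !scaler0 addr0 add0r subr0.
    by rewrite addrC subrK.
  have <- : \rank (D t *m D t^-1) = (a + n - k)%N by rewrite DD rank_pid_mx.
  exact: mxrankM_maxl.
Qed.

Lemma copid_mx_block a n : copid_mx a = block_mx 0 0 0 1%:M :> 'M[K]_(a + n).
Proof.
rewrite /copid_mx pid_mx_block scalar_mx_block opp_block_mx add_block_mx.
by rewrite !oppr0 !addr0 subrr.
Qed.

(** When the ranks add up to m the remaining block of B is invertible and can be absorbed into the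
    left change of basis. *)
Lemma pair_normal_form_full m a (A B : 'M[K]_m) :
  A *m B^T = 0 -> B^T *m A = 0 -> \rank A = a -> \rank B = (m - a)%N ->
  exists P P' Q Q' : 'M[K]_m, [/\ P' *m P = 1%:M, Q' *m Q = 1%:M,
    A = P *m pid_mx a *m Q & B = P'^T *m copid_mx a *m Q'^T].
Proof.
move=> AB BA ra rB.
have [n em] : exists n, m = (a + n)%N by exists (m - a)%N; rewrite subnKC // -ra rank_leq_row.
subst m; have [P [P' [Q [Q' [B2 [PP QQ AE BE]]]]]] := pair_normal_form ra AB BA.
have PPt : P^T *m P'^T = 1%:M by rewrite -trmx_mul PP trmx1.
have QQt : Q^T *m Q'^T = 1%:M by rewrite -trmx_mul QQ trmx1.
have uB2 : B2 \in unitmx.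
  rewrite -row_free_unit /row_free; apply/eqP; move: rB.
  by rewrite BE (mxrank_conj _ PPt QQt) rank_diag_block_mx mxrank0 addKn.
pose C : 'M_(a + n) := block_mx 1%:M 0 0 (invmx B2)^T.
pose C' : 'M_(a + n) := block_mx 1%:M 0 0 B2^T.
exists (P *m C), (C' *m P'), Q, Q'; split=> //.
- rewrite -!mulmxA [P' *m _]mulmxA PP mul1mx /C /C' mulmx_block.
  rewrite ?mul0mx ?mulmx0 ?mulmx1 ?addr0 ?add0r -trmx_mul mulVmx // trmx1.
  by rewrite -scalar_mx_block.
- rewrite AE pid_mx_block -[P *m C *m _]mulmxA /C mulmx_block.
  by rewrite ?mul0mx ?mulmx0 ?mulmx1 ?addr0.
- rewrite BE copid_mx_block trmx_mul -[_ *m C'^T *m _]mulmxA /C' tr_block_mx mulmx_block.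
  by rewrite ?mul0mx ?mulmx0 ?mulmx1 ?trmx0 ?mul0mx ?addr0 ?add0r trmxK.
Qed.

End MatrixPairs.

Section Normalization.
Variable (K : numClosedFieldType).

(** Multiplying [P] by a diagonal matrix with entries x (a times) and y only rescales the two
    blocks, while x^a y^(m-a) takes any nonzero value over a closed field. If a = 0 only y can
    correct the determinant. *)
Lemma det_normalize m a (P P' : 'M[K]_m) : (0 < m)%N -> (a <= m)%N -> P' *m P = 1%:M ->
  exists (P1 P1' : 'M[K]_m) (u v : K), [/\ P1' *m P1 = 1%:M, \det P1 = 1, u != 0 /\ v != 0,
    P *m pid_mx a = u *: (P1 *m pid_mx a) :> 'M_m & P'^T *m copid_mx a = v *: (P1'^T *m copid_mx a)].
Proof.
move=> m0 am PP; pose D (x y : K) : 'M[K]_m := x *: pid_mx a + y *: copid_mx a.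
have pp : (pid_mx a : 'M[K]_m) *m pid_mx a = pid_mx a :> 'M_m by rewrite pid_mx_id.
have cc : (copid_mx a : 'M[K]_m) *m copid_mx a = copid_mx a by rewrite copid_mx_id.
have pc : (pid_mx a : 'M[K]_m) *m copid_mx a = 0 by rewrite mul_pid_mx_copid.
have cp : (copid_mx a : 'M[K]_m) *m pid_mx a = 0 :> 'M_m by rewrite mul_copid_mx_pid.
have Dp x y : D x y *m pid_mx a = x *: pid_mx a :> 'M_m.
  by rewrite mulmxDl -!scalemxAl pp cp scaler0 addr0.
have Dc x y : D x y *m copid_mx a = y *: copid_mx a.
  by rewrite mulmxDl -!scalemxAl cc pc scaler0 add0r.
have DD x y : x != 0 -> y != 0 -> D x^-1 y^-1 *m D x y = 1%:M.
  move=> x0 y0; rewrite {2}/D mulmxDr -!scalemxAr Dp Dc !scalerA !mulfV // !scale1r.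
  by rewrite addrC subrK.
have Dtr x y : (D x y)^T = D x y.
  by rewrite /D linearD !linearZ linearB /= trmx1 !tr_pid_mx.
have detD x y : \det (D x y) = x ^+ a * y ^+ (m - a).
  rewrite /D; have [n em] : exists n, m = (a + n)%N by exists (m - a)%N; rewrite subnKC.
  subst m; rewrite addKn pid_mx_block copid_mx_block !scale_block_mx add_block_mx.
  by rewrite !scaler0 ?add0r ?addr0 det_ublock !detZ !det1 !mulr1.
have dP : \det P != 0.
  by apply: contraTneq (oner_neq0 K) => e; rewrite -(det1 _ m) -PP det_mulmx e mulr0 eqxx.
have [x [y [x0 y0 dxy]]] : exists x y, [/\ x != 0, y != 0 & x ^+ a * y ^+ (m - a) = (\det P)^-1].
  have root0 k : (0 < k)%N -> k.-root (\det P)^-1 != 0.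
    move=> k0; have : (\det P)^-1 != 0 by rewrite invr_eq0.
    by apply: contra_neq => e; rewrite -(rootCK k0 (\det P)^-1) e expr0n eqn0Ngt k0.
  have [a0|a0] := posnP a.
    by exists 1, (m.-root (\det P)^-1); rewrite a0 subn0 mul1r rootCK // oner_neq0 root0.
  by exists (a.-root (\det P)^-1), 1; rewrite expr1n mulr1 rootCK // oner_neq0 root0.
exists (P *m D x y), (D x^-1 y^-1 *m P'), x^-1, y; split.
- by rewrite -!mulmxA [P' *m _]mulmxA PP mul1mx DD.
- by rewrite det_mulmx detD dxy mulfV.
- by rewrite invr_eq0.
- by rewrite -mulmxA Dp -scalemxAr scalerA mulVf // scale1r.
- by rewrite trmx_mul Dtr -mulmxA Dc -scalemxAr scalerA mulfV // scale1r.
Qed.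

(** The two scalars are the price of determinant one; [degenerate_scale] removes them. *)
Lemma SL_normal_form m a (A B : 'M[K]_m) : (0 < m)%N ->
  A *m B^T = 0 -> B^T *m A = 0 -> \rank A = a -> \rank B = (m - a)%N ->
  exists (P P' Q Q' : 'M[K]_m) (s t : K), [/\ P' *m P = 1%:M /\ Q' *m Q = 1%:M,
    \det P = 1 /\ \det Q = 1, s != 0 /\ t != 0, A = s *: (P *m pid_mx a *m Q) &
    B = t *: (P'^T *m copid_mx a *m Q'^T)].
Proof.
move=> m0 AB BA ra rB; have am : (a <= m)%N by rewrite -ra rank_leq_row.
have [P [P' [Q [Q' [PP QQ AE BE]]]]] := pair_normal_form_full AB BA ra rB.
have [P1 [P1' [u [v [PP1 dP1 [u0 v0] Pp Pc]]]]] := det_normalize m0 am PP.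
have QQt : Q'^T *m Q^T = 1%:M by rewrite -trmx_mul (mulmx1C QQ) trmx1.
have [Q1 [Q1' [x [y [QQ1 dQ1 [x0 y0] Qp Qc]]]]] := det_normalize m0 am QQt.
exists P1, P1', Q1^T, Q1'^T, (x * u), (y * v); split.
- by split=> //; rewrite -trmx_mul (mulmx1C QQ1) trmx1.
- by rewrite det_tr.
- by rewrite !mulf_neq0.
- have {}Qp : pid_mx a *m Q = x *: (pid_mx a *m Q1^T) :> 'M_m.
    by apply: trmx_inj; rewrite linearZ /= !trmx_mul trmxK tr_pid_mx.
  by rewrite AE Pp -scalemxAl -[P1 *m _ *m Q]mulmxA Qp -scalemxAr scalerA mulmxA mulrC.
have {}Qc : copid_mx a *m Q'^T = y *: (copid_mx a *m Q1').
  apply: trmx_inj; rewrite linearZ /= !trmx_mul.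
  have -> : (copid_mx a : 'M[K]_m)^T = copid_mx a by rewrite linearB /= trmx1 tr_pid_mx.
  exact: Qc.
by rewrite BE Pc -scalemxAl -[P1'^T *m _ *m Q'^T]mulmxA Qc -scalemxAr scalerA mulmxA mulrC trmxK.
Qed.

End Normalization.

(** * Spanning sets of matrices and tangents to orbits *)

Section MatrixSpans.
Variable (K : fieldType).

(** The bordered matrix with rows (1, -y) and (x, 1) has two triangular factorisations, of
    determinants det(1 + xy) and 1. *)
Lemma det_1_add_rank1 m (x : 'cV[K]_m) (y : 'rV[K]_m) :
  y *m x = 0 -> \det (1%:M + x *m y) = 1.
Proof.
move=> yx.
have e1 : block_mx 1%:M 0 x 1%:M *m block_mx (1%:M : 'M_1) (- y) 0 (1%:M + x *m y) =
    block_mx 1%:M (- y) x 1%:M.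
  rewrite mulmx_block ?mul1mx ?mul0mx ?mulmx0 ?mulmx1 ?addr0 mulmxN.
  by rewrite addrC addrK.
have e2 : block_mx (1%:M : 'M_1) (- y) 0 1%:M *m block_mx 1%:M 0 x 1%:M =
    block_mx 1%:M (- y) x 1%:M.
  by rewrite mulmx_block ?mul1mx ?mul0mx ?mulmx0 ?mulmx1 ?add0r mulNmx yx subr0.
have := congr1 determinant (etrans e1 (esym e2)).
by rewrite !det_mulmx !det_ublock !det_lblock !det1 !mul1r.
Qed.

Lemma matrix_span m n (P : 'M[K]_(m, n) -> Prop) :
  P 0 -> (forall a b, P a -> P b -> P (a + b)) -> (forall c a, P a -> P (c *: a)) ->
  (forall i j, P (delta_mx i j)) -> forall a, P a.
Proof.
move=> P0 PD PZ Pd a; rewrite [a]matrix_sum_delta.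
by apply: (big_ind P) => // i _; apply: (big_ind P) => // j _; exact: PZ.
Qed.

(** Rank-one square-zero matrices span sl_m. They are convenient because 1 + t xy is a straight line
    inside SL_m. *)
Lemma traceless_span m (P : 'M[K]_m -> Prop) :
  P 0 -> (forall a b, P a -> P b -> P (a + b)) -> (forall c a, P a -> P (c *: a)) ->
  (forall (x : 'cV[K]_m) (y : 'rV[K]_m), y *m x = 0 -> P (x *m y)) ->
  forall a, \tr a = 0 -> P a.
Proof.
case: m P => [|m] P P0 PD PZ Pxy a ta.
  by rewrite (_ : a = 0) //; apply/matrixP=> -[].
pose e (i j : 'I_m.+1) : 'M[K]_m.+1 := delta_mx i j - (i == j)%:R *: delta_mx 0 0.
have Pd (i j : 'I_m.+1) : i != j -> P (delta_mx i j).
  move=> ij; rewrite -(mul_delta_mx (0 : 'I_1)); apply: Pxy.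
  by rewrite mul_delta_mx_0 // eq_sym.
have PN b : P b -> P (- b) by move=> Pb; rewrite -scaleN1r; exact: PZ.
have Pe i j : P (e i j).
  rewrite /e; have [<-|ij] := eqVneq i j; last by rewrite scale0r subr0; exact: Pd.
  rewrite scale1r; have [->|i0] := eqVneq i 0; first by rewrite subrr.
  (* The product (e_i + e_0)(e_i - e_0)^T is square-zero and differs from the diagonal matrix E_ii -
     E_00 only by off-diagonal units. *)
  pose x : 'cV[K]_m.+1 := delta_mx i 0 + delta_mx 0 0.
  pose y : 'rV[K]_m.+1 := delta_mx 0 i - delta_mx 0 0.
  have -> : delta_mx i i - delta_mx 0 0 = x *m y + (delta_mx i 0 - delta_mx 0 i) :> 'M[K]_m.+1.
    rewrite /x /y mulmxDl !mulmxBr !(mul_delta_mx (0 : 'I_1)).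
    apply/matrixP=> k l; rewrite !mxE; ring.
  apply: (PD); last by apply: (PD); [|apply: (PN)]; apply: Pd; rewrite // eq_sym.
  apply: Pxy; rewrite /x /y mulmxDr !mulmxBl !mul_delta_mx_cond !eqxx [0 == i]eq_sym (negPf i0).
  by rewrite !mulr0n !mulr1n subr0 sub0r subrr.
have -> : a = \sum_i \sum_j a i j *: e i j.
  transitivity (\sum_i \sum_j (a i j *: delta_mx i j - a i j *: ((i == j)%:R *: delta_mx 0 0))).
    under eq_bigr do rewrite sumrB; rewrite sumrB -matrix_sum_delta.
    rewrite [X in a - X](_ : _ = (\tr a) *: delta_mx 0 0).
      by rewrite ta scale0r subr0.
    rewrite /mxtrace scaler_suml; apply: eq_bigr => i _.
    rewrite (bigD1 i) //= big1 ?addr0 => [|j ji]; first by rewrite eqxx scale1r.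
    by rewrite eq_sym (negPf ji) scale0r scaler0.
  by apply: eq_bigr => i _; apply: eq_bigr => j _; rewrite -scalerBr.
by apply: (big_ind P) => // i _; apply: (big_ind P) => // j _; exact: PZ.
Qed.

Lemma scalar_of_traceless m (M : 'M[K]_m) : (m%:R : K) != 0 ->
  (forall C, \tr C = 0 -> \tr (C *m M) = 0) -> M = (\tr M / m%:R)%:M.
Proof.
move=> m0 H; apply/eqP; rewrite -subr_eq0; apply/eqP; apply: mxtrace_eq0 => g.
pose C := g - (\tr g / m%:R)%:M.
have tC : \tr C = 0 by rewrite raddfB /= mxtrace_scalar -[_ / _ *+ m]mulr_natr divfK // subrr.
have := H C tC; rewrite mulmxBl mul_scalar_mx raddfB /= mxtraceZ => e.
rewrite mulmxBr mul_mx_scalar raddfB /= mxtraceZ -[RHS]e; congr (_ - _); field.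
exact: m0.
Qed.

(* The tangent space to the orbit of (A, B) under (gAh, g^-T B h^-T) is cut
   out by the differentials of AB^T and B^TA. *)
Lemma pair_orbit_tangent m a (A B A' B' : 'M[K]_m) :
  A *m B^T = 0 -> B^T *m A = 0 -> \rank A = a -> \rank B = (m - a)%N ->
  A' *m B^T + A *m B'^T = 0 -> B^T *m A' + B'^T *m A = 0 ->
  exists g h, A' = g *m A + A *m h /\ B' = - (g^T *m B) - B *m h^T.
Proof.
move=> AB BA ra rB e1 e2.
have [n em] : exists n, m = (a + n)%N by exists (m - a)%N; rewrite subnKC // -ra rank_leq_row.
subst m; have [P [P' [Q [Q' [PP QQ AE BE]]]]] := pair_normal_form_full AB BA ra rB.
have PP' := mulmx1C PP; have QQ' := mulmx1C QQ.
have PPt : P^T *m P'^T = 1%:M by rewrite -trmx_mul PP trmx1.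
have QQt : Q'^T *m Q^T = 1%:M by rewrite -trmx_mul QQ' trmx1.
pose J : 'M[K]_(a + n) := block_mx 1%:M 0 0 0.
pose L : 'M[K]_(a + n) := block_mx 0 0 0 1%:M.
have {}AE : A = P *m J *m Q by rewrite AE pid_mx_block.
have {}BE : B = P'^T *m L *m Q'^T by rewrite BE copid_mx_block.
have LT : L^T = L by rewrite /L tr_block_mx !trmx0 trmx1.
pose x := P' *m A' *m Q'; pose y := P^T *m B' *m Q^T.
have f1 : x *m L + J *m y^T = 0.
  transitivity (P' *m (A' *m B^T + A *m B'^T) *m P); last by rewrite e1 mulmx0 mul0mx.
  rewrite BE AE !trmx_mul !trmxK LT mulmxDr mulmxDl /x /y ?trmx_mul ?trmxK.
  by rewrite !mulmxA PP mul1mx -!mulmxA PP mulmx1.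
have f2 : L *m x + y^T *m J = 0.
  transitivity (Q *m (B^T *m A' + B'^T *m A) *m Q'); last by rewrite e2 mulmx0 mul0mx.
  rewrite BE AE !trmx_mul !trmxK LT mulmxDr mulmxDl /x /y ?trmx_mul ?trmxK.
  by rewrite !mulmxA QQ' mul1mx -!mulmxA QQ' mulmx1.
suff [g [h [gx gy]]] : exists g h : 'M[K]_(a + n), x = g *m J + J *m h /\ y = - (g^T *m L) - L *m h^T.
  exists (P *m g *m P'), (Q' *m h *m Q); split.
    have -> : A' = P *m x *m Q.
      by rewrite /x !mulmxA PP' mul1mx -mulmxA QQ mulmx1.
    rewrite gx AE mulmxDr mulmxDl; congr (_ + _); rewrite !mulmxA.
      by rewrite -[P *m g *m P' *m P]mulmxA PP mulmx1.
    by rewrite -[P *m J *m Q *m Q']mulmxA QQ' mulmx1.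
  have -> : B' = P'^T *m y *m Q'^T.
    by rewrite /y !mulmxA -trmx_mul PP' trmx1 mul1mx -mulmxA -trmx_mul QQ trmx1 mulmx1.
  rewrite gy BE mulmxBr mulmxBl mulmxN mulNmx !trmx_mul; congr (- _ - _); rewrite !mulmxA.
    by rewrite -[_ *m P^T *m P'^T]mulmxA PPt mulmx1.
  by rewrite -[_ *m Q'^T *m Q^T]mulmxA QQt mulmx1.
move: f1 f2; rewrite -[x]submxK -[y]submxK.
move: (ulsubmx x) (ursubmx x) (dlsubmx x) (drsubmx x) => x1 x2 x3 x4.
move: (ulsubmx y) (ursubmx y) (dlsubmx y) (drsubmx y) => y1 y2 y3 y4.
have z0 : (0 : 'M[K]_(a + n)) = block_mx 0 0 0 0 by rewrite block_mx0.
rewrite tr_block_mx /J /L !mulmx_block ?mul1mx ?mul0mx ?mulmx1 ?mulmx0 ?addr0 ?add0r.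
rewrite !add_block_mx ?addr0 ?add0r z0.
move=> /eq_block_mx[y1E e3 _ x4E] /eq_block_mx[_ _ e4 _].
have {}y1E : y1 = 0 by apply: trmx_inj; rewrite y1E trmx0.
have y3E : y3 = - x2^T.
  by apply: trmx_inj; rewrite linearN /= trmxK; apply/eqP; rewrite -addr_eq0 addrC e3.
have y2E : y2 = - x3^T.
  by apply: trmx_inj; rewrite linearN /= trmxK; apply/eqP; rewrite -addr_eq0 addrC e4.
(* The equations force x4 = 0, y1 = 0, y2 = -x3^T and y3 = -x2^T; of the free blocks, g carries x1,
   x3, y4 and h carries x2. *)
exists (block_mx x1 0 x3 (- y4^T)), (block_mx 0 x2 0 0).
rewrite !tr_block_mx !mulmx_block ?mul1mx ?mul0mx ?mulmx1 ?mulmx0 ?addr0 ?add0r ?trmx0.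
rewrite !opp_block_mx !add_block_mx ?oppr0 ?addr0 ?add0r x4E y1E y2E y3E.
by split=> //; rewrite ?mulmx0 ?mul1mx ?oppr0 ?addr0 ?add0r [(- _)^T]linearN /= trmxK opprK.
Qed.

End MatrixSpans.

(** * Coordinates, dimension and Lagrangian cones *)

Local Open Scope classical_set_scope.

Section Coordinates.
Variables (R : realType) (m : nat).
Notation K := R[i].
Notation N := (coord_dim m).
Notation V := (V R m).
Implicit Types (u v z : V) (Z : set V).

Definition rv v : 'rV[K]_N := row_mx (mxvec v.1) (mxvec v.2).

Definition unrv (x : 'rV[K]_N) : V :=
  (vec_mx (lsubmx (x : 'rV_(m * m + m * m))), vec_mx (rsubmx (x : 'rV_(m * m + m * m)))).

Lemma rvK : cancel rv unrv.
Proof. by case=> A B; rewrite /unrv /rv row_mxKl row_mxKr !mxvecK. Qed.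

Lemma unrvK : cancel unrv rv.
Proof. by move=> x; rewrite /unrv /rv /= !vec_mxK hsubmxK. Qed.

Lemma rv_is_linear a u v : rv (a *: u + v) = a *: rv u + rv v.
Proof.
by rewrite /rv /= !linearP /= scale_row_mx add_row_mx.
Qed.

HB.instance Definition _ :=
  GRing.isLinear.Build K V 'rV[K]_N *:%R rv rv_is_linear.

Lemma unrv_is_linear a x y : unrv (a *: x + y) = a *: unrv x + unrv y.
Proof. by apply: (can_inj rvK); rewrite linearP /= !unrvK. Qed.

HB.instance Definition _ :=
  GRing.isLinear.Build K 'rV[K]_N V *:%R unrv unrv_is_linear.

Lemma coordsE v : coords v = rv v 0.
Proof. by []. Qed.

Definition in_coords Z (x : 'rV[K]_N) := Z (unrv x).

Lemma ideal_ofE Z p : ideal_of Z p <-> vanishes_on (in_coords Z) p.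
Proof.
split=> H z Zz; first by have := H _ Zz; rewrite coordsE unrvK.
by rewrite coordsE H // /in_coords rvK.
Qed.

Lemma tangent_spaceE Z z v :
  tangent_space Z z v <-> tangent_at (in_coords Z) (rv z) (rv v).
Proof. by split=> H p /ideal_ofE/H. Qed.

Lemma vspace_of_mx (M : 'M[K]_N) :
  exists T : {vspace V}, (forall v, v \in T <-> (rv v <= M)%MS) /\ \dim T = \rank M.
Proof.
pose B := row_base M.
pose X := [tuple unrv (row i B) | i < \rank M].
have Xi (i : 'I_(\rank M)) : rv X`_i = row i B.
  by rewrite (nth_map i) ?size_enum_ord // nth_ord_enum unrvK.
have XE (k : 'I_(\rank M) -> K) : rv (\sum_i k i *: X`_i) = \row_i k i *m B.
  rewrite linear_sum mulmx_sum_row; apply: eq_bigr => i _.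
  by rewrite linearZ /= Xi mxE.
have freeX : free X.
  apply/freeP => k /(congr1 rv); rewrite XE linear0 => /eqP.
  rewrite mulmx_free_eq0 ?row_base_free // => /eqP/rowP k0 i.
  by have := k0 i; rewrite !mxE.
exists <<X>>%VS; split=> [v|]; last by rewrite (eqP freeX) size_tuple.
have -> : (rv v <= M)%MS = (rv v <= B)%MS by rewrite eq_row_base.
split=> [/coord_span ->|/submxP[k rvv]].
  by rewrite XE submxMl.
have -> : v = \sum_i k 0 i *: X`_i.
  apply: (can_inj rvK); rewrite XE rvv; congr (_ *m _).
  by apply/rowP=> i; rewrite mxE.
apply: memv_suml => i _; apply: memvZ; apply: memv_span; apply: mem_nth.
by rewrite size_tuple.
Qed.

Lemma affine_irreducible_prime Z :
  affine_irreducible Z -> char0_prime_ideal (vanishes_on (in_coords Z)).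
Proof.
move=> [_ [z0 Zz0] irr]; have Zr0 : in_coords Z (rv z0) by rewrite /in_coords rvK.
split.
- by move=> z _; rewrite meval0.
- by move=> p q Ip Iq z Zz; rewrite mevalD Ip // Iq // addr0.
- by move=> p q Iq z Zz; rewrite mevalM Iq // mulr0.
- move=> p q Ipq.
  have [||z Zz|H|H] := irr [set z | p.@[coords z] = 0] [set z | q.@[coords z] = 0].
  + by exists [set p]; apply/seteqP; split=> z /= => [pz _ ->//|]; exact.
  + by exists [set q]; apply/seteqP; split=> z /= => [pz _ ->//|]; exact.
  + have /eqP := (ideal_ofE _ _).2 Ipq z Zz; rewrite mevalM mulf_eq0.
    by case/orP => /eqP; [left|right].
  + by left; apply/ideal_ofE.
  + by right; apply/ideal_ofE.
- split=> [/(_ _ Zr0)|k p Ip z Zz]; first by rewrite meval1 => /eqP; rewrite oner_eq0.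
  by have /eqP := Ip z Zz; rewrite mevalMn mulrn_eq0 /= => /eqP.
Qed.

Lemma prime_ideal_of Z : affine_irreducible Z ->
  forall p q, ideal_of Z (p * q) -> ideal_of Z p \/ ideal_of Z q.
Proof.
move=> /affine_irreducible_prime[_ _ _ pr _] p q /ideal_ofE/pr.
by case=> /ideal_ofE; [left|right].
Qed.

Lemma not_ideal_ofM Z : affine_irreducible Z ->
  forall p q, ~ ideal_of Z p -> ~ ideal_of Z q -> ~ ideal_of Z (p * q).
Proof. by move=> irr p q np nq /(prime_ideal_of irr)[]. Qed.

Lemma not_ideal_ofP Z p : ~ ideal_of Z p -> exists2 z, Z z & p.@[coords z] != 0.
Proof. by move=> /existsNP[z /not_implyP[Zz /eqP pz]]; exists z. Qed.

Lemma alg_independent_onE Z e (f : 'I_e -> polyV R m) :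
  alg_independent_on Z f <-> independent_on (in_coords Z) f.
Proof.
split=> H q Hq; apply: H => z Zz.
  by have /ideal_ofE/(_ z Zz) := Hq; rewrite mevalP_mmap.
by rewrite mevalP_mmap; have := Hq _ Zz; rewrite coordsE unrvK.
Qed.

Lemma irreducible_dim Z : affine_irreducible Z ->
  exists d g, [/\ has_dim Z d, ~ ideal_of Z g &
    forall z, Z z -> g.@[coords z] != 0 -> forall E : 'M[K]_N,
      (forall v, tangent_space Z z v <-> (rv v <= E)%MS) -> \rank E = d].
Proof.
move=> irr; have HI := affine_irreducible_prime irr.
have [|d [g [nIg [f indf] maxd gen]]] := generic_smoothness HI.
  by case: irr => _ [z Zz] _; exists (rv z); rewrite /in_coords rvK.
exists d, g; split=> [||z Zz gz E EE].
- split; first by exists f; apply/alg_independent_onE.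
  by move=> e h /alg_independent_onE; exact: maxd.
- by move/ideal_ofE.
apply: (gen (rv z)) => [||v] //; first by rewrite /in_coords rvK.
by have := EE (unrv v); rewrite tangent_spaceE unrvK.
Qed.

(** [Z] is itself the largest irreducible closed subset through [z]: functions independent on a
    subset stay independent on [Z]. *)
Lemma has_local_dim_irreducible Z z d : affine_irreducible Z -> Z z ->
  has_dim Z d -> forall e, has_local_dim Z z e <-> e = d.
Proof.
move=> irr Zz dimZ.
have mono W e : W `<=` Z -> has_dim W e -> (e <= d)%N.
  move=> WZ [[f indf] _]; apply: (proj2 dimZ _ f) => q Hq.
  by apply: indf => w /WZ; exact: Hq.
move=> e; split=> [[[W [irrW WZ Wz dimW]] maxe]|->].
  apply/eqP; rewrite eqn_leq (mono _ _ WZ dimW).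
  exact: (maxe Z d).
by split=> [|W e' _ WZ _]; [exists Z; split|exact: mono].
Qed.

Lemma tangent_space_mx Z z :
  exists E : 'M[K]_N, forall v, tangent_space Z z v <-> (rv v <= E)%MS.
Proof.
have [E EE] := tangent_mx (in_coords Z) (rv z).
by exists E => v; rewrite tangent_spaceE.
Qed.

Lemma smooth_pointP Z z d : affine_irreducible Z -> has_dim Z d ->
  smooth_point Z z <-> Z z /\ forall E : 'M[K]_N,
    (forall v, tangent_space Z z v <-> (rv v <= E)%MS) -> \rank E = d.
Proof.
move=> irr dimZ; split=> [[Zz [T [TE /has_local_dim_irreducible-/(_ d irr Zz dimZ) dT]]]|[Zz HE]].
  split=> // E EE; rewrite -dT; have [T' [T'E <-]] := vspace_of_mx E.
  by congr (\dim _); apply/vspaceP => v; apply/idP/idP; rewrite T'E -EE TE.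
split=> //; have [E EE] := tangent_space_mx Z z.
have [T [TE dT]] := vspace_of_mx E; exists T; split=> [v|].
  by rewrite TE EE.
by apply/(has_local_dim_irreducible irr Zz dimZ); rewrite dT HE.
Qed.

End Coordinates.

Lemma mxtrace_mul_tr (K : comNzRingType) m n (A B : 'M[K]_(m, n)) :
  \tr (A *m B^T) = (mxvec A *m (mxvec B)^T) 0 0.
Proof.
rewrite mxE (reindex _ (curry_mxvec_bij _ _)) /=.
rewrite (eq_bigr (fun k => A k.1 k.2 * B k.1 k.2)) => [|[i j] _ /=]; last by rewrite [_^T _ _]mxE !mxvecE.
rewrite -(pair_bigA _ (fun i j => A i j * B i j)); apply: eq_bigr => i _ /=.
by rewrite mxE; apply: eq_bigr => j _; rewrite mxE.
Qed.

(** * The symplectic form and Hamiltonian vectors *)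

Section Symplectic.
Variables (R : realType) (m : nat).
Notation K := R[i].
Notation N := (coord_dim m).
Notation V := (V R m).
Implicit Types (u v z : V) (Z : set V).

Definition Om : 'M[K]_N := block_mx 0 1%:M (- 1%:M) (0 : 'M_(m * m)).

Lemma trOm : Om^T = - Om.
Proof. by rewrite /Om tr_block_mx opp_block_mx !trmx0 linearN /= trmx1 !oppr0 opprK. Qed.

Lemma mul_Om_tr : Om *m Om^T = 1%:M.
Proof.
rewrite trOm mulmxN /Om mulmx_block opp_block_mx !mul0mx !mulmx0 ?mulmx1 ?mul1mx.
by rewrite !add0r !addr0 oppr0 opprK -scalar_mx_block.
Qed.

Lemma mul_tr_Om : Om^T *m Om = 1%:M.
Proof. exact/mulmx1C/mul_Om_tr. Qed.

Lemma omegaE u v : omega u v = (rv u *m Om *m (rv v)^T) 0 0.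
Proof.
rewrite /omega linearB /= !mxtrace_mul_tr /Om /rv mul_row_block tr_row_mx.
rewrite !mulmx0 mulmx1 add0r addr0 mulmxN mulmx1 mul_row_col mulNmx.
rewrite [RHS]mxE [X in _ = X + _]mxE [RHS]addrC; congr (_ - _).
by rewrite -[mxvec v.1 *m _]trmxK trmx_mul trmxK mxE.
Qed.

Lemma omegaC u v : omega u v = - omega v u.
Proof.
by rewrite /omega !linearB /= opprK addrC.
Qed.

Lemma Lagrangian_dense Z : affine_irreducible Z -> Lagrangian Z ->
  exists2 g, ~ ideal_of Z g &
    forall z, Z z -> g.@[coords z] != 0 -> Lagrangian_subspace (tangent_space Z z).
Proof.
move=> irr LZ; have [d [g [dimZ nIg gen]]] := irreducible_dim irr.
exists g => // z Zz gz; apply: LZ.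
apply/(smooth_pointP z irr dimZ); split=> //; exact: gen.
Qed.

(* Being Lagrangian on a dense open set makes I(Z) closed under the Poisson
   bracket, hence the Hamiltonian fields of elements of I(Z) are tangent at
   every point; at a smooth one they span the tangent space, by dimension. *)
Lemma Lagrangian_of_dense Z g0 : affine_irreducible Z -> ~ ideal_of Z g0 ->
  (forall z, Z z -> g0.@[coords z] != 0 -> Lagrangian_subspace (tangent_space Z z)) ->
  Lagrangian Z.
Proof.
move=> irr nIg0 HL; have [d [g [dimZ nIg gen]]] := irreducible_dim irr.
have freeOm : row_free Om by apply/row_freeP; exists Om^T; exact: mul_Om_tr.
have freeOmT : row_free Om^T by apply/row_freeP; exists Om; exact: mul_tr_Om.
(* One point generic for both conditions suffices: there the tangent space has dimension d and
   equals its perpendicular, of dimension N - d. *)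
have dN : d = (N - d)%N.
  have [z1 Zz1] := not_ideal_ofP (not_ideal_ofM irr nIg nIg0).
  rewrite mevalM mulf_eq0 negb_or => /andP[gz1 g0z1].
  have [E EE] := tangent_space_mx Z z1.
  have rE := gen z1 Zz1 gz1 E EE.
  have -> : (N - d)%N = \rank (kermx (Om *m E^T)).
    rewrite mxrank_ker -mxrank_tr trmx_mul trmxK mxrankMfree ?rE //.
  have TL := HL z1 Zz1 g0z1.
  rewrite -rE; apply/eqP; rewrite eqn_leq; apply/andP; split; apply: mxrankS.
    apply/rV_subP => x xE; apply/sub_kermxP; apply/rowP => i; rewrite mxE [RHS]mxE.
    have : tangent_space Z z1 (unrv x) by apply/EE; rewrite unrvK.
    rewrite TL => /(_ (unrv (row i E))); rewrite omegaE !unrvK -mulmxA mxE => xt.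
    rewrite -[RHS]xt; last by apply/EE; rewrite unrvK row_sub.
    apply: eq_bigr => k _; congr (_ * _); rewrite !mxE; apply: eq_bigr => l _.
    by rewrite !mxE.
  apply/rV_subP => x /sub_kermxP xE; rewrite -[x]unrvK; apply/EE; rewrite TL => t.
  move=> /EE/submxP[y yt]; rewrite omegaE unrvK yt trmx_mul !mulmxA.
  by rewrite -(mulmxA x) xE mul0mx mxE.
(* [P] is the Poisson bracket and [ham p] the Hamiltonian vector of [p], normalised so that
   [omega (ham p z)] is the differential of [p] at [z]. *)
pose P p q : polyV R m := \sum_j q^`M(j) * \sum_k Om j k *: p^`M(k).
pose ham p z : V := unrv (grad p (rv z) *m Om^T).
have PE p q z : (P p q).@[coords z] = \sum_j (q^`M(j)).@[coords z] * coords (ham p z) j.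
  rewrite raddf_sum; apply: eq_bigr => j _ /=; rewrite mevalM; congr (_ * _).
  rewrite [coords (ham p z)]coordsE /ham unrvK mxE raddf_sum; apply: eq_bigr => k _ /=.
  by rewrite mevalZ !mxE mulrC.
have omega_ham p z v : omega (ham p z) v = \sum_j (p^`M(j)).@[coords z] * coords v j.
  by rewrite omegaE /ham unrvK -(mulmxA _ Om^T) mul_tr_Om mulmx1 -tangent_gradE.
have tham z p : Z z -> ideal_of Z p -> tangent_space Z z (ham p z).
  move=> Zz Ip q Iq; rewrite -PE; move: z Zz; rewrite -/(ideal_of Z _).
  have : ideal_of Z (P p q * g0).
    move=> z Zz; rewrite mevalM; have [->|g0z] := eqVneq g0.@[coords z] 0.
      by rewrite mulr0.
    rewrite PE; suff -> : \sum_j (q^`M(j)).@[coords z] * coords (ham p z) j = 0 by rewrite mul0r.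
    have : tangent_space Z z (ham p z).
      by rewrite (HL z Zz g0z) => t tt; rewrite omega_ham tt.
    exact.
  by case/(prime_ideal_of irr).
move=> z /(smooth_pointP z irr dimZ)[Zz HE].
have [E EE] := tangent_space_mx Z z; have rE := HE E EE.
have [S SE] := grad_mx (in_coords Z) (rv z).
have rS : \rank S = d.
  rewrite (rank_tangent (T := E) _ SE) ?rE -?dN // => v.
  by have := EE (unrv v); rewrite tangent_spaceE unrvK.
have SOE : (S *m Om^T <= E)%MS.
  apply/row_subP => i; rewrite row_mul.
  have [p Ip ->] := (SE (row i S)).2 (row_sub i S).
  rewrite -[X in (X <= _)%MS]unrvK; apply/EE/tham => //; exact/ideal_ofE.
have ESO : (E <= S *m Om^T)%MS.
  by rewrite -(mxrank_leqif_sup SOE) mxrankMfree // rS rE.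
apply/seteqP; split=> u.
  move=> /EE ue t tt.
  have /SE[p Ip e] : (rv u *m Om <= S)%MS.
    have := submxMr Om (submx_trans ue ESO).
    by rewrite -mulmxA mul_tr_Om mulmx1.
  rewrite omegaE e -tangent_gradE; apply: tt; exact/ideal_ofE.
move=> Hu p Ip; rewrite -omega_ham omegaC Hu ?oppr0 //; exact: tham.
Qed.

End Symplectic.

(** * Projective varieties and their cones *)

Local Open Scope quotient_scope.

Lemma meval_dhomog (K : comNzRingType) n d (p : {mpoly K[n]}) (c : K) (x : 'I_n -> K) :
  p \is d.-homog -> p.@[fun i => c * x i] = c ^+ d * p.@[x].
Proof.
move=> /dhomogP hp; rewrite !mevalE mulr_sumr !big_seq; apply: eq_bigr => mm /hp md.
rewrite mulrCA; congr (_ * _).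
under eq_bigr do rewrite exprMn; rewrite big_split /=; congr (_ * _).
by rewrite prodrXr -mdegE; congr (_ ^+ _); exact: md.
Qed.

Section Cones.
Variables (R : realType) (m : nat).
Notation K := R[i].
Notation N := (coord_dim m).
Notation V := (V R m).
Implicit Types (u v z : V) (Z F : set V) (X : set (PV R m)).

Lemma coordsZ (c : K) v i : coords (c *: v) i = c * coords v i.
Proof. by rewrite !coordsE linearZ mxE. Qed.

Lemma coords0 i : coords (0 : V) i = 0.
Proof. by rewrite coordsE linear0 mxE. Qed.

Lemma coords_inj u v : (forall i, coords u i = coords v i) -> u = v.
Proof.
by move=> H; apply: (can_inj (@rvK R m)); apply/rowP => i; rewrite -!coordsE.
Qed.

(** As a polynomial in c, p(cv) has the homogeneous components of p at v as coefficients. *)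
Lemma vanish_on_line_homog (p : polyV R m) v :
  (forall c : K, p.@[coords (c *: v)] = 0) <->
  forall d, (pihomog mdeg d p).@[coords v] = 0.
Proof.
have pE c : p.@[coords (c *: v)] =
    (\poly_(d < msize p) (pihomog mdeg d p).@[coords v]).[c].
  rewrite {1}(pihomog_partitionE (leqnn (msize p))) raddf_sum horner_poly.
  apply: eq_bigr => d _ /=; rewrite mulrC -(meval_dhomog _ _ (pihomogP mdeg d p)).
  by apply: meval_eq => i; rewrite coordsZ.
split=> [H d|H c]; last first.
  by rewrite pE horner_poly big1 // => d _; rewrite H mul0r.
have P0 : \poly_(d < msize p) (pihomog mdeg d p).@[coords v] = 0.
  by apply: horner_ext => c; rewrite -pE H horner0.
have [dp|pd] := ltnP d (msize p).
  by have := congr1 (fun P : {poly K} => P`_d) P0; rewrite coef_poly dp coef0.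
suff -> : pihomog mdeg d p = 0 by rewrite meval0.
rewrite pihomogE big_seq_cond big_pred0 // => mm; apply/negP => /andP[/msize_mdeg_lt + /eqP e].
by rewrite e ltnNge pd.
Qed.

Lemma proj_closed_of_lines X (S : set (polyV R m)) :
  (forall v (v0 : v != 0), X (cls v0) <-> forall p, S p -> forall c : K, p.@[coords (c *: v)] = 0) ->
  proj_closed X.
Proof.
move=> XS; exists [set q | exists2 p, S p & exists d, q = pihomog mdeg d p]; split.
  by move=> q [p _ [d ->]]; exists d; exact: pihomogP.
move=> v v0; rewrite XS; split=> [H q [p Sp [d ->]]|H p Sp].
  by move/vanish_on_line_homog: (H p Sp).
by apply/vanish_on_line_homog => d; apply: H; exists p => //; exists d.
Qed.

Lemma PV_cls (x : PV R m) : exists v (v0 : v != 0), x = cls v0.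
Proof.
exists (val (repr x)), (valP (repr x)).
by rewrite /cls -[LHS]reprK; congr (\pi_ _ _); apply: val_inj.
Qed.

Lemma cls_scale v (v0 : v != 0) (c : K) (cv0 : c *: v != 0) : cls cv0 = cls v0.
Proof.
apply/esym/clsP; exists c => //; by apply: contraNneq cv0 => ->; rewrite scale0r.
Qed.

Lemma coneE X v (v0 : v != 0) : affine_cone X v <-> X (cls v0).
Proof.
split=> [[e|[v0' H]]|]; last by right; exists v0.
  by exfalso; move: (v0); rewrite e eqxx.
by rewrite (bool_irrelevance v0 v0').
Qed.

Lemma cone0 X : affine_cone X 0.
Proof. by left. Qed.

Lemma coneZ X v (c : K) : affine_cone X v -> affine_cone X (c *: v).
Proof.
move=> Xv; have [->|cv0] := eqVneq (c *: v) 0; first exact: cone0.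
have v0 : v != 0 by apply: contraNneq cv0 => ->; rewrite scaler0.
by apply/(coneE X cv0); rewrite (cls_scale v0) -coneE.
Qed.

Lemma sub_cone X X' : affine_cone X `<=` affine_cone X' <-> X `<=` X'.
Proof.
split=> [H x|H v [->|[v0 /H]]]; [|exact: cone0|by right; exists v0].
by have [v [v0 ->]] := PV_cls x; rewrite -!coneE; exact: H.
Qed.

Lemma proj_closed_cone X : affine_closed (affine_cone X) -> proj_closed X.
Proof.
move=> [S SE]; apply: (@proj_closed_of_lines _ S) => v v0; rewrite -coneE.
split=> [Xv p Sp c|H]; first by have := coneZ c Xv; rewrite SE; exact.
by rewrite SE => p Sp; have := H p Sp 1; rewrite scale1r.
Qed.

(** The cone always contains 0, where a constant equation of [X] may fail; multiplying every
    equation by every coordinate forces vanishing at 0 and changes nothing elsewhere. *)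
Lemma affine_closed_cone X : proj_closed X -> affine_closed (affine_cone X).
Proof.
move=> [S [_ XS]].
exists [set q | exists2 p, S p & exists i, q = 'X_i * p].
apply/seteqP; split=> v.
  move=> Xv q [p Sp [i ->]]; rewrite mevalM mevalXU.
  have [->|v0] := eqVneq v 0; first by rewrite coords0 mul0r.
  by have /XS/(_ p Sp)-> := (coneE X v0).1 Xv; rewrite mulr0.
move=> H; have [->|v0] := eqVneq v 0; first exact: cone0.
apply/(coneE X v0)/XS => p Sp; apply/eqP; apply: contraNT v0 => pv.
apply/eqP; apply: coords_inj => i; rewrite coords0.
have := H ('X_i * p) (ex_intro2 _ _ p Sp (ex_intro _ i erefl)).
by rewrite mevalM mevalXU => /eqP; rewrite mulf_eq0 (negPf pv) orbF => /eqP.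
Qed.

(** The lines through 0 contained in a closed [F] form a projectively closed set, and each line of
    the cone lies in [F] or in [G] because polynomials in one variable form a domain. *)
Lemma affine_irreducible_cone X : proj_irreducible X -> affine_irreducible (affine_cone X).
Proof.
move=> [cX [x0 Xx0] irr]; split; [exact: affine_closed_cone|by exists 0; exact: cone0|].
move=> F G [SF FE] [SG GE] sub.
pose lines F' : set (PV R m) :=
  [set x | exists v (v0 : v != 0), x = cls v0 /\ forall c : K, F' (c *: v)].
have linesE F' v (v0 : v != 0) : lines F' (cls v0) <-> forall c : K, F' (c *: v).
  split=> [[u [u0 [/esym/clsP[b b0 ->] H]]] c|H]; last by exists v, v0.
  by rewrite scalerA.
have linesC F' : affine_closed F' -> proj_closed (lines F').
  move=> [S ->]; apply: (@proj_closed_of_lines _ S) => v v0; rewrite linesE.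
  by split=> [H p Sp c|H c p Sp]; exact: H.
have lines_sub F' : X `<=` lines F' -> affine_cone X `<=` F'.
  move=> H u [->|[u0 /H/linesE/(_ 1)]]; last by rewrite scale1r.
  by have [v [v0 e]] := PV_cls x0; have := H _ Xx0; rewrite e linesE => /(_ 0); rewrite scale0r.
have FC : affine_closed F by exists SF.
have GC : affine_closed G by exists SG.
have [x Xx||] := irr _ _ (linesC _ FC) (linesC _ GC); last 2 first.
- by move/lines_sub; left.
- by move/lines_sub; right.
have [v [v0 ex]] := PV_cls x; have Xv : affine_cone X v by apply/coneE; rewrite -ex.
rewrite ex; have [?|nF] := pselect (lines F (cls v0)); first by left.
right; apply/linesE => b; rewrite GE => q Sq.
have /existsNP[a] : ~ forall c : K, F (c *: v) by move=> H; apply: nF; exact/linesE.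
rewrite FE => /existsNP[p /not_implyP[Sp pa]].
pose P := line 0 (rv v) p; pose Q := line 0 (rv v) q.
have lineE r c : (line 0 (rv v) r).[c] = r.@[coords (c *: v)].
  by rewrite horner_line add0r coordsE linearZ.
have : P * Q = 0.
  apply: horner_ext => c; rewrite hornerM !lineE horner0.
  case: (sub _ (coneZ c Xv)); rewrite ?FE ?GE => H.
    by rewrite (H p Sp) mul0r.
  by rewrite (H q Sq) mulr0.
move/eqP; rewrite mulf_eq0 => /orP[]/eqP e; last by rewrite -lineE -/Q e horner0.
by case: pa; rewrite -lineE -/P e horner0.
Qed.

(** Otherwise each member has an equation not vanishing on [Z], and the product of these contradicts
    primality. *)
Lemma affine_irreducible_cover Z (I : eqType) (s : seq I) (F : I -> set V) :
  affine_irreducible Z -> (forall i, affine_closed (F i)) ->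
  (forall z, Z z -> exists2 i, i \in s & F i z) -> exists2 i, i \in s & Z `<=` F i.
Proof.
move=> irr FC cov; apply: contrapT => nex.
have H i : i \in s -> exists p, ideal_of (F i) p /\ ~ ideal_of Z p.
  move=> si; apply: contrapT => np; apply: nex; exists i => // z Zz.
  have [S FE] := FC i; rewrite FE => p Sp; apply: contrapT => pz; apply: np.
  by exists p; split=> [y|/(_ z Zz)//]; rewrite FE; apply.
have [p [pF pZ]] : exists p, (forall i, i \in s -> ideal_of (F i) p) /\ ~ ideal_of Z p.
  elim: s {cov nex} H => [|i s IH] H.
    exists 1; split=> // I1; case: irr => _ [z Zz] _.
    by have /eqP := I1 z Zz; rewrite meval1 oner_eq0.
  have [|p [pF pZ]] := IH; first by move=> j sj; apply: H; rewrite inE sj orbT.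
  have [q [qF qZ]] := H i (mem_head _ _).
  exists (q * p); split; last exact: not_ideal_ofM.
  move=> j; rewrite inE => /predU1P[->|sj] z Fz; rewrite mevalM.
    by rewrite qF // mul0r.
  by rewrite (pF j) // mulr0.
by apply: pZ => z /cov[i si Fz]; exact: pF Fz.
Qed.

End Cones.

(** * Quadrics, tangent vectors and linear flows on cones *)

Section Tangents.
Variables (R : realType) (m : nat).
Notation K := R[i].
Notation N := (coord_dim m).
Notation V := (V R m).
Implicit Types (u v z : V) (Z F : set V) (X : set (PV R m)).

Definition genA : 'M[polyV R m]_m :=
  \matrix_(i, j) 'X_(lshift (m * m) (mxvec_index i j)).
Definition genB : 'M[polyV R m]_m :=
  \matrix_(i, j) 'X_(rshift (m * m) (mxvec_index i j)).

Lemma map_genA z : map_mx (meval (coords z)) genA = z.1.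
Proof. by apply/matrixP=> i j; rewrite !mxE mevalXU /coords row_mxEl mxvecE. Qed.

Lemma map_genB z : map_mx (meval (coords z)) genB = z.2.
Proof. by apply/matrixP=> i j; rewrite !mxE mevalXU /coords row_mxEr mxvecE. Qed.

Definition cst_mx p q (C : 'M[K]_(p, q)) : 'M[polyV R m]_(p, q) := map_mx (@mpolyC N K) C.

Lemma map_cst_mx p q (C : 'M[K]_(p, q)) z : map_mx (meval (coords z)) (cst_mx C) = C.
Proof. by apply/matrixP=> i j; rewrite !mxE mevalC. Qed.

Definition quad (C D : 'M[K]_m) : polyV R m :=
  \tr (cst_mx C *m genA *m cst_mx D *m genB^T).

Lemma quadE C D z : (quad C D).@[coords z] = \tr (C *m z.1 *m D *m z.2^T).
Proof. by rewrite -trace_map_mx !map_mxM -map_trmx map_genA map_genB !map_cst_mx. Qed.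

Lemma coordsD u v i : coords (u + v) i = coords u i + coords v i.
Proof. by rewrite !coordsE linearD mxE. Qed.

Lemma tangent_spaceD Z z u v :
  tangent_space Z z u -> tangent_space Z z v -> tangent_space Z z (u + v).
Proof.
move=> tu tv p Ip; transitivity (\sum_i (p^`M(i)).@[coords z] * coords u i +
    \sum_i (p^`M(i)).@[coords z] * coords v i); last by rewrite tu // tv // addr0.
by rewrite -big_split; apply: eq_bigr => i _; rewrite coordsD mulrDr.
Qed.

Lemma tangent_spaceZ Z z v (c : K) : tangent_space Z z v -> tangent_space Z z (c *: v).
Proof.
move=> tv p Ip; transitivity (c * \sum_i (p^`M(i)).@[coords z] * coords v i).
  by rewrite mulr_sumr; apply: eq_bigr => i _; rewrite coordsZ mulrCA.
by rewrite tv // mulr0.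
Qed.

Lemma tangent_space_differential Z z v p (h : {poly K}) :
  ideal_of Z p -> tangent_space Z z v ->
  (forall t, h.[t] = p.@[coords (z + t *: v)]) -> h^`().[0] = 0.
Proof.
move=> Ip tv hE; transitivity (\sum_i (p^`M(i)).@[coords z] * coords v i); last exact: tv.
apply/esym; apply: (differential_unique (z := rv z) (v := rv v)) => t.
by rewrite hE coordsE linearD linearZ.
Qed.

Lemma tangent_space_line Z z v : (forall t : K, Z (z + t *: v)) -> tangent_space Z z v.
Proof.
move=> H; apply/tangent_spaceE/tangent_of_line => t.
by rewrite /in_coords -linearZ -linearD rvK.
Qed.

Lemma tangent_quad Z z v C D :
  (forall z, Z z -> \tr (C *m z.1 *m D *m z.2^T) = 0) -> tangent_space Z z v ->
  \tr (C *m z.1 *m D *m v.2^T) + \tr (C *m v.1 *m D *m z.2^T) = 0.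
Proof.
move=> HZ tv; set b := _ + _.
pose h : {poly K} := (\tr (C *m z.1 *m D *m z.2^T))%:P + b *: 'X +
  \tr (C *m v.1 *m D *m v.2^T) *: 'X^2.
have Iq : ideal_of Z (quad C D) by move=> y Zy; rewrite quadE HZ.
have := tangent_space_differential (h := h) Iq tv.
rewrite /h !derivD derivC !derivZ derivX derivXn !hornerE /=; apply.
move=> t; rewrite quadE !hornerE /= /b.
rewrite [(_ + _)^T]linearD /= [(_ *: _)^T]linearZ /= !(mulmxDr, mulmxDl).
rewrite -!scalemxAr -!scalemxAl !mxtraceD !mxtraceZ.
move: (\tr (C *m z.1 *m D *m z.2^T)) (\tr (C *m z.1 *m D *m v.2^T)) => x1 x2.
by move: (\tr (C *m v.1 *m D *m z.2^T)) (\tr (C *m v.1 *m D *m v.2^T)) => x3 x4; ring.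
Qed.

(** For (a, b) = (1, -1) this is the Hamiltonian field of [quad C D]; for (1, 0) and C = D = 1 it is
    the projection to the first factor. *)
Definition sandwich (a b : K) (C D : 'M[K]_m) z : V :=
  (a *: (C *m z.1 *m D), b *: (C^T *m z.2 *m D^T)).

Lemma sandwich_is_linear a b C D : linear (sandwich a b C D).
Proof.
move=> c u v; rewrite /sandwich; congr pair; rewrite /= !mulmxDr !mulmxDl;
  by rewrite -!scalemxAr -!scalemxAl scalerDr !scalerA mulrC.
Qed.

HB.instance Definition _ a b C D :=
  GRing.isLinear.Build K V V *:%R (sandwich a b C D) (sandwich_is_linear a b C D).

Lemma hamiltonian_tangent Z z C D :
  Lagrangian_subspace (tangent_space Z z) ->
  (forall z, Z z -> \tr (C *m z.1 *m D *m z.2^T) = 0) ->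
  tangent_space Z z (sandwich 1 (-1) C D z).
Proof.
move=> -> HZ v tv; rewrite /omega linearB /= scale1r.
transitivity (\tr (C *m z.1 *m D *m v.2^T) + \tr (C *m v.1 *m D *m z.2^T)); last exact: (tangent_quad HZ tv).
congr (_ + _); rewrite scaleN1r linearN /= mulmxN linearN /= opprK.
by rewrite !trmx_mul !trmxK !mulmxA mxtrace_mulC !mulmxA.
Qed.

Lemma mem_closed Z z : affine_closed Z -> (forall p, ideal_of Z p -> p.@[coords z] = 0) -> Z z.
Proof. by move=> [S ->] H p Sp; apply: H => y; apply. Qed.

(** Tangency off the zeros of [g0] is enough: the derivative of an equation along [f], multiplied by
    [g0], lies in the ideal, and primality removes the factor. *)
Lemma lin_field_closed Z g0 (f : {linear V -> V}) (c : K) :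
  affine_irreducible Z -> ~ ideal_of Z g0 -> (forall z, f (f z) = c *: f z) ->
  (forall z, Z z -> g0.@[coords z] != 0 -> tangent_space Z z (f z)) ->
  forall z, Z z -> forall t : K, Z (z + t *: f z).
Proof.
move=> irr nIg ff tf z Zz t; have cZ : affine_closed Z by case: irr.
pose M : 'M[K]_N := lin1_mx (@rv R m \o f \o @unrv R m).
have ME y : rv y *m M = rv (f y) by rewrite mul_rV_lin1 /= rvK.
have tM x : in_coords Z x -> tangent_at (in_coords Z) x (x *m M).
  rewrite -[x]unrvK; move: (unrv x) => y; rewrite /in_coords rvK => Zy p /ideal_ofE Ip.
  rewrite -lin_fieldE -coordsE; move: y Zy; rewrite -/(ideal_of Z _).
  have : ideal_of Z (lin_field M p * g0).
    move=> y Zy; rewrite mevalM; have [->|g0y] := eqVneq g0.@[coords y] 0.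
      by rewrite mulr0.
    by rewrite coordsE lin_fieldE ME (tf y Zy g0y p Ip) mul0r.
  by case/(prime_ideal_of irr).
have MM : M *m M = c *: M.
  apply/row_matrixP=> i; rewrite linearZ /= row_mul -[row i M]unrvK ME.
  have -> : row i M = rv (f (unrv (delta_mx 0 i))) by rewrite -ME unrvK rowE.
  by rewrite rvK ff linearZ.
apply: mem_closed => // p /ideal_ofE Ip.
rewrite coordsE linearD linearZ /= -ME.
by apply: (lin_field_invariant MM tM Ip); rewrite /in_coords rvK.
Qed.

End Tangents.

(** * The maps psi_mu and the cones of the given varieties *)

Section Rescaling.
Variables (R : realType) (m : nat).
Notation K := R[i].
Notation N := (coord_dim m).
Notation V := (V R m).
Implicit Types (u v z : V) (Z F : set V) (X : set (PV R m)).

Lemma affine_closed_preimage Z (f : {linear V -> V}) :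
  affine_closed Z -> affine_closed [set z | Z (f z)].
Proof.
move=> [S ->].
pose M : 'M[K]_N := lin1_mx (@rv R m \o f \o @unrv R m).
pose q i : polyV R m := \sum_j M j i *: 'X_j.
have qE z i : (q i).@[coords z] = coords (f z) i.
  have -> : coords (f z) i = (rv z *m M) 0 i by rewrite mul_rV_lin1 /= rvK.
  rewrite mxE raddf_sum; apply: eq_bigr => j _ /=.
  by rewrite mevalZ mevalXU mulrC.
exists [set mmap (@mpolyC N K) q p | p in S].
apply/seteqP; split=> z /=.
  by move=> H _ [p Sp <-]; rewrite mevalP_mmap (meval_eq _ (qE z)) H.
move=> H p Sp; rewrite -(meval_eq _ (qE z)) -mevalP_mmap.
by apply: H; exists p.
Qed.

Lemma rescale_is_linear (mu : K) : linear (@rescale R m mu).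
Proof.
move=> c u v; rewrite /rescale; congr pair; rewrite /= scalerDr !scalerA;
  by rewrite mulrC.
Qed.

HB.instance Definition _ (mu : K) :=
  GRing.isLinear.Build K V V *:%R (@rescale R m mu) (rescale_is_linear mu).

Lemma rescaleK (mu : K) : mu != 0 -> cancel (@rescale R m mu) (rescale mu^-1).
Proof. by move=> mu0 [A B]; rewrite /rescale /= invrK !scalerA mulVf // mulfV // !scale1r. Qed.

Lemma rescaleVK (mu : K) : mu != 0 -> cancel (@rescale R m mu^-1) (rescale mu).
Proof. by move=> mu0 [A B]; rewrite /rescale /= invrK !scalerA mulVf // mulfV // !scale1r. Qed.

Lemma cone_psi (mu : K) (mu0 : mu != 0) X z :
  affine_cone (psi mu0 @` X) z <-> affine_cone X (rescale mu^-1 z).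
Proof.
have [->|z0] := eqVneq z 0; first by rewrite linear0; split=> _; exact: cone0.
have w0 : rescale mu^-1 z != 0 by apply: rescale_neq0; rewrite ?invr_eq0.
rewrite (coneE _ z0) (coneE _ w0); split=> [[x Xx]|Xw].
  have [v [v0 ex]] := PV_cls x; move: Xx; rewrite ex psiE => Xx /clsP[c c0 ez].
  have cv0 : c *: v != 0 by rewrite scaler_eq0 negb_or c0.
  rewrite -(coneE _ w0) ez linearZ /= rescaleK // (coneE _ cv0).
  by rewrite (cls_scale v0).
exists (cls w0) => //; rewrite psiE; apply/clsP; exists 1; rewrite ?oner_eq0 //.
by rewrite scale1r rescaleVK.
Qed.

Lemma cone_psi_preimage (mu : K) (mu0 : mu != 0) X z :
  affine_cone (psi mu0 @^-1` X) z <-> affine_cone X (rescale mu z).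
Proof.
have [->|z0] := eqVneq z 0; first by rewrite linear0; split=> _; exact: cone0.
by rewrite (coneE _ z0) (coneE _ (rescale_neq0 mu0 z0)) /= psiE.
Qed.

Lemma proj_closed_psi_preimage (mu : K) (mu0 : mu != 0) X :
  proj_closed X -> proj_closed (psi mu0 @^-1` X).
Proof.
move=> /affine_closed_cone cX; apply: proj_closed_cone.
have -> : affine_cone (psi mu0 @^-1` X) = [set z | affine_cone X (rescale mu z)].
  by apply/seteqP; split=> z H; apply/cone_psi_preimage.
exact: affine_closed_preimage.
Qed.

Lemma cone_classes_of (D : set V) v :
  (forall (c : K) u, c != 0 -> D u -> D (c *: u)) ->
  affine_cone (classes_of D) v <-> v = 0 \/ D v.
Proof.
move=> DZ; have [->|v0] := eqVneq v 0.
  by split=> _; [left|exact: cone0].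
rewrite (coneE _ v0); split=> [[u [u0 [Du]]]|[/eqP|Dv]]; last 2 first.
- by rewrite (negPf v0).
- by exists v, v0.
by move=> /esym/clsP[c c0 ->]; right; exact: DZ.
Qed.

Lemma cone_Y v : affine_cone (Y R m) v <-> exists lam : K,
  v.1 *m v.2^T = (lam ^+ 2)%:M /\ v.2^T *m v.1 = (lam ^+ 2)%:M.
Proof.
rewrite cone_classes_of => [|c u c0 [lam [e1 e2]]].
  split=> [[->|]//|]; last by right.
  by exists 0; rewrite expr0n /= !mul0mx trmx0 mul0mx raddf0.
exists (c * lam); rewrite /= linearZ /= -!scalemxAl -!scalemxAr e1 e2.
by rewrite !scale_scalar_mx exprMn mulrA expr2.
Qed.

Lemma cone_X_deg k v : affine_cone (X_deg R m k) v <->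
  [/\ v.1 *m v.2^T = 0, v.2^T *m v.1 = 0, (\rank v.1 <= k)%N & (\rank v.2 <= m - k)%N].
Proof.
rewrite cone_classes_of => [|c u c0 /= [e1 e2 r1 r2]].
  split=> [[->|]//|]; last by right.
  by rewrite /= !mul0mx trmx0 mul0mx mxrank0.
rewrite linearZ /= -!scalemxAl -!scalemxAr e1 e2 !scaler0.
by rewrite !mxrank_scale_nz.
Qed.

Lemma proj_closure_closed (D : set (PV R m)) : proj_closed (proj_closure D).
Proof.
exists [set p | (exists d : nat, p \is d.-homog) /\
  forall v (v0 : v != 0), D (cls v0) -> p.@[coords v] = 0]; split=> [p []//|v v0].
split=> [H p [hp Dp]|H F [S [hS FS]] DF].
  pose Fp : set (PV R m) := [set x | forall u (u0 : u != 0), x = cls u0 -> p.@[coords u] = 0].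
  have FpE u (u0 : u != 0) : Fp (cls u0) <-> p.@[coords u] = 0.
    split=> [|pu w w0 /clsP[c c0 ->]]; first exact.
    have [d hd] := hp; rewrite (meval_eq _ (coordsZ c u)) (meval_dhomog _ _ hd) pu.
    by rewrite mulr0.
  apply/(FpE v v0); apply: H => [|x Dx].
    by exists [set p]; split=> [q -> //|u u0]; rewrite FpE; split=> [pu _ ->//|]; apply.
  by have [u [u0 e]] := PV_cls x; rewrite e in Dx *; apply/FpE; exact: Dp Dx.
apply/FS => p Sp; apply: H; split; first exact: hS.
by move=> u u0 /DF/FS; apply.
Qed.

Lemma X_inv_mem (g h : 'M[K]_m) : h *m g = 1%:M -> \det g = 1 ->
  affine_cone (X_inv R m) (g, h^T).
Proof.
move=> hg dg; have [->|v0] := eqVneq ((g, h^T) : V) 0; first exact: cone0.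
apply/(coneE _ v0) => F _; apply; exists (g, h^T), v0; split=> //.
exists g; split=> //; congr (_, _); congr (_^T).
have ug : g \in unitmx by rewrite unitmxE dg unitr1.
by rewrite -[h]mulmx1 -(mulmxV ug) mulmxA hg mul1mx.
Qed.

Lemma X_inv_sub X : proj_closed X ->
  (forall g h : 'M[K]_m, h *m g = 1%:M -> \det g = 1 -> affine_cone X (g, h^T)) ->
  X_inv R m `<=` X.
Proof.
move=> cX H x; apply => // _ [v [v0 [[g [dg e]] ->]]].
apply/(coneE _ v0); rewrite e; apply: H => //.
by apply: mulVmx; rewrite unitmxE dg unitr1.
Qed.

End Rescaling.

(** * Legendrian subvarieties of Y *)

Section Invariance.
Variables (R : realType) (m : nat).
Notation K := R[i].
Notation V := (V R m).
Implicit Types (z : V) (Z : set V).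

Definition SL_invariant Z :=
  (forall A B P Q : 'M[K]_m, Q *m P = 1%:M -> \det P = 1 -> Z (A, B) -> Z (P *m A, Q^T *m B)) /\
  (forall A B P Q : 'M[K]_m, Q *m P = 1%:M -> \det P = 1 -> Z (A, B) -> Z (A *m P, B *m Q^T)).

(** The predicate [H] quantifies over inverses of [g], so that B is transported together with A;
    being closed under transvections, it passes from 1 to all of SL_m. *)
Lemma SL_invariant_of_transvections Z :
  (forall (A B n : 'M[K]_m), n *m n = 0 -> \tr n = 0 -> Z (A, B) ->
     Z ((1%:M + n) *m A, (1%:M - n^T) *m B)) ->
  (forall (A B n : 'M[K]_m), n *m n = 0 -> \tr n = 0 -> Z (A, B) ->
     Z (A *m (1%:M + n), B *m (1%:M - n^T))) ->
  SL_invariant Z.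
Proof.
have inv1n (n : 'M[K]_m) : n *m n = 0 -> (1%:M + n) *m (1%:M - n) = 1%:M.
  by move=> nn; rewrite mulmxDl mul1mx mulmxBr mulmx1 nn subr0 subrK.
move=> left_inv right_inv; split=> A B P Q QP dP ZAB.
  pose H g := forall h : 'M[K]_m, h *m g = 1%:M -> Z (g *m A, h^T *m B).
  suff : H P by exact.
  have cH : transvection_closed H.
    move=> n g nn tn Hg h; rewrite mulmxA => hg.
    have := left_inv _ _ n nn tn (Hg _ hg).
    have -> : 1%:M - n^T = (1%:M - n)^T by rewrite linearB /= trmx1.
    by rewrite !mulmxA -trmx_mul -[h *m _ *m _]mulmxA inv1n // mulmx1.
  have H1 : H 1%:M by move=> h; rewrite mulmx1 mul1mx => ->; rewrite trmx1 mul1mx.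
  by apply: (transvection_equiv_det _ _ cH).1 H1; rewrite det1 ?oner_eq0.
(* Transposing turns right multiplication into left multiplication, the only kind that
   [transvection_closed] covers. *)
pose H g := forall h : 'M[K]_m, h *m g = 1%:M -> Z (A *m g^T, B *m h).
suff : H P^T by move/(_ Q^T); rewrite -trmx_mul trmxK; apply; rewrite (mulmx1C QP) trmx1.
have cH : transvection_closed H.
  move=> n g nn tn Hg h; rewrite mulmxA => hg.
  have := right_inv _ _ n^T _ _ (Hg _ hg); rewrite trmxK mxtrace_tr.
  rewrite -trmx_mul nn trmx0 tn => /(_ erefl erefl).
  have -> : 1%:M + n^T = (1%:M + n)^T by rewrite linearD /= trmx1.
  by rewrite -!mulmxA -trmx_mul inv1n // mulmx1.
have H1 : H 1%:M by move=> h; rewrite mulmx1 trmx1 mulmx1 => ->; rewrite mulmx1.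
by apply: (transvection_equiv_det _ _ cH).1 H1; rewrite ?det_tr det1 ?oner_eq0.
Qed.

End Invariance.

(** * Invariance under SL_m, and the case where tr(AB^T) is not identically zero *)

Section Forward.
Variables (R : realType) (m : nat).
Notation K := R[i].
Notation N := (coord_dim m).
Notation V := (V R m).
Implicit Types (u v z : V) (Z F : set V).
Variable X : set (PV R m).
Hypotheses (hm : (2 <= m)%N) (hX : proj_irreducible X).
Hypotheses (LX : Legendrian X) (XY : X `<=` Y R m).
Let Z := affine_cone X.
Let irrZ : affine_irreducible Z := affine_irreducible_cone hX.
Let closedZ : affine_closed Z. Proof. by case: irrZ. Qed.

Let coneY z : Z z -> exists lam : K,
  z.1 *m z.2^T = (lam ^+ 2)%:M /\ z.2^T *m z.1 = (lam ^+ 2)%:M.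
Proof. by move=> Zz; apply/cone_Y; move: z Zz; apply/sub_cone. Qed.

Lemma Legendrian_SL_invariant : SL_invariant Z.
Proof.
have [g0 nI0 Hg0] := Lagrangian_dense irrZ LX.
apply: SL_invariant_of_transvections => A B n nn tn ZAB.
  have q0 z : Z z -> \tr (n *m z.1 *m 1%:M *m z.2^T) = 0.
    move=> /coneY[lam [e _]]; rewrite mulmx1 -mulmxA e mul_mx_scalar.
    by rewrite mxtraceZ tn mulr0.
  have : forall t : K, Z ((A, B) + t *: sandwich 1 (-1) n 1%:M (A, B)).
    apply: (lin_field_closed (c := 0) irrZ nI0) => // [z|z Zz gz]; last first.
      exact: (hamiltonian_tangent (Hg0 _ Zz gz)).
    rewrite /=.
    rewrite /sandwich scale0r /= !trmx1 !mulmx1 !scale1r !scaleN1r !mulmxN !mulmxA nn.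
    by rewrite -trmx_mul nn trmx0 !mul0mx !oppr0.
  move=> /(_ 1); rewrite scale1r /sandwich /= scale1r scaleN1r trmx1 !mulmx1.
  rewrite [X in Z X](_ : _ = ((1%:M + n) *m A, (1%:M - n^T) *m B)) //.
  by congr pair; rewrite /= ?mulmxBl ?mulmxDl mul1mx.
have q0 z : Z z -> \tr (1%:M *m z.1 *m n *m z.2^T) = 0.
  move=> /coneY[lam [_ e]]; rewrite mul1mx mxtrace_mulC mulmxA e mul_scalar_mx.
  by rewrite mxtraceZ tn mulr0.
have : forall t : K, Z ((A, B) + t *: sandwich 1 (-1) 1%:M n (A, B)).
  apply: (lin_field_closed (c := 0) irrZ nI0) => // [z|z Zz gz]; last first.
    exact: (hamiltonian_tangent (Hg0 _ Zz gz)).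
  rewrite /=.
  rewrite /sandwich scale0r /= !trmx1 !mul1mx !scale1r !scaleN1r !mulNmx -!mulmxA nn.
  by rewrite -trmx_mul nn trmx0 !mulmx0 !oppr0.
move=> /(_ 1); rewrite scale1r /sandwich /= scale1r scaleN1r trmx1 !mul1mx.
rewrite [X in Z X](_ : _ = (A *m (1%:M + n), B *m (1%:M - n^T))) //.
by congr pair; rewrite /= ?mulmxBr ?mulmxDr mulmx1.
Qed.

(** Left multiplication by g A^-1 = g B^T has determinant one and carries one inverse pair to the
    other. *)
Lemma inverse_pair_orbit (A B g h : 'M[K]_m) :
  Z (A, B) -> B^T *m A = 1%:M -> h *m g = 1%:M -> \det g = \det A -> Z (g, h^T).
Proof.
move=> ZAB BA hg dg; have [lft _] := Legendrian_SL_invariant.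
have AB := mulmx1C BA; have gh := mulmx1C hg.
have := lft A B (g *m B^T) (A *m h) _ _ ZAB.
rewrite -[g *m B^T *m A]mulmxA BA mulmx1 trmx_mul -[h^T *m _ *m _]mulmxA.
have -> : A^T *m B = 1%:M by rewrite -[B]trmxK -trmx_mul BA trmx1.
rewrite mulmx1; apply.
  by rewrite -mulmxA [h *m _]mulmxA hg mul1mx AB.
by rewrite det_mulmx dg mulrC -det_mulmx BA det1.
Qed.

Lemma scaled_pair z (lam : K) : lam != 0 -> Z z -> z.2^T *m z.1 = (lam ^+ 2)%:M ->
  Z (lam^-1 *: z.1, lam^-1 *: z.2) /\ (lam^-1 *: z.2)^T *m (lam^-1 *: z.1) = 1%:M.
Proof.
move=> lam0 Zz e; split; first exact: (coneZ lam^-1 Zz).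
have -> : (lam^-1 *: z.2)^T = lam^-1 *: z.2^T by rewrite linearZ.
rewrite -scalemxAl -scalemxAr e !scale_scalar_mx; congr _%:M.
by rewrite expr2; field.
Qed.

Lemma trace_pair z (lam : K) : z.1 *m z.2^T = (lam ^+ 2)%:M ->
  \tr (z.1 *m z.2^T) != 0 -> lam != 0.
Proof. by move=> ->; apply: contraNneq => ->; rewrite expr0n raddf0 mxtrace0. Qed.

Hypothesis nondeg : exists2 z, Z z & \tr (z.1 *m z.2^T) != 0.

(** Fix an inverse pair (A0, B0) in the cone. Any other one has (t A0, t^-1 B0) in its orbit for a
    suitable t, hence the cone contains (t^2 A0, B0), and t^2 is a root of one fixed nonzero
    polynomial. *)
Lemma det_values_finite : exists s : seq K, forall A B : 'M[K]_m,
  Z (A, B) -> B^T *m A = 1%:M -> \det A \in s.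
Proof.
have m0 : (0 < m)%N by exact: leq_trans hm.
have [g0 nI0 Hg0] := Lagrangian_dense irrZ LX.
have nIq : ~ ideal_of Z (quad (1%:M : 'M[K]_m) 1%:M).
  case: nondeg => z Zz tz /(_ z Zz); rewrite quadE mulmx1 mul1mx.
  by apply/eqP.
have [z0 Zz0] := not_ideal_ofP (not_ideal_ofM irrZ nI0 nIq).
rewrite mevalM mulf_eq0 negb_or quadE mulmx1 mul1mx => /andP[gz0 tz0].
have [lam [e1 e2]] := coneY Zz0; have lam0 := trace_pair e1 tz0.
have [ZA0 BA0] := scaled_pair lam0 Zz0 e2.
set A0 := lam^-1 *: z0.1 in ZA0 BA0; set B0 := lam^-1 *: z0.2 in ZA0 BA0.
pose v0 : V := (z0.1, 0); pose w0 : V := (0, z0.2).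
have [p Ip hp] : exists2 p, ideal_of Z p & line (rv w0) (rv v0) p != 0.
  apply: contrapT => np.
  have ZL (s : K) : Z (w0 + s *: v0).
    apply: mem_closed => // p Ip; rewrite coordsE linearD linearZ /= -horner_line.
    have [->|hp] := eqVneq (line (rv w0) (rv v0) p) 0; first by rewrite horner0.
    by case: np; exists p.
  have z0E : z0 = w0 + 1 *: v0.
    by rewrite [LHS]surjective_pairing scale1r; congr pair; rewrite /= ?add0r ?addr0.
  have tv0 : tangent_space Z z0 v0.
    apply: tangent_space_line => t; rewrite {1}z0E -addrA -scalerDl; exact: ZL.
  have tz : tangent_space Z z0 z0.
    apply: tangent_space_line => t; rewrite -{1}[z0]scale1r -scalerDl; exact: coneZ.
  have := tz; rewrite (Hg0 z0 Zz0 gz0) => /(_ v0 tv0) /eqP.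
  by rewrite /omega /= trmx0 mulmx0 sub0r raddfN /= oppr_eq0 (negPf tz0).
have [rs rsE] := closed_field_poly_normal (line (rv w0) (rv v0) p).
(* A root s = t^2 only determines the square of the determinant, (det A)^2 = s^m (det A0)^2; both
   signs are listed. *)
exists (flatten [seq [:: sqrtC (s ^+ m * \det A0 ^+ 2); - sqrtC (s ^+ m * \det A0 ^+ 2)] | s <- rs]).
move=> A B ZAB BA.
have dA0 : \det A0 != 0.
  by apply: contraTneq (oner_neq0 K) => e; rewrite -(det1 _ m) -BA0 det_mulmx e mulr0 eqxx.
have dA : \det A != 0.
  by apply: contraTneq (oner_neq0 K) => e; rewrite -(det1 _ m) -BA det_mulmx e mulr0 eqxx.
pose t := m.-root (\det A / \det A0).
have tm : t ^+ m = \det A / \det A0 by rewrite rootCK.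
have t0 : t != 0.
  have := mulf_neq0 dA (invr_neq0 dA0); apply: contra_neq => e.
  by rewrite -tm e expr0n eqn0Ngt m0.
have ZtA : Z (t *: A0, (t^-1 *: B0^T)^T).
  apply: (inverse_pair_orbit ZAB BA); last by rewrite detZ tm divfK.
  by rewrite -scalemxAl -scalemxAr BA0 scalerA mulVf // scale1r.
have Zt2 : Z (w0 + t ^+ 2 *: v0).
  rewrite [X in Z X](_ : _ = (t * lam) *: ((t *: A0, (t^-1 *: B0^T)^T) : V)).
    exact: coneZ.
  congr pair; rewrite /= ?add0r.
    by rewrite /A0 !scalerA; congr (_ *: _); field.
  rewrite scaler0 addr0 linearZ /= trmxK /B0 !scalerA.
  by rewrite (_ : _ * _ * _ = 1) ?scale1r //; field; rewrite lam0 t0.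
apply/flattenP.
exists [:: sqrtC ((t ^+ 2) ^+ m * \det A0 ^+ 2); - sqrtC ((t ^+ 2) ^+ m * \det A0 ^+ 2)].
  apply: map_f; have : root (line (rv w0) (rv v0) p) (t ^+ 2).
    by rewrite /root horner_line -linearZ -linearD /= -coordsE; apply/eqP; exact: Ip.
  by rewrite rsE rootZ ?root_prod_XsubC // lead_coef_eq0.
rewrite !inE -eqf_sqr sqrtCK exprAC tm exprMn exprVn divfK //.
by rewrite expf_neq0.
Qed.

Lemma nondegenerate_case : exists (mu : K) (mu0 : mu != 0), X = psi mu0 @` X_inv R m.
Proof.
have m0 : (0 < m)%N by exact: leq_trans hm.
have [s sE] := det_values_finite.
pose C d := exists A B : 'M[K]_m, [/\ Z (A, B), B^T *m A = 1%:M & \det A = d].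
(* An m-th root of d plays mu, since dividing A by it makes the determinant 1; [None] stands for the
   locus where the trace vanishes. *)
pose F (i : option K) : set V := if i is Some d
  then [set z | affine_cone (X_inv R m) (rescale (m.-root d)^-1 z)]
  else [set z | \tr (z.1 *m z.2^T) = 0].
have det0 (A B : 'M[K]_m) : B^T *m A = 1%:M -> \det A != 0.
  move=> BA; apply: contraTneq (oner_neq0 K) => e.
  by rewrite -(det1 _ m) -BA det_mulmx e mulr0 eqxx.
have root0 (d : K) : d != 0 -> m.-root d != 0.
  by apply: contra_neq => e; rewrite -(rootCK m0 d) e expr0n eqn0Ngt m0.
have FC i : affine_closed (F i).
  case: i => [d|] /=; last first.
    exists [set quad (1%:M : 'M[K]_m) 1%:M]; apply/seteqP; split=> z /=.
      by move=> tz _ ->; rewrite quadE mulmx1 mul1mx.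
    by move=> /(_ _ erefl); rewrite quadE mulmx1 mul1mx.
  apply: affine_closed_preimage; apply: affine_closed_cone.
  exact: proj_closure_closed.
(* Only determinants attained on [Z] are kept: such a value comes with a point whose orbit gives the
   reverse inclusion. *)
have [|i] := affine_irreducible_cover (s := None :: [seq Some d | d <- s & `[< C d >]]) irrZ FC.
- move=> z Zz; have [tz|tz] := eqVneq (\tr (z.1 *m z.2^T)) 0.
    by exists None => //; rewrite mem_head.
  have [lam [e1 e2]] := coneY Zz; have lam0 := trace_pair e1 tz.
  have [ZAB BA] := scaled_pair lam0 Zz e2.
  set A := lam^-1 *: z.1 in ZAB BA; set B := lam^-1 *: z.2 in ZAB BA.
  exists (Some (\det A)).
    rewrite inE; apply/orP; right; apply: map_f; rewrite mem_filter (sE _ _ ZAB BA) andbT.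
    by apply/asboolP; exists A, B.
  rewrite /= -[z](scale1r) -(mulfV lam0) -scalerA linearZ /=; apply: coneZ.
  have dA0 := det0 _ _ BA; set mu := m.-root _; have mu0 : mu != 0 by exact: root0.
  have -> : rescale mu^-1 (lam^-1 *: z) = (mu^-1 *: A, (mu *: B^T)^T) :> V.
    by rewrite /rescale invrK; congr pair; rewrite [RHS]linearZ /= trmxK.
  apply: X_inv_mem.
    by rewrite -scalemxAl -scalemxAr BA scalerA mulfV // scale1r.
  by rewrite detZ exprVn rootCK // mulVf.
rewrite inE => /orP[/eqP -> ZF|].
  by case: nondeg => z /ZF /= ->; rewrite eqxx.
case/mapP => d; rewrite mem_filter => /andP[/asboolP[A [B [ZAB BA dA]]] _] -> ZF.
have d0 : d != 0 by rewrite -dA (det0 _ _ BA).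
have mu0 := root0 d d0; exists (m.-root d), mu0.
apply/seteqP; split.
  by apply/sub_cone => z /ZF Fz; apply/cone_psi.
move=> _ [x Xx <-]; move: x Xx.
have [cX _ _] := hX; apply: (X_inv_sub (X := psi mu0 @^-1` X)).
  exact: proj_closed_psi_preimage.
move=> g h hg dg; apply/cone_psi_preimage.
have -> : rescale (m.-root d) (g, h^T) = (m.-root d *: g, ((m.-root d)^-1 *: h)^T) :> V.
  by rewrite /rescale; congr pair; rewrite [RHS]linearZ.
apply: (inverse_pair_orbit ZAB BA).
  by rewrite -scalemxAl -scalemxAr hg scalerA mulVf // scale1r.
by rewrite detZ rootCK // dg mulr1 dA.
Qed.

End Forward.

(** * Minors and generic ranks *)

Section Minors.
Variables (R : realType) (m : nat).
Notation K := R[i].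
Notation V := (V R m).
Implicit Types (u v z : V) (Z F : set V).
Variables (G : 'M[polyV R m]_m) (pr : V -> 'M[K]_m).
Hypothesis prG : forall z, map_mx (meval (coords z)) G = pr z.
Hypothesis pr_line : forall z v t, pr (z + t *: v) = pr z + t *: pr v.

(** Arbitrary scalar matrices replace selections of rows and columns, so that bordering by kernel
    vectors keeps this form. *)
Definition minor p (P : 'M[K]_(p, m)) (Q : 'M[K]_(m, p)) : polyV R m :=
  \det (cst_mx m P *m G *m cst_mx m Q).

Lemma minorE p (P : 'M[K]_(p, m)) Q z : (minor P Q).@[coords z] = \det (P *m pr z *m Q).
Proof. by rewrite -det_map_mx !map_mxM prG !map_cst_mx. Qed.

Lemma minor_eq0 p (P : 'M[K]_(p, m)) Q z :
  (\rank (pr z) < p)%N -> (minor P Q).@[coords z] = 0.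
Proof.
move=> rp; rewrite minorE; apply/eqP; apply: contraTT rp => d0; rewrite -leqNgt.
have : P *m pr z *m Q \in unitmx by rewrite unitmxE unitfE.
rewrite -row_free_unit => /eqP {1}<-.
by apply: leq_trans (mxrankM_maxl _ _) _; exact: mxrankM_maxr.
Qed.

Lemma minor_neq0 z : exists (P : 'M[K]_(\rank (pr z), m)) (Q : 'M[K]_(m, \rank (pr z))),
  P *m pr z *m Q = 1%:M.
Proof.
have [P PE] := row_fullP (col_base_full (pr z)).
have [Q QE] := row_freeP (row_base_free (pr z)).
exists P, Q; rewrite [X in _ *m X *m _](_ : _ = col_base (pr z) *m row_base (pr z)).
  by rewrite mulmxA PE mul1mx QE.
by rewrite mulmx_base.
Qed.

(* Differentiate the bordered minors of size [\rank (pr z) + 1]. *)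
Lemma tangent_minor Z z v (l : 'rV[K]_m) (r : 'cV[K]_m) :
  (forall y, Z y -> (\rank (pr y) <= \rank (pr z))%N) -> tangent_space Z z v ->
  l *m pr z = 0 -> pr z *m r = 0 -> l *m pr v *m r = 0.
Proof.
move=> maxr tv lz zr; have [P [Q PQ]] := minor_neq0 z.
move: P Q PQ maxr; set a := \rank (pr z) => P Q PQ maxr.
have Ip : ideal_of Z (minor (col_mx P l) (row_mx Q r)).
  by move=> y Zy; rewrite minor_eq0 // addn1 ltnS maxr.
pose M1 := P *m pr v *m Q; pose u := P *m pr v *m r.
pose w := l *m pr v *m Q; pose s := l *m pr v *m r.
pose C q1 q2 (M : 'M[K]_(q1, q2)) : 'M[{poly K}]_(q1, q2) := map_mx polyC M.
(* Because [l] kills [pr z], the bordering row is divisible by t. With that factor in front, the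
   derivative at 0 is a block triangular determinant, equal to the determinant of [s]. *)
pose h : {poly K} := 'X * \det (block_mx (1%:M + 'X *: C _ _ M1) ('X *: C _ _ u) (C _ _ w) (C _ _ s)).
have CE q1 q2 (M : 'M[K]_(q1, q2)) t : map_mx (horner_eval t) (C _ _ M) = M.
  by apply/matrixP=> i j; rewrite !mxE /horner_eval hornerC.
have XE q1 q2 (M : 'M[K]_(q1, q2)) t : map_mx (horner_eval t) ('X *: C _ _ M) = t *: M.
  by apply/matrixP=> i j; rewrite !mxE /horner_eval hornerM hornerX hornerC.
have detE t : (\det (block_mx (1%:M + 'X *: C _ _ M1) ('X *: C _ _ u) (C _ _ w) (C _ _ s))).[t] =
    \det (block_mx (1%:M + t *: M1) (t *: u) w s).
  rewrite -[LHS]/(horner_eval t _) -det_map_mx map_block_mx map_mxD map_mx1.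
  by rewrite !XE !CE.
have := tangent_space_differential (h := h) Ip tv.
rewrite /h derivM derivX mul1r hornerD hornerM hornerX mul0r addr0 detE !scale0r addr0.
rewrite det_lblock det1 mul1r => H.
rewrite [LHS]mx11_scalar -det_mx11 -/s H ?raddf0 // => t.
rewrite hornerM hornerX detE minorE pr_line.
have -> : col_mx P l *m (pr z + t *: pr v) *m row_mx Q r =
    block_mx (1%:M + t *: M1) (t *: u) (t *: w) (t *: s).
  rewrite mul_col_mx mul_col_row !mulmxDr !mulmxDl -!scalemxAr -!scalemxAl PQ lz.
  by rewrite -[P *m pr z *m r]mulmxA zr !mul0mx !mulmx0 !add0r.
have -> : block_mx (1%:M + t *: M1) (t *: u) (t *: w) (t *: s) =
    block_mx 1%:M 0 0 (t%:M : 'M_1) *m block_mx (1%:M + t *: M1) (t *: u) w s.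
  by rewrite mulmx_block !mul0mx !addr0 !add0r !mul1mx !mul_scalar_mx.
by rewrite det_mulmx det_ublock det1 mul1r det_scalar1.
Qed.

End Minors.

Section MaximalRank.
Variables (R : realType) (m : nat).
Notation K := R[i].
Notation V := (V R m).
Implicit Types (u v z : V) (Z F : set V).
Variables (G : 'M[polyV R m]_m) (pr : V -> 'M[K]_m).
Hypothesis prG : forall z, map_mx (meval (coords z)) G = pr z.

Lemma generic_rank Z : Z !=set0 -> exists (r : nat) (p : polyV R m),
  [/\ ~ ideal_of Z p, forall z, Z z -> (\rank (pr z) <= r)%N &
      forall z, Z z -> p.@[coords z] != 0 -> \rank (pr z) = r].
Proof.
move=> [z0 Zz0]; pose Q r := `[< exists2 z, Z z & \rank (pr z) = r >].
have Q0 : exists r, Q r by exists (\rank (pr z0)); apply/asboolP; exists z0.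
have Qn r : Q r -> (r <= m)%N by move=> /asboolP[z _ <-]; exact: rank_leq_row.
case: (ex_maxnP Q0 Qn) => _ /asboolP[z1 Zz1 <-] maxr.
have [P [S PS]] := minor_neq0 pr z1.
have maxr' z : Z z -> (\rank (pr z) <= \rank (pr z1))%N.
  by move=> Zz; apply: maxr; apply/asboolP; exists z.
exists (\rank (pr z1)), (minor G P S); split=> // [/(_ z1 Zz1)|z Zz pz].
  by rewrite (minorE prG) PS det1 => /eqP; rewrite oner_eq0.
apply/eqP; rewrite eqn_leq maxr' //= leqNgt; apply: contra pz => rz.
by rewrite (minor_eq0 prG).
Qed.

End MaximalRank.

(** * The case where tr(AB^T) vanishes identically *)

Section ForwardDegenerate.
Variables (R : realType) (m : nat).
Notation K := R[i].
Notation N := (coord_dim m).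
Notation V := (V R m).
Implicit Types (u v z : V) (Z F : set V).
Variable X : set (PV R m).
Hypotheses (hm : (2 <= m)%N) (hX : proj_irreducible X).
Hypotheses (LX : Legendrian X) (XY : X `<=` Y R m).
Let Z := affine_cone X.
Let irrZ : affine_irreducible Z := affine_irreducible_cone hX.
Let closedZ : affine_closed Z. Proof. by case: irrZ. Qed.
Hypothesis deg : forall z, Z z -> \tr (z.1 *m z.2^T) = 0.

Let m0 : (0 < m)%N := ltnW hm.

Lemma degenerate_products z : Z z -> z.1 *m z.2^T = 0 /\ z.2^T *m z.1 = 0.
Proof.
move=> Zz; have [lam [e1 e2]] : exists lam : K,
    z.1 *m z.2^T = (lam ^+ 2)%:M /\ z.2^T *m z.1 = (lam ^+ 2)%:M.
  by apply/cone_Y; move: z Zz; apply/sub_cone.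
have /eqP := etrans (esym (congr1 (@mxtrace _ _) e1)) (deg Zz).
rewrite mxtrace_scalar mulrn_eq0 eqn0Ngt m0 /= => /eqP lam0.
by split; [rewrite [LHS]e1|rewrite [LHS]e2]; rewrite lam0 raddf0.
Qed.

(** Half the sum of the field (A, -B) and the Euler field (A, B) is the projection (A, 0), an
    idempotent; its flow scales A alone, and the cone structure does the rest. *)
Lemma degenerate_scale (A B : 'M[K]_m) (s t : K) : Z (A, B) -> s != 0 -> t != 0 -> Z (s *: A, t *: B).
Proof.
have [g0 nI0 Hg0] := Lagrangian_dense irrZ LX.
have sA (C D : 'M[K]_m) c : Z (C, D) -> Z (c *: C, D).
  move=> ZCD; have : forall t : K, Z ((C, D) + t *: sandwich 1 0 1%:M 1%:M (C, D)).
    apply: (lin_field_closed (c := 1) irrZ nI0) => // [z|z Zz gz].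
      by rewrite /= /sandwich /= !trmx1 !mul1mx !mulmx1 !scale1r !scale0r.
    rewrite /=.
    have T1 : tangent_space Z z (sandwich 1 (-1) 1%:M 1%:M z).
      apply: (hamiltonian_tangent (Hg0 _ Zz gz)) => y Zy.
      by rewrite mulmx1 mul1mx deg.
    have T2 : tangent_space Z z z.
      apply: tangent_space_line => x; rewrite -{1}[z]scale1r -scalerDl; exact: coneZ.
    rewrite [X in tangent_space Z z X](_ : _ = 2^-1 *: (sandwich 1 (-1) 1%:M 1%:M z + z)).
      by apply: tangent_spaceZ; apply: tangent_spaceD.
    rewrite /sandwich /= !trmx1 !mul1mx !mulmx1 !scale1r scale0r scaleN1r; congr pair => /=.
      by rewrite scalerDr -scalerDl (_ : 2^-1 + 2^-1 = 1 :> K) ?scale1r //; field.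
    by rewrite addNr scaler0.
  move=> /(_ (c - 1)); rewrite /sandwich /= !trmx1 !mul1mx !mulmx1 scale1r scale0r.
  rewrite [X in Z X -> _](_ : _ = (c *: C, D)) //; congr pair => /=.
    by rewrite -{1}[C]scale1r -scalerDl addrC subrK.
  by rewrite scaler0 addr0.
move=> ZAB s0 t0; have := coneZ t (sA A B (s / t) ZAB).
rewrite [X in _ X -> _](_ : _ = (s *: A, t *: B)) //; congr pair => /=.
by rewrite scalerA mulrC divfK.
Qed.

Lemma degenerate_ranks : exists z, Z z /\ (\rank z.1 + \rank z.2 = m)%N /\
  forall y, Z y -> (\rank y.1 <= \rank z.1)%N /\ (\rank y.2 <= \rank z.2)%N.
Proof.
have Z0 : Z !=set0 by exists 0; exact: cone0.
have [g0 nI0 Hg0] := Lagrangian_dense irrZ LX.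
have [a [pA [nIA maxA genA_]]] := generic_rank (@map_genA R m) Z0.
have [b [pB [nIB maxB genB_]]] := generic_rank (@map_genB R m) Z0.
have [z Zz] := not_ideal_ofP (not_ideal_ofM irrZ nI0 (not_ideal_ofM irrZ nIA nIB)).
rewrite !mevalM !mulf_eq0 !negb_or => /and3P[gz pAz pBz].
have ra := genA_ z Zz pAz; have rb := genB_ z Zz pBz.
have maxr y : Z y -> (\rank y.1 <= \rank z.1)%N /\ (\rank y.2 <= \rank z.2)%N.
  by move=> Zy; rewrite ra rb maxA // maxB.
exists z; split=> //; split=> //; have [AB BA] := degenerate_products Zz.
apply/eqP; rewrite eqn_leq -{1}[\rank z.2]mxrank_tr mulmx0_rank_max //= leqNgt.
apply/negP => lt_m; have TL := Hg0 z Zz gz.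
(* The left kernels have dimensions adding up to more than m, so they cannot be orthogonal for the
   standard bilinear form. *)
have nz (M1 M2 : 'M[K]_m) : (\rank M1 + \rank M2 < m)%N ->
    exists (x l : 'rV[K]_m), [/\ x *m M1 = 0, l *m M2 = 0 & (l *m x^T) 0 0 != 0].
  move=> lt; have : kermx M2 *m (kermx M1)^T != 0.
    apply/eqP => /mulmx0_rank_max; rewrite mxrank_tr !mxrank_ker.
    by lia.
  move=> /matrix0Pn[i [j ij]]; exists (row j (kermx M1)), (row i (kermx M2)); split.
  - by rewrite -row_mul mulmx_ker row0.
  - by rewrite -row_mul mulmx_ker row0.
  - by move: ij; rewrite !mxE; congr (_ != 0); apply: eq_bigr => k _; rewrite !mxE.
have [|x [l [xB lA lx]]] := nz z.2 z.1; first by rewrite addnC.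
have [|y [r [yB rA ry]]] := nz z.2^T z.1^T; first by rewrite !mxrank_tr addnC.
have Tv : tangent_space Z z (x^T *m y, 0).
  rewrite TL => t tt; rewrite /omega /= trmx0 mulmx0 subr0.
  have : x *m t.2 *m y^T = 0.
    apply: (tangent_minor (@map_genB R m) _ _ tt) => [//|u Zu|//|].
      exact: (maxr u Zu).2.
    by rewrite -[z.2]trmxK -trmx_mul yB trmx0.
  move=> /(congr1 trmx); rewrite !trmx_mul trmxK trmx0 => xty.
  by rewrite -[x^T *m y *m _]mulmxA mxtrace_mulC -mulmxA xty mxtrace0.
have : l *m (x^T *m y) *m r^T = 0.
  apply: (tangent_minor (@map_genA R m) _ _ Tv) => [//|u Zu|//|].
    exact: (maxr u Zu).1.
  by rewrite -[z.1]trmxK -trmx_mul rA trmx0.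
rewrite mulmxA [l *m x^T]mx11_scalar -mulmxA mul_scalar_mx => /eqP.
rewrite scaler_eq0 (negPf lx) /= => /eqP/(congr1 trmx).
by rewrite trmx_mul trmxK trmx0 => ry0; rewrite ry0 mxE eqxx in ry.
Qed.

Lemma degenerate_case : exists k, (k <= m)%N /\ X = X_deg R m k.
Proof.
have [z [Zz [rz maxr]]] := degenerate_ranks.
have [lft rgt] : SL_invariant Z by exact: Legendrian_SL_invariant.
pose k := \rank z.1; have rB : \rank z.2 = (m - k)%N by rewrite /k; lia.
have km : (k <= m)%N by exact: rank_leq_row.
have Zpid : Z (pid_mx k, copid_mx k).
  have [AB BA] := degenerate_products Zz.
  have [P [P' [Q [Q' [s [t [[PP QQ] [dP dQ] [s0 t0] AE BE]]]]]]] :=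
    SL_normal_form m0 AB BA (erefl k) rB.
  have PP' := mulmx1C PP; have QQ' := mulmx1C QQ.
  have dP' : \det P' = 1 by rewrite -[LHS]mulr1 -dP -det_mulmx PP det1.
  have dQ' : \det Q' = 1 by rewrite -[LHS]mulr1 -dQ -det_mulmx QQ det1.
  have ZAB : Z (z.1, z.2) by rewrite -surjective_pairing.
  have := rgt _ _ _ _ QQ' dQ' (lft _ _ _ _ PP' dP' ZAB).
  rewrite {1}AE {1}BE -!scalemxAr -!scalemxAl.
  have -> : P' *m (P *m pid_mx k *m Q) *m Q' = pid_mx k.
    by rewrite -!mulmxA QQ' mulmx1 mulmxA PP mul1mx.
  have -> : P^T *m (P'^T *m copid_mx k *m Q'^T) *m Q^T = copid_mx k.
    by rewrite -!mulmxA -(trmx_mul Q) QQ' trmx1 mulmx1 mulmxA -trmx_mul PP trmx1 mul1mx.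
  have s'0 : s^-1 != 0 by rewrite invr_eq0.
  have t'0 : t^-1 != 0 by rewrite invr_eq0.
  by move/degenerate_scale/(_ s'0 t'0); rewrite !scalerA !mulVf // !scale1r.
have stratum (A B : 'M[K]_m) : A *m B^T = 0 -> B^T *m A = 0 -> \rank A = k ->
    \rank B = (m - k)%N -> Z (A, B).
  move=> AB BA rA rB'.
  have [P [P' [Q [Q' [s [t [[PP QQ] [dP dQ] [s0 t0] -> ->]]]]]]] :=
    SL_normal_form m0 AB BA rA rB'.
  apply: degenerate_scale => //.
  exact: rgt QQ dQ (lft _ _ _ _ PP dP Zpid).
exists k; split=> //; apply/seteqP; split; apply/sub_cone => v.
  move=> Zv; apply/cone_X_deg; have [-> ->] := degenerate_products Zv.
  by have [-> ] := maxr v Zv; rewrite rB.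
move=> /cone_X_deg[AB BA rA rB'].
have [A1 [B1 H]] := pair_approx km AB BA rA rB'.
apply: mem_closed => // p Ip; pose v1 : V := (A1, B1).
have -> : p.@[coords v] = (line (rv v) (rv v1) p).[0].
  by rewrite horner_line scale0r addr0 coordsE.
suff -> : line (rv v) (rv v1) p = 0 by rewrite horner0.
(* The equation is known to vanish on the line only for t nonzero; the factor 'X covers t = 0. *)
have /eqP : 'X * line (rv v) (rv v1) p = 0.
  apply: horner_ext => t; rewrite hornerM hornerX horner0.
  have [->|t0] := eqVneq t 0; first by rewrite mul0r.
  rewrite horner_line (_ : rv v + t *: rv v1 = rv (v + t *: v1)); last by rewrite linearD linearZ.
  rewrite -coordsE Ip ?mulr0 //.
  have [e1 e2 r1 r2] := H t t0; exact: stratum e1 e2 r1 r2.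
by rewrite mulf_eq0 polyX_eq0 /= => /eqP.
Qed.

End ForwardDegenerate.

(** * The varieties X_inv and X_deg are Legendrian *)

Section BackwardDegenerate.
Variables (R : realType) (m : nat).
Notation K := R[i].
Notation N := (coord_dim m).
Notation V := (V R m).
Implicit Types (u v z : V).

Lemma cone_tangent (X : set (PV R m)) z : affine_cone X z -> tangent_space (affine_cone X) z z.
Proof.
move=> Xz; apply: tangent_space_line => t.
by rewrite -{1}[z]scale1r -scalerDl; exact: coneZ.
Qed.

Lemma tangent_space0 (Z : set V) z : tangent_space Z z 0.
Proof. by move=> p _; rewrite big1 // => i _; rewrite coords0 mulr0. Qed.

Lemma quad_tangent_pair (Z : set V) z v :
  (forall y, Z y -> y.1 *m y.2^T = 0 /\ y.2^T *m y.1 = 0) -> tangent_space Z z v ->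
  v.1 *m z.2^T + z.1 *m v.2^T = 0 /\ z.2^T *m v.1 + v.2^T *m z.1 = 0.
Proof.
move=> HZ tv; split; apply: mxtrace_eq0 => g.
  have q0 y : Z y -> \tr (g *m y.1 *m 1%:M *m y.2^T) = 0.
    by move=> /HZ[e _]; rewrite mulmx1 -mulmxA [X in _ *m X]e mulmx0 mxtrace0.
  have := tangent_quad q0 tv; rewrite !mulmx1 => e.
  by rewrite mulmxDr !mulmxA mxtraceD addrC.
have q0 y : Z y -> \tr (1%:M *m y.1 *m g *m y.2^T) = 0.
  move=> /HZ[_ e]; rewrite mul1mx mxtrace_mulC mulmxA.
  by rewrite [X in X *m _]e mul0mx mxtrace0.
have := tangent_quad q0 tv; rewrite !mul1mx => e.
by rewrite mulmxDr mxtraceD ![\tr (g *m _)]mxtrace_mulC -[_ *m v.1 *m g]mulmxA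
  -[_ *m z.1 *m g]mulmxA mxtrace_mulC [X in _ + X]mxtrace_mulC addrC.
Qed.

(** A moment map identity: the perpendicular of the orbit directions is the kernel of the
    differentials of AB^T and B^TA. *)
Lemma omega_orbit u (A B g h : 'M[K]_m) :
  omega u ((g *m A + A *m h, - (g^T *m B) - B *m h^T) : V) =
  - (\tr (g *m (u.1 *m B^T + A *m u.2^T)) + \tr (h *m (B^T *m u.1 + u.2^T *m A))).
Proof.
have e : (- (g^T *m B) - B *m h^T)^T = - (B^T *m g) - h *m B^T.
  by rewrite linearB /= linearN /= !trmx_mul !trmxK.
rewrite /omega /= e mulmxBr mulmxN mulmxDl !mulmxDr.
rewrite !(mxtraceD, raddfB, raddfN) /=.
have e1 : \tr (u.1 *m (B^T *m g)) = \tr (g *m (u.1 *m B^T)) by rewrite mulmxA mxtrace_mulC.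
have e2 : \tr (u.1 *m (h *m B^T)) = \tr (h *m (B^T *m u.1)) by rewrite mxtrace_mulC -mulmxA.
have e3 : \tr (g *m A *m u.2^T) = \tr (g *m (A *m u.2^T)) by rewrite mulmxA.
have e4 : \tr (A *m h *m u.2^T) = \tr (h *m (u.2^T *m A)) by rewrite -mulmxA mxtrace_mulC mulmxA.
rewrite e1 e2 [\tr (_ + _)]mxtraceD e3 e4; ring.
Qed.

(** At points of ranks exactly k and m - k the tangent space lies between the orbit directions and
    the kernel of the differentials of AB^T and B^TA. [pair_orbit_tangent] makes these equal, and
    [omega_orbit] makes the common space its own perpendicular. *)
Lemma Legendrian_X_deg k : (k <= m)%N -> proj_irreducible (X_deg R m k) ->
  Legendrian (X_deg R m k) /\ X_deg R m k `<=` Y R m.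
Proof.
move=> km irrX; have irr := affine_irreducible_cone irrX.
set Z := affine_cone (X_deg R m k) in irr *.
have ZE z : Z z <-> [/\ z.1 *m z.2^T = 0, z.2^T *m z.1 = 0, (\rank z.1 <= k)%N
  & (\rank z.2 <= m - k)%N] by exact: cone_X_deg.
split; last first.
  apply/sub_cone => z /ZE[AB BA _ _]; apply/cone_Y; exists 0.
  by rewrite expr0n raddf0.
pose z0 : V := (pid_mx k, copid_mx k).
have rz0 : \rank z0.1 = k by rewrite rank_pid_mx.
have rz0' : \rank z0.2 = (m - k)%N by rewrite rank_copid_mx.
have Zz0 : Z z0.
  apply/ZE; rewrite rz0 rz0' !leqnn.
  have -> : z0.2^T = copid_mx k by rewrite /z0 /= linearB /= trmx1 tr_pid_mx.
  by split=> //; rewrite /z0 /= ?mul_pid_mx_copid ?mul_copid_mx_pid.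
have [P [S PS]] := minor_neq0 fst z0; have [P' [S' PS']] := minor_neq0 snd z0.
pose gA := minor (genA R m) P S; pose gB := minor (genB R m) P' S'.
have nA : ~ ideal_of Z gA.
  by move=> /(_ z0 Zz0); rewrite (minorE (@map_genA R m)) PS det1 => /eqP; rewrite oner_eq0.
have nB : ~ ideal_of Z gB.
  by move=> /(_ z0 Zz0); rewrite (minorE (@map_genB R m)) PS' det1 => /eqP; rewrite oner_eq0.
apply: (Lagrangian_of_dense irr (not_ideal_ofM irr nA nB)) => z Zz.
rewrite mevalM mulf_eq0 negb_or => /andP[gAz gBz].
have [AB BA rA rB] := (ZE z).1 Zz.
have {gAz}rA : \rank z.1 = k.
  apply/eqP; rewrite eqn_leq rA /= -rz0 leqNgt; apply: contra gAz => lt.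
  by rewrite /gA (minor_eq0 (@map_genA R m)).
have {gBz}rB : \rank z.2 = (m - k)%N.
  apply/eqP; rewrite eqn_leq rB /= -rz0' leqNgt; apply: contra gBz => lt.
  by rewrite /gB (minor_eq0 (@map_genB R m)).
have T0B : tangent_space Z z ((0, z.2) : V).
  apply: tangent_space_line => t; apply/ZE => /=; rewrite !scaler0 !addr0.
  have -> : z.2 + t *: z.2 = (1 + t) *: z.2 by rewrite scalerDl scale1r.
  rewrite [(_ *: _)^T]linearZ /= -scalemxAr -scalemxAl AB BA !scaler0.
  by split=> //; [rewrite rA|rewrite -rB mxrank_scale].
(* [(1 + c t) - t e] inverts [1 + t e] up to the factor [1 + c t]. *)
have einv (e : 'M[K]_m) c t : e *m e = c *: e ->
    ((1 + c * t)%:M - t *: e) *m (1%:M + t *: e) = (1 + c * t)%:M.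
  move=> ee; rewrite mulmxDr mulmx1 mulmxBl mul_scalar_mx -scalemxAl -scalemxAr ee !scalerA.
  rewrite -addrA -[RHS]addr0; congr (_ + _).
  by apply/matrixP=> i j; rewrite !mxE; ring.
have einv' (e : 'M[K]_m) c t : e *m e = c *: e ->
    (1%:M + t *: e) *m ((1 + c * t)%:M - t *: e) = (1 + c * t)%:M.
  move=> ee; rewrite mulmxDl mul1mx mulmxBr mul_mx_scalar -scalemxAl -scalemxAr ee !scalerA.
  rewrite -addrA -[RHS]addr0; congr (_ + _).
  by apply/matrixP=> i j; rewrite !mxE; ring.
have etr (e : 'M[K]_m) c t : ((1 + c * t)%:M - t *: e)^T = (1 + c * t)%:M - t *: e^T.
  by rewrite [LHS]linearB /= tr_scalar_mx [(_ *: _)^T]linearZ.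
(* With the factor 1 + ct cleared, the whole line stays in the cone, even where 1 + te is singular.
   The cost is an extra c (0, B), later removed with [T0B]. *)
have TL e c : e *m e = c *: e -> tangent_space Z z ((e *m z.1, c *: z.2 - e^T *m z.2) : V).
  move=> ee; apply: tangent_space_line => t; apply/ZE => /=.
  have -> : z.1 + t *: (e *m z.1) = (1%:M + t *: e) *m z.1.
    by rewrite mulmxDl mul1mx -scalemxAl.
  have -> : z.2 + t *: (c *: z.2 - e^T *m z.2) = ((1 + c * t)%:M - t *: e)^T *m z.2.
    rewrite etr mulmxBl mul_scalar_mx -scalemxAl.
    by rewrite scalerBr addrA scalerA mulrC scalerDl scale1r.
  rewrite trmx_mul trmxK; split.
  - by rewrite -mulmxA [z.1 *m (_ *m _)]mulmxA AB mul0mx mulmx0.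
  - by rewrite -mulmxA [_ *m (_ *m z.1)]mulmxA einv // mul_scalar_mx -scalemxAr BA scaler0.
  - by rewrite -rA mxrankM_maxr.
  - by rewrite -rB mxrankM_maxr.
have TR e c : e *m e = c *: e -> tangent_space Z z ((z.1 *m e, c *: z.2 - z.2 *m e^T) : V).
  move=> ee; apply: tangent_space_line => t; apply/ZE => /=.
  have -> : z.1 + t *: (z.1 *m e) = z.1 *m (1%:M + t *: e).
    by rewrite mulmxDr mulmx1 -scalemxAr.
  have -> : z.2 + t *: (c *: z.2 - z.2 *m e^T) = z.2 *m ((1 + c * t)%:M - t *: e)^T.
    rewrite etr mulmxBr mul_mx_scalar -scalemxAr.
    by rewrite scalerBr addrA scalerA mulrC scalerDl scale1r.
  rewrite trmx_mul trmxK; split.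
  - by rewrite -mulmxA [(1%:M + _) *m (_ *m _)]mulmxA einv' // mul_scalar_mx -scalemxAr AB scaler0.
  - by rewrite -mulmxA [z.2^T *m (_ *m _)]mulmxA BA mul0mx mulmx0.
  - by rewrite -rA mxrankM_maxl.
  - by rewrite -rB mxrankM_maxl.
have dd (i j : 'I_m) : delta_mx i j *m delta_mx i j = (j == i)%:R *: (delta_mx i j : 'M[K]_m).
  by rewrite mul_delta_mx_cond scaler_nat.
have {}TL g : tangent_space Z z ((g *m z.1, - (g^T *m z.2)) : V).
  move: g; apply: matrix_span => [|g h Tg Th|c g Tg|i j].
  - rewrite trmx0 !mul0mx oppr0; exact: tangent_space0.
  - have := tangent_spaceD Tg Th; congr (tangent_space Z z _); congr pair => /=.
      by rewrite mulmxDl.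
    by rewrite linearD mulmxDl opprD.
  - have := tangent_spaceZ c Tg; congr (tangent_space Z z _); congr pair => /=.
      by rewrite scalemxAl.
    by rewrite linearZ /= -scalemxAl scalerN.
  - have := tangent_spaceD (TL _ _ (dd i j)) (tangent_spaceZ (- (j == i)%:R) T0B).
    congr (tangent_space Z z _); congr pair => /=; first by rewrite scaler0 addr0.
    by rewrite scaleNr addrAC subrr add0r.
have {}TR g : tangent_space Z z ((z.1 *m g, - (z.2 *m g^T)) : V).
  move: g; apply: matrix_span => [|g h Tg Th|c g Tg|i j].
  - rewrite trmx0 !mulmx0 oppr0; exact: tangent_space0.
  - have := tangent_spaceD Tg Th; congr (tangent_space Z z _); congr pair => /=.
      by rewrite mulmxDr.
    by rewrite linearD mulmxDr opprD.
  - have := tangent_spaceZ c Tg; congr (tangent_space Z z _); congr pair => /=.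
      by rewrite scalemxAr.
    by rewrite linearZ /= -scalemxAr scalerN.
  - have := tangent_spaceD (TR _ _ (dd i j)) (tangent_spaceZ (- (j == i)%:R) T0B).
    congr (tangent_space Z z _); congr pair => /=; first by rewrite scaler0 addr0.
    by rewrite scaleNr addrAC subrr add0r.
have TO g h : tangent_space Z z ((g *m z.1 + z.1 *m h, - (g^T *m z.2) - z.2 *m h^T) : V).
  by have := tangent_spaceD (TL g) (TR h).
have HQ v : v.1 *m z.2^T + z.1 *m v.2^T = 0 -> z.2^T *m v.1 + v.2^T *m z.1 = 0 ->
    exists g h, v = (g *m z.1 + z.1 *m h, - (g^T *m z.2) - z.2 *m h^T).
  move=> e1 e2; have [g [h [E1 E2]]] := pair_orbit_tangent AB BA rA rB e1 e2.
  by exists g, h; rewrite [LHS]surjective_pairing E1 E2.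
have TQ v : tangent_space Z z v ->
    v.1 *m z.2^T + z.1 *m v.2^T = 0 /\ z.2^T *m v.1 + v.2^T *m z.1 = 0.
  by apply: quad_tangent_pair => y /ZE[].
apply/seteqP; split=> u.
  move=> /TQ[e1 e2] t /TQ[f1 f2]; have [g [h ->]] := HQ t f1 f2.
  by rewrite omega_orbit e1 e2 !mulmx0 mxtrace0 addr0 oppr0.
move=> Hu; have [||g [h ->]] := HQ u; last exact: TO.
  apply: mxtrace_eq0 => g; have := Hu _ (TO g 0).
  by rewrite omega_orbit mul0mx mxtrace0 addr0 => /eqP; rewrite oppr_eq0 => /eqP.
apply: mxtrace_eq0 => h; have := Hu _ (TO 0 h).
by rewrite omega_orbit mul0mx mxtrace0 add0r => /eqP; rewrite oppr_eq0 => /eqP.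
Qed.

End BackwardDegenerate.

(** * The translates of X_inv *)

Section BackwardInverse.
Variables (R : realType) (m : nat).
Notation K := R[i].
Notation N := (coord_dim m).
Notation V := (V R m).
Implicit Types (u v z : V).
Hypothesis hm : (2 <= m)%N.
Let m0 : (0 < m)%N := ltnW hm.
Let mK : (m%:R : K) != 0. Proof. by rewrite pnatr_eq0 -lt0n. Qed.

Lemma cone_X_inv_min (F : set V) : affine_closed F ->
  (forall (c : K) v, F v -> F (c *: v)) ->
  (forall g h : 'M[K]_m, h *m g = 1%:M -> \det g = 1 -> F (g, h^T)) ->
  affine_cone (X_inv R m) `<=` F.
Proof.
move=> cF FZ Fgh; have F0 : F 0.
  by rewrite -(scale0r ((1%:M, 1%:M^T) : V)); apply: FZ; apply: Fgh; rewrite ?mulmx1 ?det1.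
have FE v : affine_cone (classes_of F) v <-> F v.
  by rewrite cone_classes_of => [|c u _]; [split=> [[->|]//|]; right|exact: FZ].
have cX : proj_closed (classes_of F).
  by apply: proj_closed_cone; rewrite (_ : affine_cone _ = F) //; apply/seteqP; split=> v /FE.
move=> v Xv; apply/FE; move: v Xv; apply/sub_cone; apply: (X_inv_sub cX) => g h hg dg.
by apply/FE; exact: Fgh.
Qed.

Definition bimul (P Q : 'M[K]_m) z : V := (P *m z.1, Q *m z.2).

Lemma bimul_is_linear P Q : linear (bimul P Q).
Proof.
by move=> c u v; rewrite /bimul; congr pair; rewrite /= mulmxDr -scalemxAr.
Qed.

HB.instance Definition _ P Q :=
  GRing.isLinear.Build K V V *:%R (bimul P Q) (bimul_is_linear P Q).

Lemma cone_X_inv_SL (P Q : 'M[K]_m) z : Q *m P = 1%:M -> \det P = 1 ->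
  affine_cone (X_inv R m) z -> affine_cone (X_inv R m) (P *m z.1, Q^T *m z.2).
Proof.
move=> QP dP; move: z; apply: (@cone_X_inv_min [set z | affine_cone (X_inv R m) (bimul P Q^T z)]).
- by apply: affine_closed_preimage; apply: affine_closed_cone; exact: proj_closure_closed.
- by move=> c v /= H; rewrite linearZ; exact: coneZ.
move=> g h hg dg; rewrite /= /bimul /= -trmx_mul; apply: X_inv_mem.
  by rewrite mulmxA -[h *m Q *m P]mulmxA QP mulmx1.
by rewrite det_mulmx dP dg mulr1.
Qed.

(** Equations for [Y] with lambda eliminated; lambda returns as a square root of tr(AB^T)/m. *)
Definition scalar_pair : set V := [set z | forall C : 'M[K]_m, \tr C = 0 ->
  \tr (C *m z.1 *m 1%:M *m z.2^T) = 0 /\ \tr (1%:M *m z.1 *m C *m z.2^T) = 0].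

Lemma scalar_pairE z : affine_cone (Y R m) z <-> scalar_pair z.
Proof.
rewrite cone_Y; split=> [[lam [e1 e2]] C tC|H].
  split.
    by rewrite mulmx1 -mulmxA [X in _ *m X]e1 mul_mx_scalar mxtraceZ tC mulr0.
  by rewrite mul1mx mxtrace_mulC mulmxA [X in X *m _]e2 mul_scalar_mx mxtraceZ tC mulr0.
have e1 := scalar_of_traceless mK (M := z.1 *m z.2^T).
have e2 := scalar_of_traceless mK (M := z.2^T *m z.1).
exists (sqrtC (\tr (z.1 *m z.2^T) / m%:R)); rewrite sqrtCK; split.
  apply: e1 => C /H[+ _]; by rewrite mulmx1 mulmxA.
rewrite mxtrace_mulC; apply: e2 => C /H[_].
by rewrite mul1mx mxtrace_mulC mulmxA => <-; rewrite mxtrace_mulC.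
Qed.

Lemma affine_closed_Y : affine_closed (affine_cone (Y R m)).
Proof.
exists [set p | exists2 C : 'M[K]_m, \tr C = 0 & p = quad C 1%:M \/ p = quad 1%:M C].
apply/seteqP; split=> z.
  by move=> /scalar_pairE H p [C /H[e1 e2] [->|->]]; rewrite quadE.
move=> H; apply/scalar_pairE => C tC.
by rewrite -!quadE; split; apply: H; exists C => //; [left|right].
Qed.

Lemma cone_X_inv_Y z : affine_cone (X_inv R m) z -> affine_cone (Y R m) z.
Proof.
move: z; apply: cone_X_inv_min; [exact: affine_closed_Y|by move=> c v; exact: coneZ|].
move=> g h hg dg; apply/cone_Y; exists 1; rewrite /= trmxK expr1n.
by rewrite hg (mulmx1C hg).
Qed.

Lemma det_polynomials : exists p q : polyV R m,
  forall z, p.@[coords z] = \det z.1 /\ q.@[coords z] = \det z.2.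
Proof.
exists (\det (genA R m)), (\det (genB R m)) => z.
by split; [rewrite -map_genA|rewrite -map_genB]; rewrite det_map_mx.
Qed.

(** The cone of [Y] allows A and B to be scaled independently; this equation removes the surplus
    tangent direction at invertible pairs. *)
Lemma cone_X_inv_det z : affine_cone (X_inv R m) z -> \det z.1 = \det z.2.
Proof.
move=> Xz; apply/eqP; rewrite -subr_eq0; apply/eqP; move: z Xz.
apply: (@cone_X_inv_min [set z | \det z.1 - \det z.2 = 0]).
- have [p [q pqE]] := det_polynomials; exists [set p - q].
  have E z : (p - q).@[coords z] = \det z.1 - \det z.2.
    by have [<- <-] := pqE z; rewrite mevalB.
  apply/seteqP; split=> z /=; first by move=> e _ ->; rewrite E.
  by move=> /(_ _ erefl); rewrite E.
- by move=> c v /= e; rewrite !detZ -mulrBr e mulr0.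
- move=> g h hg dg /=; rewrite det_tr dg.
  by rewrite -(det1 K m) -hg det_mulmx dg mulr1 subrr.
Qed.

Variables (mu : K) (mu0 : mu != 0).
Let X := psi mu0 @` X_inv R m.
Hypothesis irrX : proj_irreducible X.
Let Z := affine_cone X.
Let irr : affine_irreducible Z := affine_irreducible_cone irrX.

Let ZE z : Z z <-> affine_cone (X_inv R m) (mu^-1 *: z.1, mu *: z.2).
Proof. by rewrite /Z cone_psi /rescale invrK. Qed.

Lemma psi_X_inv_sub_Y : X `<=` Y R m.
Proof.
apply/sub_cone => z /ZE/cone_X_inv_Y/cone_Y[lam /= [e1 e2]].
apply/cone_Y; exists lam; move: e1 e2; rewrite linearZ /= -!scalemxAl -!scalemxAr !scalerA.
by rewrite mulfV // mulVf // !scale1r.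
Qed.

Lemma psi_X_inv_SL (P Q : 'M[K]_m) z : Q *m P = 1%:M -> \det P = 1 -> Z z ->
  Z (P *m z.1, Q^T *m z.2).
Proof.
move=> QP dP /ZE/(cone_X_inv_SL QP dP) H; apply/ZE.
by move: H; rewrite /= -!scalemxAr.
Qed.

Lemma psi_X_inv_tangent (a : 'M[K]_m) z : Z z -> \tr a = 0 ->
  tangent_space Z z ((a *m z.1, - (a^T *m z.2)) : V).
Proof.
move=> Zz; move: a; apply: traceless_span => [|g h Tg Th|c g Tg|x y yx].
- rewrite trmx0 !mul0mx oppr0; exact: tangent_space0.
- have := tangent_spaceD Tg Th; congr (tangent_space Z z _); congr pair => /=.
    by rewrite mulmxDl.
  by rewrite linearD mulmxDl opprD.
- have := tangent_spaceZ c Tg; congr (tangent_space Z z _); congr pair => /=.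
    by rewrite scalemxAl.
  by rewrite linearZ /= -scalemxAl scalerN.
apply: tangent_space_line => t.
have yx' : y *m (t *: x) = 0 by rewrite -scalemxAr yx scaler0.
have QP : (1%:M - (t *: x) *m y) *m (1%:M + (t *: x) *m y) = 1%:M.
  rewrite mulmxDr mulmx1 mulmxBl mul1mx -!mulmxA [y *m (_ *m _)]mulmxA yx' mul0mx mulmx0.
  by rewrite subr0 subrK.
have := psi_X_inv_SL QP (det_1_add_rank1 yx') Zz.
congr Z; rewrite [RHS]surjective_pairing; congr pair => /=.
  by rewrite mulmxDl mul1mx -!scalemxAl.
rewrite linearB /= trmx1 mulmxBl mul1mx -scalemxAl [(_ *: _)^T]linearZ /= -scalemxAl.
by rewrite scalerN.
Qed.

(** Where tr(AB^T) is nonzero, a tangent vector is determined by its A-component aA: the quadrics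
    fix the B-component up to a multiple of B, and the determinants fix that multiple. *)
Lemma Legendrian_psi_X_inv : Legendrian X.
Proof.
have nIq : ~ ideal_of Z (quad (1%:M : 'M[K]_m) 1%:M).
  have Zw : Z (mu%:M, mu^-1%:M).
    apply/ZE; rewrite /= !scale_scalar_mx mulVf // mulfV //.
    by rewrite -{2}(trmx1 K m); apply: X_inv_mem; rewrite ?mulmx1 ?det1.
  move=> /(_ _ Zw); rewrite quadE /= mulmx1 mul1mx tr_scalar_mx -scalar_mxM mulfV //.
  by rewrite mxtrace1; apply/eqP.
apply: (Lagrangian_of_dense irr nIq) => z Zz.
rewrite quadE mulmx1 mul1mx => tz.
have YZ y : Z y -> affine_cone (Y R m) y by move: y; apply/sub_cone; exact: psi_X_inv_sub_Y.
have [lam [e1 e2]] : exists lam : K,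
    z.1 *m z.2^T = (lam ^+ 2)%:M /\ z.2^T *m z.1 = (lam ^+ 2)%:M.
  by apply/cone_Y/YZ.
have lam0 := trace_pair e1 tz; move: e1 e2; set l := lam ^+ 2 => e1 e2.
have l0 : l != 0 by rewrite expf_neq0.
set A := z.1 in e1 e2 tz *; set B := z.2 in e1 e2 tz *.
have e3 : A^T *m B = l%:M by rewrite -[B]trmxK -trmx_mul e2 tr_scalar_mx.
(* Split a into its traceless and scalar parts: the first acts by (aA, -a^T B), the second through
   the Euler field (A, B). The opposite signs on B produce the factor 2. *)
pose al (a : 'M[K]_m) := 2 * \tr a / m%:R.
pose L (a : 'M[K]_m) : V := (a *m A, al a *: B - a^T *m B).
have TL a : tangent_space Z z (L a).
  pose a0 := a - (\tr a / m%:R)%:M.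
  have ta0 : \tr a0 = 0.
    by rewrite raddfB /= mxtrace_scalar -[_ / _ *+ m]mulr_natr divfK // subrr.
  have := tangent_spaceD (psi_X_inv_tangent Zz ta0) (tangent_spaceZ (\tr a / m%:R) (cone_tangent Zz)).
  congr (tangent_space Z z _); rewrite /L /a0; congr pair => /=.
    by rewrite mulmxBl mul_scalar_mx subrK.
  rewrite linearB /= tr_scalar_mx mulmxBl mul_scalar_mx opprB.
  rewrite addrAC -scalerDl /al; congr (_ *: _ - _); field; exact: mK.
have split1 v : (l^-1 *: (v.1 *m B^T)) *m A = v.1.
  by rewrite -scalemxAl -mulmxA e2 mul_mx_scalar scalerA mulVf // scale1r.
have split2 v s : v.1 *m B^T + A *m v.2^T = s%:M ->
    v.2 = (s / l) *: B - (l^-1 *: (v.1 *m B^T))^T *m B.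
  move=> es; apply: trmx_inj; rewrite linearB linearZ /= trmx_mul trmxK.
  have -> : v.2^T = l^-1 *: (B^T *m (A *m v.2^T)).
    by rewrite mulmxA e2 mul_scalar_mx scalerA mulVf // scale1r.
  have -> : A *m v.2^T = s%:M - v.1 *m B^T by rewrite -es addrC addKr.
  by rewrite mulmxBr mul_mx_scalar scalerBr scalerA mulrC -scalemxAr.
have TsubL v : tangent_space Z z v -> exists a, v = L a.
  move=> tv; pose a := l^-1 *: (v.1 *m B^T).
  have aA : a *m A = v.1 by exact: split1.
  have [s es] : exists s, v.1 *m B^T + A *m v.2^T = s%:M.
    exists (\tr (v.1 *m B^T + A *m v.2^T) / m%:R); apply: scalar_of_traceless => // C tC.
    have q0 y : Z y -> \tr (C *m y.1 *m 1%:M *m y.2^T) = 0.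
      by move=> Zy; have [] := (scalar_pairE y).1 (YZ y Zy) C tC.
    have := tangent_quad q0 tv; rewrite !mulmx1 => e.
    by rewrite mulmxDr !mulmxA mxtraceD addrC.
  have v2 := split2 v s es; rewrite -/a in v2.
  pose kap := s / l - al a.
  have tk : tangent_space Z z ((0, kap *: B) : V).
    have := tangent_spaceD tv (tangent_spaceZ (-1) (TL a)).
    congr (tangent_space Z z _); rewrite [LHS]surjective_pairing; congr pair => /=.
      by rewrite aA scaleN1r subrr.
    rewrite v2 scaleN1r /kap; move: (a^T *m B) => M.
    by apply/matrixP=> i j; rewrite !mxE; ring.
  have kap0 : kap = 0.
    have [p [q pqE]] := det_polynomials.
    (* The relation between determinants carried over by psi_mu. Along (0, B) its derivative is a
       nonzero multiple of det B, so [kap] must vanish. *)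
    pose d := mu^-1 ^+ m *: p - mu ^+ m *: q.
    have dE y : d.@[coords y] = mu^-1 ^+ m * \det y.1 - mu ^+ m * \det y.2.
      by have [<- <-] := pqE y; rewrite mevalB !mevalZ.
    have Id : ideal_of Z d.
      move=> y /ZE/cone_X_inv_det /= e; rewrite dE -!detZ e subrr //.
    pose h : {poly K} := (mu^-1 ^+ m * \det A)%:P -
      (mu ^+ m * \det B) *: (1 + kap *: 'X) ^+ m.
    have := tangent_space_differential (h := h) Id tk.
    have -> : h^`().[0] = - (mu ^+ m * \det B * (kap *+ m)).
      rewrite /h derivB derivC sub0r derivZ deriv_exp derivD derivC add0r derivZ derivX.
      by rewrite hornerN hornerZ hornerMn hornerM horner_exp !hornerE expr1n mulr1.
    move=> H; apply/eqP; have /eqP : - (mu ^+ m * \det B * (kap *+ m)) = 0.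
      apply: H => t; rewrite dE /= scaler0 addr0 /h !hornerE /=.
      have -> : B + t *: (kap *: B) = (1 + kap * t) *: B.
        by rewrite scalerA scalerDl scale1r mulrC.
      rewrite detZ; ring.
    rewrite oppr_eq0 !mulf_eq0 mulrn_eq0 eqn0Ngt m0 /= expf_eq0 m0 (negPf mu0) /=.
    suff /negPf -> : \det B != 0 by [].
    apply: contraTneq (expf_neq0 m l0) => dB.
    by rewrite -(det_scalar m) -e3 det_mulmx dB mulr0 eqxx.
  exists a; rewrite [LHS]surjective_pairing /L aA; congr pair.
  by rewrite v2; congr (_ *: _ - _); apply/eqP; rewrite -subr_eq0 -/kap kap0.
have omegaL u a : omega u (L a) = al a * \tr (u.1 *m B^T) - \tr (a *m (u.1 *m B^T + A *m u.2^T)).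
  have e : (al a *: B - a^T *m B)^T = al a *: B^T - B^T *m a.
    by rewrite linearB linearZ /= trmx_mul trmxK.
  have t1 : \tr (u.1 *m (B^T *m a)) = \tr (a *m (u.1 *m B^T)) by rewrite mulmxA mxtrace_mulC.
  have t2 : \tr (a *m A *m u.2^T) = \tr (a *m (A *m u.2^T)) by rewrite mulmxA.
  rewrite /omega /= e mulmxBr -scalemxAr !raddfB /= mxtraceZ t1 t2 mulmxDr mxtraceD.
  ring.
apply/seteqP; split=> u.
  move=> /TsubL[b ->] t /TsubL[a ->]; rewrite omegaL /=.
  have -> : (al b *: B - b^T *m B)^T = al b *: B^T - B^T *m b.
    by rewrite linearB linearZ /= trmx_mul trmxK.
  rewrite mulmxBr -scalemxAr mulmxA e1 -[b *m A *m _]mulmxA e1 mul_mx_scalar mul_scalar_mx.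
  rewrite [_ *: b + _]addrC subrK scale_scalar_mx mul_mx_scalar !mxtraceZ /al.
  field; exact: mK.
(* Orthogonality to every [L a], read through the trace form, says that M + A u.2^T is scalar with
   exactly the constant [al] prescribes. *)
move=> Hu; pose M := u.1 *m B^T; pose c := 2 * \tr M / m%:R.
have MN : M + A *m u.2^T = c%:M.
  apply/eqP; rewrite -subr_eq0; apply/eqP; apply: mxtrace_eq0 => a.
  have := Hu _ (TL a); rewrite omegaL -/M => /eqP; rewrite subr_eq0 => /eqP e.
  rewrite mulmxBr raddfB /= -e mul_mx_scalar mxtraceZ /al /c; field; exact: mK.
have -> : u = L (l^-1 *: M).
  rewrite [LHS]surjective_pairing /L split1; congr pair.
  rewrite {1}(split2 u c MN) -/M; congr (_ *: _ - _).
  by rewrite /al /c mxtraceZ; field; rewrite l0 mK.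
exact: TL.
Qed.

End BackwardInverse.

Unset Implicit Arguments.

Theorem theorem1p1 (R : realType) (m : nat) (hm : (2 <= m)%N)
    (X : set (PV R m)) (hX : proj_irreducible X) :
  Legendrian X /\ X `<=` Y R m <->
  (exists (mu : R[i]) (mu0 : mu != 0), X = psi mu0 @` X_inv R m) \/
  (exists k : nat, (k <= m)%N /\ X = X_deg R m k).
Proof.
split=> [[LX XY]|[[mu [mu0 eX]]|[k [km eX]]]]; last 2 first.
- rewrite eX in hX *; split; first exact: Legendrian_psi_X_inv.
  exact: psi_X_inv_sub_Y.
- by rewrite eX in hX *; exact: Legendrian_X_deg.
have [deg|nondeg] := pselect (forall z, affine_cone X z -> \tr (z.1 *m z.2^T) = 0).
  by right; exact: degenerate_case.
left; apply: nondegenerate_case => //.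
by move: nondeg => /existsNP[z /not_implyP[Zz /eqP tz]]; exists z.
Qed.
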